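(* Let $p\ge 1$ and $j\ge 1$ be coprime integers and let $r$ be an integer with $0\le 2r\le 2p+j-2$. Then, for generic $z\in\mathbb{C}\setminus\{0\}$ (identity of meromorphic functions of $z$), \begin{align*} &\chi_{2r}^{(p,2p+j)} (z;q)=\sum_{s=0}^{j-1}z^{-s}q^{\frac{p}{j}s^2}C_{2s,2r}^{(p,2p+j)}(q)\,j(-z^{j}q^{p(j-2s)};q^{2pj})\\ &\ +\frac{1}{(q)_{\infty}^3}\sum_{s=0}^{j-1}(-1)^{p}q^{-\frac{1}{8}+\frac{p(2r+1)^2}{4(2p+j)}}q^{\binom{p}{2}-p(r-s)}z^{-s}\,j(-q^{p(j-2s)}z^{j};q^{2jp})\sum_{m=1}^{p-1}(-1)^{m}q^{\binom{m+1}{2}+m(r-p)} \\ &\quad \times\Big ( j(-q^{m(2p+j)+p(2r+1)};q^{2p(2p+j)} )- q^{m(2p+j)-m(2r+1)}j(-q^{-m(2p+j)+p(2r+1)};q^{2p(2p+j)})\Big )\\ &\quad \times\Big (q^{ms-2ps}\,m(-q^{jm-2ps},-q^{p(j+2s)}z^{-j};q^{2jp}) + q^{-ms}\,m(-q^{jm+2ps},-q^{p(j-2s)}z^{j};q^{2jp})\Big ). \end{align*}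
   Context: Throughout $q=e^{2\pi i\tau}$ with $\operatorname{Im}\tau>0$, $q^{a}:=e^{2\pi i a\tau}$ for rational $a$, and $z=e^{2\pi i w}$, $z^{a}:=e^{2\pi i a w}$. Also $(q)_\infty=\prod_{n\ge1}(1-q^n)$, $\binom{n}{2}=n(n-1)/2$ for all $n\in\mathbb{Z}$, and the theta function is $j(x;q):=\sum_{n\in\mathbb{Z}}(-1)^nq^{\binom n2}x^n$ (the letter $j$ without arguments is an integer). The Appell function is $$m(x,z;q):=\frac{1}{j(z;q)}\sum_{n\in\mathbb{Z}}\frac{(-1)^nq^{\binom n2}z^n}{1-q^{n-1}xz}$$ (defined when neither $z$ nor $xz$ is an integral power of $q$; the letter $m$ without arguments is a summation index). ''Generic'' means that all Appell functions and the character in the formula are defined. Empty sums are $0$. Characters: for coprime integers $p\ge1$, $p'\ge 2$ put $N=p'/p-2$, and let $0\le\ell\le p'-2$. The character of the admissible irreducible highest weight $A_1^{(1)}$-module of level $N$ and spin $\ell$ is (Weyl–Kac formula) the meromorphic function $$\chi_{\ell}^{(p,p')}(z;q)=\frac{\Theta_{\ell+1,p'}(z;q^p)-\Theta_{-(\ell+1),p'}(z;q^p)}{\Theta_{1,2}(z;q)-\Theta_{-1,2}(z;q)},\qquad \Theta_{n,m}(z;q)=\sum_{k\in\mathbb{Z}+n/(2m)}q^{mk^2}z^{-mk}.$$ It is holomorphic in the annulus $|q|<|z|<|q|^{-1}$. String functions: for $N\neq0$ and $m\in2\mathbb{Z}+\ell$, $C_{m,\ell}^{(p,p')}(q)=C^N_{m,\ell}(q)$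 is defined by the expansion in that annulus $$\chi_\ell^{(p,p')}(z;q)=\sum_{m\in2\mathbb{Z}+\ell}C_{m,\ell}^{(p,p')}(q)\,q^{\frac{m^2}{4N}}z^{-\frac m2}.$$ *)

(* Defs.v *)
From Stdlib Require Import Reals ZArith ClassicalEpsilon.
From Coquelicot Require Import Coquelicot.

Open Scope R_scope.

Coercion INR : nat >-> R.

Definition Cexp (x : C) : C :=
  (exp (Re x) * cos (Im x), exp (Re x) * sin (Im x)).

(* [epow x a] is exp(2 pi i a x).  With q = epow tau 1 and z = epow w 1 this is
   the branch-free meaning of the real powers q^a = epow tau a and
   z^a = epow w a. *)
Definition epow (x : C) (a : R) : C :=
  Cexp (RtoC (2 * PI * a) * Ci * x)%C.

Definition Cpowz (x : C) (n : Z) : C :=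
  match n with
  | Z0 => RtoC 1
  | Zpos k => Cpow x (Pos.to_nat k)
  | Zneg k => Cinv (Cpow x (Pos.to_nat k))
  end.

Definition binom2 (n : Z) : Z := (n * (n - 1) / 2)%Z.

(* Total limit operators on C, taken on real and imaginary parts; they return
   junk on divergent input.  All the sums and products they are applied to
   below converge absolutely. *)
Definition CLim_seq (u : nat -> C) : C :=
  (real (Lim_seq (fun n => Re (u n))), real (Lim_seq (fun n => Im (u n)))).

Definition CSeries (a : nat -> C) : C :=
  (Series (fun n => Re (a n)), Series (fun n => Im (a n))).

Definition Zseries (a : Z -> C) : C :=
  (CSeries (fun n => a (Z.of_nat n))
   + CSeries (fun n => a (- Z.of_nat (S n))%Z))%C.

Definition is_Zseries (a : Z -> C) (l : C) : Prop :=
  exists l1 l2 : C,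
    is_series (fun n => a (Z.of_nat n)) l1 /\
    is_series (fun n => a (- Z.of_nat (S n))%Z) l2 /\
    l = (l1 + l2)%C.

(* (q)_infinity *)
Fixpoint qpoch_fin (q : C) (n : nat) : C :=
  match n with
  | O => RtoC 1
  | S k => (qpoch_fin q k * (RtoC 1 - Cpow q (S k)))%C
  end.

Definition qpoch (q : C) : C := CLim_seq (qpoch_fin q).

(* j(x; q) *)
Definition jtheta (x q : C) : C :=
  Zseries (fun n =>
    Cpowz (RtoC (-1)) n * Cpowz q (binom2 n) * Cpowz x n)%C.

(* m(x, z; q) *)
Definition appell (x z q : C) : C :=
  (Zseries (fun n =>
     Cpowz (RtoC (-1)) n * Cpowz q (binom2 n) * Cpowz z n
     / (RtoC 1 - Cpowz q (n - 1) * x * z))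
   / jtheta z q)%C.

Definition appell_defined (x z q : C) : Prop :=
  (forall n : Z, z <> Cpowz q n) /\ (forall n : Z, (x * z)%C <> Cpowz q n).

(* Theta_{n,m}(z; q), for z = exp(2 pi i w) and q = exp(2 pi i tau); replacing
   q by q^p amounts to replacing tau by p tau. *)
Definition Theta (n m : R) (w tau : C) : C :=
  Zseries (fun i =>
    let k := (IZR i + n / (2 * m))%R in
    epow tau (m * k ^ 2) * epow w (- (m * k)))%C.

Definition char_den (w tau : C) : C :=
  (Theta 1 2 w tau - Theta (-1) 2 w tau)%C.

Definition character (p p' l : nat) (w tau : C) : C :=
  ((Theta (l + 1) p' w (RtoC p * tau) - Theta (- (l + 1)) p' w (RtoC p * tau))
   / char_den w tau)%C.

(* The quotient defining the character makes sense off the zeros of its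
   denominator; as a meromorphic function the character is determined there. *)
Definition character_defined (w tau : C) : Prop := char_den w tau <> RtoC 0.

Definition level (p p' : nat) : R := p' / p - 2.

(* [c] is a family of coefficients, indexed by m = 2 n + l, of the expansion of
   the character in the annulus |q| < |z| < |q|^(-1).  The only points of the
   annulus left out are those over z = 1, where the character has a removable
   singularity and the quotient reads 0 / 0. *)
Definition string_expansion (p p' l : nat) (tau : C) (c : Z -> C) : Prop :=
  forall w : C,
    Cmod (epow tau 1) < Cmod (epow w 1) < / Cmod (epow tau 1) ->
    character_defined w tau ->
    is_Zseries
      (fun n =>
         let m := (2 * n + Z.of_nat l)%Z in
         c m * epow tau (IZR m ^ 2 / (4 * level p p'))
         * epow w (- (IZR m / 2)))%C
      (character p p' l w tau).

(* C_{m,l}^{(p,p')}(q), for m of the same parity as l (no meaning is attached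
   to the other values of m). *)
Definition string_function (p p' : nat) (m : Z) (l : nat) (tau : C) : C :=
  epsilon (inhabits (fun _ : Z => RtoC 0)) (string_expansion p p' l tau) m.

(* Main.v *)
(* Write j(z) for j(z; q) and N(z) for the Weyl-Kac numerator, so that the
   character is N/j up to a power of q.  Its poles are the zeros z = q^(-n) of j
   with p not dividing n.  The sums

     Sum_nu q^(j p nu^2) z^(j nu) y^u / (1 - y),   y = q^(2 p nu + n) z,

   have the same quasi-periodicity under z -> q^(2p) z as N/j; weighted by the
   residues of N/j they give a polar part G, which is the Appell function part
   of the theorem once 1/(1 - y) is written with denominators 1 - y^j.  The
   product j G is a Laurent series converging for all z <> 0, so is
   e = N - j G, and e vanishes at all powers of q.

   Division by j is carried out on Laurent coefficients: those of (q)_oo^3 / j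
   in |q| < |z| < 1 are sig k = Sum_(n >= 0) (-1)^n q^(n(n+1)/2 + n k), and the
   relation sig (k-1) = 1 - q^k sig k turns the vanishing of e at the powers of
   q into a recursion for the coefficients of e/j.  With quasi-periodicity this
   makes e/j = N/j - G a combination of j theta functions.  In the annulus
   |q| < |z| < 1/|q| the geometric expansion of G has no term z^(-s) with
   0 <= s < j, so the coefficients of that combination are string functions. *)

Require Import Defs.
From Stdlib Require Import Reals ZArith Lra Lia Psatz ClassicalEpsilon.
From Coquelicot Require Import Coquelicot.
Open Scope R_scope.

(** * Series over Z *)

(** Since [sig k] tends to 1 as k grows, dividing by j on coefficients gives at first only bounded
    coefficients. Their Gaussian decay comes from the recursion: 2p uses of the [sig] relation move
    the index by -2p and replace e_i by q^(2pi) e_i, which quasi-periodicity turns into a multiple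
    of e_(i+P), where P = 2p + j; the net step is j.

    The numerator is odd under z -> 1/z up to a monomial. Hence it vanishes at 1 and at q^p, and the
    weights at n and -n are opposite; this pairing yields the two Appell functions for each m = n +
    p with n < 0. The residues leave the exponent u free. The choice u = 1 - j for n < 0 and u = 1
    for n > 0 serves both the gap in the annulus expansion and the finite geometric sums that create
    the denominators in y^j.

    The constant (q)_oo^3 first appears as the value of j(z)/(1 - z) at z = 1; its identification is
    Jacobi's identity, read off from the first moment of the finite triple product. String functions
    are known only through a convergent expansion, so Laurent uniqueness starts from bare
    convergence and uses averages over roots of unity in place of contour integrals. *)

Definition Cconv (u : nat -> C) (l : C) : Prop :=
  forall eps : R, 0 < eps ->
  exists N : nat, forall n : nat, (N <= n)%nat -> Cmod (u n - l) < eps.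

Fixpoint csum (n : nat) (f : nat -> C) : C :=
  match n with
  | O => RtoC 0
  | S k => (csum k f + f k)%C
  end.

Fixpoint rsum (n : nat) (f : nat -> R) : R :=
  match n with
  | O => 0
  | S k => rsum k f + f k
  end.

Lemma Cmod_sub_sym (x y : C) : Cmod (x - y) = Cmod (y - x).
Proof.
rewrite <- (Cmod_opp (x - y)). f_equal. ring.
Qed.

Lemma Cmod_re_im (c : C) : Cmod c <= Rabs (Re c) + Rabs (Im c).
Proof.
replace c with (RtoC (Re c) + Ci * RtoC (Im c))%C at 1.
- eapply Rle_trans. apply Cmod_triangle.
  rewrite Cmod_mult, Cmod_Ci, !Cmod_R. lra.
- destruct c as [a b]. unfold Re, Im. simpl.
  apply injective_projections; simpl; ring.
Qed.

Lemma im_le_Cmod (c : C) : Rabs (Im c) <= Cmod c.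
Proof.
eapply Rle_trans; [|apply Rmax_Cmod]. apply Rmax_r.
Qed.

Lemma Cconv_unique (u : nat -> C) (l l' : C) :
  Cconv u l -> Cconv u l' -> l = l'.
Proof.
intros H H'. apply Ceq_minus.
apply Cmod_eq_0.
destruct (Req_dec (Cmod (l - l')) 0) as [E|E]; [exact E|exfalso].
assert (P : 0 < Cmod (l - l')) by (pose proof (Cmod_ge_0 (l - l')); lra).
destruct (H (Cmod (l - l') / 2)) as [N HN]; [lra|].
destruct (H' (Cmod (l - l') / 2)) as [N' HN']; [lra|].
specialize (HN (N + N')%nat ltac:(lia)). specialize (HN' (N + N')%nat ltac:(lia)).
assert (T := Cmod_triangle (l - u (N + N')%nat) (u (N + N')%nat - l')).
replace (l - u (N + N')%nat + (u (N + N')%nat - l'))%C with (l - l')%C in T by ring.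
rewrite Cmod_sub_sym in HN. lra.
Qed.

Lemma Cconv_ext (u v : nat -> C) (l : C) :
  (forall n, u n = v n) -> Cconv u l -> Cconv v l.
Proof.
intros E H eps He. destruct (H eps He) as [N HN]. exists N.
intros n Hn. rewrite <- E. auto.
Qed.

Lemma Cconv_const (l : C) : Cconv (fun _ => l) l.
Proof.
intros eps He. exists O. intros n _.
replace (l - l)%C with (RtoC 0) by ring. now rewrite Cmod_0.
Qed.

Lemma Cconv_plus (u v : nat -> C) (l m : C) :
  Cconv u l -> Cconv v m -> Cconv (fun n => u n + v n)%C (l + m)%C.
Proof.
intros H H' eps He.
destruct (H (eps / 2)) as [N HN]; [lra|].
destruct (H' (eps / 2)) as [N' HN']; [lra|].
exists (N + N')%nat. intros n Hn.
specialize (HN n ltac:(lia)). specialize (HN' n ltac:(lia)).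
replace (u n + v n - (l + m))%C with ((u n - l) + (v n - m))%C by ring.
eapply Rle_lt_trans; [apply Cmod_triangle|lra].
Qed.

Lemma Cconv_scal (c : C) (u : nat -> C) (l : C) :
  Cconv u l -> Cconv (fun n => c * u n)%C (c * l)%C.
Proof.
intros H eps He. pose proof (Cmod_ge_0 c).
destruct (H (eps / (Cmod c + 1))) as [N HN].
{ apply Rdiv_lt_0_compat; lra. }
exists N. intros n Hn. specialize (HN n Hn).
replace (c * u n - c * l)%C with (c * (u n - l))%C by ring.
rewrite Cmod_mult. pose proof (Cmod_ge_0 (u n - l)).
apply Rlt_div_r in HN; [|lra]. nra.
Qed.

Lemma Cconv_subseq (u : nat -> C) (l : C) (phi : nat -> nat) :
  (forall n, (n <= phi n)%nat) -> Cconv u l -> Cconv (fun n => u (phi n)) l.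
Proof.
intros Hp H eps He. destruct (H eps He) as [N HN]. exists N.
intros n Hn. apply HN. specialize (Hp n). lia.
Qed.

Lemma Cconv_csum (m : nat) (u : nat -> nat -> C) (l : nat -> C) :
  (forall k, (k < m)%nat -> Cconv (fun n => u n k) (l k)) ->
  Cconv (fun n => csum m (u n)) (csum m l).
Proof.
induction m as [|m IH]; intros H; simpl.
- apply Cconv_const.
- apply Cconv_plus; auto.
Qed.

Lemma Cconv_mod_le (u : nat -> C) (l : C) (M : R) :
  (forall n, Cmod (u n) <= M) -> Cconv u l -> Cmod l <= M.
Proof.
intros H Hc. apply Rnot_lt_le. intros L.
destruct (Hc (Cmod l - M)) as [N HN]; [lra|].
specialize (HN N (le_n N)). specialize (H N).
assert (T := Cmod_triangle (l - u N) (u N)).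
replace (l - u N + u N)%C with l in T by ring.
rewrite Cmod_sub_sym in HN. lra.
Qed.

Lemma csum_ext (n : nat) (f g : nat -> C) :
  (forall k, (k < n)%nat -> f k = g k) -> csum n f = csum n g.
Proof.
induction n as [|n IH]; intros H; simpl; [easy|].
rewrite IH, H; auto.
Qed.

Lemma csum_plus (n : nat) (f g : nat -> C) :
  csum n (fun k => f k + g k)%C = (csum n f + csum n g)%C.
Proof.
induction n as [|n IH]; simpl; [ring|rewrite IH; ring].
Qed.

Lemma csum_scal (n : nat) (c : C) (f : nat -> C) :
  csum n (fun k => c * f k)%C = (c * csum n f)%C.
Proof.
induction n as [|n IH]; simpl; [ring|rewrite IH; ring].
Qed.

Lemma csum_zero (n : nat) : csum n (fun _ => RtoC 0) = 0.
Proof.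
induction n as [|n IH]; simpl; [easy|rewrite IH; ring].
Qed.

Lemma csum_exchange (n m : nat) (f : nat -> nat -> C) :
  csum n (fun i => csum m (f i)) = csum m (fun j => csum n (fun i => f i j)).
Proof.
induction n as [|n IH]; simpl.
- now rewrite csum_zero.
- now rewrite IH, csum_plus.
Qed.

Lemma csum_shift (n : nat) (f : nat -> C) :
  csum (S n) f = (f O + csum n (fun k => f (S k)))%C.
Proof.
induction n as [|n IH]; simpl; [ring|].
simpl in IH. rewrite IH. ring.
Qed.

Lemma csum_rev (n : nat) (f : nat -> C) :
  csum n f = csum n (fun k => f (n - 1 - k)%nat).
Proof.
revert f. induction n as [|n IH]; intros f; [easy|].
rewrite csum_shift. simpl. rewrite Cplus_comm.
rewrite IH. f_equal; [|f_equal; lia].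
apply csum_ext. intros k Hk. f_equal. lia.
Qed.

Lemma csum_single (n i : nat) (f : nat -> C) :
  (i < n)%nat -> (forall k, (k < n)%nat -> k <> i -> f k = 0) ->
  csum n f = f i.
Proof.
intros Hi H. induction n as [|n IH]; [lia|]. simpl.
destruct (Nat.eq_dec i n) as [->|E].
- rewrite (csum_ext n f (fun _ => RtoC 0)).
  + rewrite csum_zero. ring.
  + intros k Hk. apply H; lia.
- rewrite IH; [rewrite (H n); [ring|lia|auto]|lia|intros; apply H; lia].
Qed.

Lemma csum_mod_le (n : nat) (f : nat -> C) :
  Cmod (csum n f) <= rsum n (fun k => Cmod (f k)).
Proof.
induction n as [|n IH]; simpl.
- rewrite Cmod_0. lra.
- eapply Rle_trans; [apply Cmod_triangle|]. lra.
Qed.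

Lemma rsum_le (n : nat) (f g : nat -> R) :
  (forall k, (k < n)%nat -> f k <= g k) -> rsum n f <= rsum n g.
Proof.
induction n as [|n IH]; intros H; simpl; [lra|].
apply Rplus_le_compat; auto.
Qed.

Lemma rsum_sum_n (n : nat) (f : nat -> R) : rsum (S n) f = sum_n f n.
Proof.
induction n as [|n IH].
- rewrite sum_O. simpl. ring.
- rewrite sum_Sn, <- IH. reflexivity.
Qed.

Lemma csum_sum_n (n : nat) (f : nat -> C) : csum (S n) f = sum_n f n.
Proof.
induction n as [|n IH].
- rewrite sum_O. simpl. ring.
- rewrite sum_Sn, <- IH. reflexivity.
Qed.

Lemma rsum_le_Series (n : nat) (f : nat -> R) :
  (forall k, 0 <= f k) -> ex_series f -> rsum n f <= Series f.
Proof.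
intros Hp Hf.
assert (M : forall i, rsum n f <= rsum (n + i) f).
{ induction i as [|i IH].
  - rewrite Nat.add_0_r. lra.
  - rewrite Nat.add_succ_r. simpl. specialize (Hp (n + i)%nat). lra. }
apply Series_correct in Hf.
assert (L : is_lim_seq (fun i => sum_n f i) (Series f)) by exact Hf.
apply (is_lim_seq_incr_n _ n) in L.
refine (is_lim_seq_le _ _ (Finite (rsum n f)) (Finite (Series f)) _
          (is_lim_seq_const _) L).
intros i. rewrite <- rsum_sum_n. simpl.
specialize (M i). specialize (Hp (i + n)%nat).
rewrite (Nat.add_comm i n) in *. lra.
Qed.

Lemma ex_series_bound (f : nat -> R) (M : R) :
  (forall k, 0 <= f k) -> (forall n, rsum n f <= M) -> ex_series f.
Proof.
intros Hp H.
destruct (ex_finite_lim_seq_incr (sum_n f) M) as [l Hl].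
- intros n. rewrite sum_Sn. specialize (Hp (S n)). unfold plus; simpl. lra.
- intros n. rewrite <- rsum_sum_n. apply H.
- exists l. exact Hl.
Qed.

Lemma ex_series_dom (f g : nat -> R) :
  (forall n, 0 <= f n <= g n) -> ex_series g -> ex_series f.
Proof.
intros H. apply (ex_series_le f g). intros n. destruct (H n).
change (Rabs (f n) <= g n). now rewrite Rabs_right by lra.
Qed.

Lemma csum_re (n : nat) (f : nat -> C) : Re (csum n f) = rsum n (fun k => Re (f k)).
Proof.
induction n as [|n IH]; simpl; [easy|]. now rewrite <- IH.
Qed.

Lemma csum_im (n : nat) (f : nat -> C) : Im (csum n f) = rsum n (fun k => Im (f k)).
Proof.
induction n as [|n IH]; simpl; [easy|]. now rewrite <- IH.
Qed.

Lemma rsum_conv (f : nat -> R) :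
  ex_series f -> forall eps, 0 < eps ->
  exists N, forall n, (N <= n)%nat -> Rabs (rsum n f - Series f) < eps.
Proof.
intros Hf eps He. apply Series_correct in Hf.
assert (L : is_lim_seq (fun i => sum_n f i) (Series f)) by exact Hf.
apply is_lim_seq_spec in L. destruct (L (mkposreal eps He)) as [N HN].
exists (S N). intros [|n] Hn; [lia|]. rewrite rsum_sum_n. apply HN. lia.
Qed.

Lemma CSeries_conv (a : nat -> C) :
  ex_series (fun n => Cmod (a n)) -> Cconv (fun n => csum n a) (CSeries a).
Proof.
intros H eps He.
assert (HR : ex_series (fun n => Re (a n))).
{ apply (ex_series_le (fun n => Re (a n)) (fun n => Cmod (a n))); [|exact H].
  intros n. apply re_le_Cmod. }
assert (HI : ex_series (fun n => Im (a n))).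
{ apply (ex_series_le (fun n => Im (a n)) (fun n => Cmod (a n))); [|exact H].
  intros n. apply im_le_Cmod. }
destruct (rsum_conv _ HR (eps / 2)) as [N HN]; [lra|].
destruct (rsum_conv _ HI (eps / 2)) as [N' HN']; [lra|].
exists (N + N')%nat. intros n Hn.
specialize (HN n ltac:(lia)). specialize (HN' n ltac:(lia)).
eapply Rle_lt_trans; [apply Cmod_re_im|].
replace (Re (csum n a - CSeries a)) with (Re (csum n a) - Series (fun n => Re (a n)))
  by reflexivity.
replace (Im (csum n a - CSeries a)) with (Im (csum n a) - Series (fun n => Im (a n)))
  by reflexivity.
rewrite csum_re, csum_im. lra.
Qed.

Lemma is_series_Cconv (a : nat -> C) (l : C) :
  is_series a l <-> Cconv (fun n => csum n a) l.
Proof.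
split.
- intros H eps He.
  assert (F := proj1 (filterlim_locally_ball_norm (sum_n a) l) H (mkposreal eps He)).
  destruct F as [N HN]. exists (S N). intros [|n] Hn; [lia|].
  specialize (HN n ltac:(lia)). unfold ball_norm in HN.
  rewrite csum_sum_n. exact HN.
- intros H.
  apply (proj2 (filterlim_locally_ball_norm (sum_n a) l)).
  intros eps. destruct (H eps (cond_pos eps)) as [N HN].
  exists N. intros n Hn. unfold ball_norm. rewrite <- csum_sum_n.
  exact (HN (S n) ltac:(lia)).
Qed.

(* Series over Z are folded over nat, as in [Zseries]. *)
Definition zfold (a : Z -> C) (n : nat) : C :=
  (a (Z.of_nat n) + a (- Z.of_nat (S n))%Z)%C.

Definition zmod (a : Z -> C) (n : nat) : R :=
  Cmod (a (Z.of_nat n)) + Cmod (a (- Z.of_nat (S n))%Z).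

Definition asum (a : Z -> C) : Prop := ex_series (zmod a).

Definition Zabs (a : Z -> C) : R := Series (zmod a).

Lemma zmod_ge0 (a : Z -> C) (n : nat) : 0 <= zmod a n.
Proof.
apply Rplus_le_le_0_compat; apply Cmod_ge_0.
Qed.

Lemma zfold_le (a : Z -> C) (n : nat) : Cmod (zfold a n) <= zmod a n.
Proof. apply Cmod_triangle. Qed.

Lemma zmod_le (a b : Z -> C) (n : nat) :
  (forall k, Cmod (a k) <= Cmod (b k)) -> zmod a n <= zmod b n.
Proof. intros H. apply Rplus_le_compat; apply H. Qed.

Lemma asum_le (a b : Z -> C) :
  (forall k, Cmod (a k) <= Cmod (b k)) -> asum b -> asum a.
Proof.
intros H. apply (ex_series_dom (zmod a) (zmod b)).
intros n. split; [apply zmod_ge0|now apply zmod_le].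
Qed.

Lemma asum_ext (a b : Z -> C) : (forall k, a k = b k) -> asum a -> asum b.
Proof.
intros H. apply asum_le. intros k. rewrite H. lra.
Qed.

Lemma Zabs_le (a b : Z -> C) :
  (forall k, Cmod (a k) <= Cmod (b k)) -> asum b -> Zabs a <= Zabs b.
Proof.
intros H Hb. apply Series_le; [|exact Hb].
intros n. split; [apply zmod_ge0|now apply zmod_le].
Qed.

Lemma asum_half (a : Z -> C) : asum a ->
  ex_series (fun n => Cmod (a (Z.of_nat n))) /\
  ex_series (fun n => Cmod (a (- Z.of_nat (S n))%Z)).
Proof.
intros H. split; refine (ex_series_dom _ _ _ H); intros n; unfold zmod;
  pose proof (Cmod_ge_0 (a (Z.of_nat n))); pose proof (Cmod_ge_0 (a (- Z.of_nat (S n))%Z)); lra.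
Qed.

Lemma Zseries_conv (a : Z -> C) :
  asum a -> Cconv (fun n => csum n (zfold a)) (Zseries a).
Proof.
intros H. destruct (asum_half a H) as [H1 H2].
eapply Cconv_ext; [|exact (Cconv_plus _ _ _ _ (CSeries_conv _ H1) (CSeries_conv _ H2))].
intros n. simpl. now rewrite <- csum_plus.
Qed.

Lemma is_Zseries_asum (a : Z -> C) : asum a -> is_Zseries a (Zseries a).
Proof.
intros H. destruct (asum_half a H) as [H1 H2].
exists (CSeries (fun n => a (Z.of_nat n))), (CSeries (fun n => a (- Z.of_nat (S n))%Z)).
repeat split.
- now apply is_series_Cconv, CSeries_conv.
- now apply is_series_Cconv, (CSeries_conv (fun n => a (- Z.of_nat (S n))%Z)).
Qed.

Lemma is_Zseries_conv (a : Z -> C) (l : C) :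
  is_Zseries a l -> Cconv (fun n => csum n (zfold a)) l.
Proof.
intros (l1 & l2 & H1 & H2 & ->).
apply is_series_Cconv in H1. apply is_series_Cconv in H2.
eapply Cconv_ext; [|exact (Cconv_plus _ _ _ _ H1 H2)].
intros n. simpl. now rewrite <- csum_plus.
Qed.

Lemma is_Zseries_unique (a : Z -> C) (l : C) :
  asum a -> is_Zseries a l -> Zseries a = l.
Proof.
intros H Hl. eapply Cconv_unique; [now apply Zseries_conv|now apply is_Zseries_conv].
Qed.

Lemma Zseries_ext (a b : Z -> C) : (forall k, a k = b k) -> Zseries a = Zseries b.
Proof.
intros H. unfold Zseries, CSeries.
f_equal; apply injective_projections; simpl; apply Series_ext; intros n; now rewrite H.
Qed.

Lemma asum_plus (a b : Z -> C) : asum a -> asum b -> asum (fun k => a k + b k)%C.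
Proof.
intros Ha Hb.
apply (ex_series_dom _ (fun n => zmod a n + zmod b n)).
- intros n. split; [apply zmod_ge0|]. unfold zmod.
  assert (T1 := Cmod_triangle (a (Z.of_nat n)) (b (Z.of_nat n))).
  assert (T2 := Cmod_triangle (a (- Z.of_nat (S n))%Z) (b (- Z.of_nat (S n))%Z)).
  simpl in *. lra.
- exact (ex_series_plus (zmod a) (zmod b) Ha Hb).
Qed.

Lemma zmod_scal (c : C) (a : Z -> C) (n : nat) :
  zmod (fun k => c * a k)%C n = Cmod c * zmod a n.
Proof. unfold zmod. rewrite !Cmod_mult. ring. Qed.

Lemma asum_scal (c : C) (a : Z -> C) : asum a -> asum (fun k => c * a k)%C.
Proof.
intros Ha. unfold asum.
apply (ex_series_ext (fun n => scal (Cmod c) (zmod a n))).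
- intros n. now rewrite zmod_scal.
- now apply (ex_series_scal (Cmod c) (zmod a)).
Qed.

Lemma Zabs_scal (c : C) (a : Z -> C) :
  Zabs (fun k => c * a k)%C = Cmod c * Zabs a.
Proof.
unfold Zabs. rewrite <- Series_scal_l. apply Series_ext. intros n. apply zmod_scal.
Qed.

Lemma Zseries_plus (a b : Z -> C) : asum a -> asum b ->
  Zseries (fun k => a k + b k)%C = (Zseries a + Zseries b)%C.
Proof.
intros Ha Hb. eapply Cconv_unique; [apply Zseries_conv, asum_plus; auto|].
eapply Cconv_ext; [|apply Cconv_plus; apply Zseries_conv; eassumption].
intros n. simpl. rewrite <- csum_plus. apply csum_ext. intros k _.
unfold zfold. ring.
Qed.

Lemma Zseries_scal (c : C) (a : Z -> C) : asum a ->
  Zseries (fun k => c * a k)%C = (c * Zseries a)%C.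
Proof.
intros Ha. eapply Cconv_unique; [apply Zseries_conv, asum_scal; auto|].
eapply Cconv_ext; [|apply Cconv_scal; apply Zseries_conv; eassumption].
intros n. simpl. rewrite <- csum_scal. apply csum_ext. intros k _.
unfold zfold. ring.
Qed.

Lemma asum_zero : asum (fun _ => RtoC 0).
Proof.
apply (ex_series_bound _ 0).
- apply zmod_ge0.
- intros n. induction n as [|n IH]; cbn [rsum]; [lra|].
  unfold zmod at 2. rewrite Cmod_0. lra.
Qed.

Lemma Zseries_zero : Zseries (fun _ => RtoC 0) = 0.
Proof.
replace (Zseries (fun _ => RtoC 0)) with (Zseries (fun _ => RtoC 0 * RtoC 0)%C)
  by (apply Zseries_ext; intros; ring).
rewrite (Zseries_scal (RtoC 0) (fun _ => RtoC 0)); [ring|apply asum_zero].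
Qed.

Lemma asum_csum (m : nat) (f : nat -> Z -> C) :
  (forall i, (i < m)%nat -> asum (f i)) -> asum (fun k => csum m (fun i => f i k)).
Proof.
induction m as [|m IH]; intros H; simpl; [apply asum_zero|].
apply asum_plus; auto.
Qed.

Lemma Zseries_csum (m : nat) (f : nat -> Z -> C) :
  (forall i, (i < m)%nat -> asum (f i)) ->
  Zseries (fun k => csum m (fun i => f i k)) = csum m (fun i => Zseries (f i)).
Proof.
induction m as [|m IH]; intros H; simpl; [apply Zseries_zero|].
rewrite Zseries_plus; [rewrite IH; auto|apply asum_csum; auto|auto].
Qed.

Lemma Zabs_ge0 (a : Z -> C) : asum a -> 0 <= Zabs a.
Proof. intros H. exact (rsum_le_Series 0 (zmod a) (zmod_ge0 a) H). Qed.

Lemma zpart_le_Zabs (a : Z -> C) (n : nat) : asum a -> rsum n (zmod a) <= Zabs a.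
Proof. intros H. apply rsum_le_Series; [apply zmod_ge0|exact H]. Qed.

Lemma Zseries_le (a : Z -> C) : asum a -> Cmod (Zseries a) <= Zabs a.
Proof.
intros H. eapply Cconv_mod_le; [|apply Zseries_conv, H].
intros n. simpl. eapply Rle_trans; [apply csum_mod_le|].
eapply Rle_trans; [|apply (zpart_le_Zabs a n H)].
apply rsum_le. intros. apply zfold_le.
Qed.

Lemma term_le_Zabs (a : Z -> C) (k : Z) : asum a -> Cmod (a k) <= Zabs a.
Proof.
intros H. destruct (Z_le_gt_dec 0 k) as [L|L].
- eapply Rle_trans; [|apply (zpart_le_Zabs a (S (Z.to_nat k)) H)].
  simpl. unfold zmod at 2. rewrite Z2Nat.id by lia.
  assert (0 <= rsum (Z.to_nat k) (zmod a)).
  { induction (Z.to_nat k); simpl; [lra|]. pose proof (zmod_ge0 a n). lra. }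
  pose proof (Cmod_ge_0 (a (- Z.of_nat (S (Z.to_nat k)))%Z)). simpl in *. lra.
- set (m := Z.to_nat (- k - 1)).
  eapply Rle_trans; [|apply (zpart_le_Zabs a (S m) H)].
  simpl rsum. unfold zmod at 2.
  replace (- Z.of_nat (S m))%Z with k by (unfold m; lia).
  assert (0 <= rsum m (zmod a)).
  { induction m; simpl; [lra|]. pose proof (zmod_ge0 a m). lra. }
  pose proof (Cmod_ge_0 (a (Z.of_nat m))). lra.
Qed.

Lemma Zseries_tail (a b : Z -> C) (N : nat) :
  (forall k, Cmod (a k) <= Cmod (b k)) -> asum b ->
  Cmod (Zseries a - csum N (zfold a)) <= Zabs b - rsum N (zmod b).
Proof.
intros H Hb. assert (Ha := asum_le a b H Hb).
apply (Cconv_mod_le (fun n => csum (N + n) (zfold a) + - csum N (zfold a))%C).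
- intros n.
  assert (T : Cmod (csum (N + n) (zfold a) + - csum N (zfold a)) <=
              rsum (N + n) (zmod b) - rsum N (zmod b)).
  { induction n as [|n IH].
    - rewrite Nat.add_0_r. rewrite Cplus_opp_r, Cmod_0. lra.
    - rewrite Nat.add_succ_r. simpl.
      replace (csum (N + n) (zfold a) + zfold a (N + n)%nat + - csum N (zfold a))%C
        with ((csum (N + n) (zfold a) + - csum N (zfold a)) + zfold a (N + n)%nat)%C by ring.
      eapply Rle_trans; [apply Cmod_triangle|].
      pose proof (zfold_le a (N + n)). pose proof (zmod_le a b (N + n) H). lra. }
  pose proof (zpart_le_Zabs b (N + n) Hb). lra.
- apply Cconv_plus; [|apply Cconv_const].
  apply (Cconv_subseq (fun n => csum n (zfold a)) _ (fun n => (N + n)%nat)); [intros; lia|].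
  now apply Zseries_conv.
Qed.

(** Dominated convergence: cut where the tail of the majorant is below eps/3 and use convergence of
    the finite sums before the cut. Every limit taken under a series goes through this lemma: in
    [fubini], in Jacobi's identity and in the uniqueness of Laurent coefficients. *)
Lemma Tannery (a : nat -> Z -> C) (A b : Z -> C) :
  asum b -> (forall n k, Cmod (a n k) <= Cmod (b k)) ->
  (forall k, Cconv (fun n => a n k) (A k)) ->
  Cconv (fun n => Zseries (a n)) (Zseries A).
Proof.
intros Hb Hd Hc.
assert (HA : forall k, Cmod (A k) <= Cmod (b k)).
{ intros k. apply (Cconv_mod_le (fun n => a n k)); auto. }
intros eps He.
destruct (rsum_conv _ Hb (eps / 3)) as [N HN]; [lra|].
specialize (HN N (le_n N)). fold (Zabs b) in HN.
pose proof (zpart_le_Zabs b N Hb) as HP.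
rewrite Rabs_left1 in HN by lra.
assert (F : Cconv (fun n => csum N (zfold (a n))) (csum N (zfold A))).
{ apply Cconv_csum. intros k _. apply Cconv_plus; apply Hc. }
destruct (F (eps / 3)) as [M HM]; [lra|].
exists M. intros n Hn. specialize (HM n Hn).
pose proof (Zseries_tail (a n) b N (Hd n) Hb) as T1.
pose proof (Zseries_tail A b N HA Hb) as T2.
replace (Zseries (a n) - Zseries A)%C with
  ((Zseries (a n) - csum N (zfold (a n))) + (csum N (zfold (a n)) - csum N (zfold A))
   + - (Zseries A - csum N (zfold A)))%C by ring.
eapply Rle_lt_trans; [apply Cmod_triangle|].
rewrite Cmod_opp.
assert (T3 := Cmod_triangle (Zseries (a n) - csum N (zfold (a n)))
                (csum N (zfold (a n)) - csum N (zfold A))).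
lra.
Qed.

Definition delta (i k : Z) : C := if Z.eq_dec k i then RtoC 1 else RtoC 0.

(** The fold pairs n with -(n+1), so a unit shift alters a partial sum only by its two end terms.
    These tend to 0 for a summable family, whence the shift invariance of [Zseries]. *)
Lemma zpart_succ (a : Z -> C) (n : nat) :
  csum n (zfold (fun k => a (k + 1)%Z)) =
  (csum n (zfold a) + a (Z.of_nat n) - a (- Z.of_nat n)%Z)%C.
Proof.
induction n as [|n IH].
- simpl. ring.
- cbn [csum]. rewrite IH. unfold zfold.
  replace (Z.of_nat n + 1)%Z with (Z.of_nat (S n)) by lia.
  replace (- Z.of_nat (S n) + 1)%Z with (- Z.of_nat n)%Z by lia. ring.
Qed.

Lemma asum_bound (a : Z -> C) (M : R) :
  (forall n, rsum n (zmod a) <= M) -> asum a.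
Proof. apply ex_series_bound, zmod_ge0. Qed.

Lemma asum_succ (a : Z -> C) : asum a -> asum (fun k => a (k + 1)%Z).
Proof.
intros H. apply (asum_bound _ (2 * Zabs a)). intros n.
assert (E : rsum n (zmod (fun k => a (k + 1)%Z)) =
  rsum n (zmod a) + Cmod (a (Z.of_nat n)) - Cmod (a 0%Z) + (Cmod (a 0%Z) - Cmod (a (- Z.of_nat
      n)%Z))).
{ induction n as [|n IH].
  - simpl. ring.
  - cbn [rsum]. rewrite IH. unfold zmod.
    replace (Z.of_nat n + 1)%Z with (Z.of_nat (S n)) by lia.
    replace (- Z.of_nat (S n) + 1)%Z with (- Z.of_nat n)%Z by lia. ring. }
rewrite E. pose proof (zpart_le_Zabs a n H). pose proof (term_le_Zabs a (Z.of_nat n) H).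
pose proof (Cmod_ge_0 (a (- Z.of_nat n)%Z)). lra.
Qed.

Lemma asum_lim0 (a : Z -> C) : asum a ->
  Cconv (fun n => a (Z.of_nat n)) (RtoC 0) /\ Cconv (fun n => a (- Z.of_nat n)%Z) (RtoC 0).
Proof.
intros H. assert (L := ex_series_lim_0 _ H). apply is_lim_seq_spec in L.
assert (K : forall eps, 0 < eps -> exists N, forall n, (N <= n)%nat -> zmod a n < eps).
{ intros eps He. destruct (L (mkposreal eps He)) as [N HN]. exists N. intros n Hn.
  specialize (HN n Hn). simpl in HN. rewrite Rminus_0_r in HN.
  pose proof (Rle_abs (zmod a n)). lra. }
split; intros eps He; destruct (K eps He) as [N HN]; exists (S N); intros n Hn.
- specialize (HN n ltac:(lia)). unfold zmod in HN.
  replace (a (Z.of_nat n) - RtoC 0)%C with (a (Z.of_nat n)) by ring.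
  pose proof (Cmod_ge_0 (a (- Z.of_nat (S n))%Z)). lra.
- destruct n as [|n]; [lia|]. specialize (HN n ltac:(lia)). unfold zmod in HN.
  replace (a (- Z.of_nat (S n))%Z - RtoC 0)%C with (a (- Z.of_nat (S n))%Z) by ring.
  pose proof (Cmod_ge_0 (a (Z.of_nat n))). lra.
Qed.

Lemma Zseries_succ (a : Z -> C) : asum a -> Zseries (fun k => a (k + 1)%Z) = Zseries a.
Proof.
intros H. destruct (asum_lim0 a H) as [L1 L2].
eapply Cconv_unique; [apply Zseries_conv, asum_succ, H|].
replace (Zseries a) with (Zseries a + RtoC 0 + (RtoC (-1) * RtoC 0))%C by ring.
eapply Cconv_ext; [|exact (Cconv_plus _ _ _ _ (Cconv_plus _ _ _ _ (Zseries_conv a H) L1)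
   (Cconv_scal (RtoC (-1)) _ _ L2))].
intros n. cbn beta. rewrite zpart_succ. ring.
Qed.

(** The reflection k -> -1 - k swaps the two halves of the fold and so preserves every partial sum.
    Together with the unit shift it generates all translations and reflections of Z. *)
Lemma asum_flip (a : Z -> C) : asum a -> asum (fun k => a (- 1 - k)%Z).
Proof.
intros H. apply (ex_series_ext (zmod a)); [|exact H].
intros n. unfold zmod. rewrite Rplus_comm. f_equal; f_equal; f_equal; lia.
Qed.

Lemma Zseries_flip (a : Z -> C) : asum a -> Zseries (fun k => a (- 1 - k)%Z) = Zseries a.
Proof.
intros H. eapply Cconv_unique; [apply Zseries_conv, asum_flip, H|].
eapply Cconv_ext; [|apply Zseries_conv, H].
intros n. apply csum_ext. intros k _. unfold zfold.
rewrite Cplus_comm. f_equal; f_equal; lia.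
Qed.

Lemma Zshift_aux (a : Z -> C) (s : Z) : asum a ->
  asum (fun k => a (k + s)%Z) /\ Zseries (fun k => a (k + s)%Z) = Zseries a.
Proof.
intros H.
assert (P : forall (n : nat) (b : Z -> C), asum b ->
  asum (fun k => b (k + Z.of_nat n)%Z) /\
  Zseries (fun k => b (k + Z.of_nat n)%Z) = Zseries b).
{ induction n as [|n IH]; intros b Hb.
  - split; [apply (asum_ext b); [|exact Hb]|apply Zseries_ext];
      intros k; f_equal; lia.
  - destruct (IH b Hb) as [I1 I2].
    assert (E : forall k, b (k + 1 + Z.of_nat n)%Z = b (k + Z.of_nat (S n))%Z)
      by (intros k; f_equal; lia).
    split.
    + eapply asum_ext; [exact E|]. exact (asum_succ _ I1).
    + rewrite <- (Zseries_ext _ _ E), (Zseries_succ _ I1). exact I2. }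
destruct (Z_le_gt_dec 0 s) as [L|L].
- specialize (P (Z.to_nat s) a H). now rewrite Z2Nat.id in P by lia.
- pose proof (P (Z.to_nat (- s)) _ (asum_flip a H)) as [P1 P2].
  assert (E : forall k, a (- 1 - (- 1 - k + Z.of_nat (Z.to_nat (- s))))%Z = a (k + s)%Z)
    by (intros k; f_equal; lia).
  split.
  + eapply asum_ext; [exact E|]. exact (asum_flip _ P1).
  + rewrite <- (Zseries_ext _ _ E), (Zseries_flip _ P1), P2. now apply Zseries_flip.
Qed.

Lemma asum_shift (a : Z -> C) (s : Z) : asum a -> asum (fun k => a (k + s)%Z).
Proof. apply Zshift_aux. Qed.

Lemma Zseries_shift (a : Z -> C) (s : Z) : asum a ->
  Zseries (fun k => a (k + s)%Z) = Zseries a.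
Proof. apply Zshift_aux. Qed.

Lemma asum_unshift (a : Z -> C) (s : Z) : asum (fun k => a (k + s)%Z) -> asum a.
Proof.
intros H. apply (asum_ext (fun k => a (k + - s + s)%Z)).
- intros k. f_equal. lia.
- exact (asum_shift _ (- s) H).
Qed.

Lemma asum_opp (a : Z -> C) : asum a -> asum (fun k => a (- k)%Z).
Proof.
intros H. apply (asum_ext (fun k => a (- 1 - (k + -1))%Z)).
- intros k. f_equal. lia.
- exact (asum_shift _ (-1) (asum_flip a H)).
Qed.

Lemma Zseries_opp (a : Z -> C) : asum a -> Zseries (fun k => a (- k)%Z) = Zseries a.
Proof.
intros H. rewrite <- (Zseries_flip a H).
rewrite <- (Zseries_shift _ (-1) (asum_flip a H)).
apply Zseries_ext. intros k. f_equal. lia.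
Qed.

Lemma zdelta_aux (a : Z -> C) :
  (forall k, k <> 0%Z -> a k = 0) -> asum a /\ Zseries a = a 0%Z.
Proof.
intros H.
assert (S1 : forall n, rsum n (zmod a) <= Cmod (a 0%Z)).
{ assert (forall n, rsum (S n) (zmod a) <= Cmod (a 0%Z)).
  { induction n as [|n IH].
    - simpl. unfold zmod. rewrite (H (- Z.of_nat 1)%Z) by lia. rewrite Cmod_0. simpl. lra.
    - cbn [rsum] in *. unfold zmod at 3. rewrite (H (Z.of_nat (S n))), (H (- Z.of_nat (S (S
        n)))%Z) by lia.
      rewrite Cmod_0. lra. }
  intros [|n]; [simpl; apply Cmod_ge_0|apply H0]. }
assert (A := asum_bound a _ S1). split; [exact A|].
eapply Cconv_unique; [apply Zseries_conv, A|].
intros eps He. exists 1%nat. intros n Hn.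
rewrite (csum_single n 0 (zfold a)); [|lia|].
- unfold zfold. simpl. rewrite (H (-1)%Z) by lia.
  replace (a 0%Z + RtoC 0 - a 0%Z)%C with (RtoC 0) by ring. now rewrite Cmod_0.
- intros k _ Hk. unfold zfold. rewrite !H by lia. ring.
Qed.

Lemma asum_single (a : Z -> C) (i : Z) :
  (forall k, k <> i -> a k = 0) -> asum a.
Proof.
intros H. apply (asum_unshift a i). apply zdelta_aux. intros k Hk. apply H. lia.
Qed.

Lemma Zseries_single (a : Z -> C) (i : Z) :
  (forall k, k <> i -> a k = 0) -> Zseries a = a i.
Proof.
intros H. rewrite <- (Zseries_shift a i); [|now apply (asum_single a i)].
rewrite (proj2 (zdelta_aux (fun k => a (k + i)%Z) ltac:(intros k Hk; apply H; lia))).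
reflexivity.
Qed.

Lemma rsum_re_bound (n : nat) (f : nat -> R) (g : nat -> C) :
  (forall k, g k = RtoC (f k)) -> csum n g = RtoC (rsum n f).
Proof.
intros H. induction n as [|n IH]; simpl; [easy|]. rewrite IH, H. now rewrite RtoC_plus.
Qed.

Lemma asum_Cmod (a : Z -> C) : asum a -> asum (fun k => RtoC (Cmod (a k))).
Proof.
apply asum_le. intros k. rewrite Cmod_R, Rabs_right; [lra|]. apply Rle_ge, Cmod_ge_0.
Qed.

Lemma Zseries_Cmod (a : Z -> C) : asum a ->
  Zseries (fun k => RtoC (Cmod (a k))) = RtoC (Zabs a).
Proof.
intros Ha. eapply Cconv_unique; [apply Zseries_conv, asum_Cmod, Ha|].
intros eps He. destruct (rsum_conv _ Ha eps He) as [N HN]. exists N.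
intros n Hn. specialize (HN n Hn).
rewrite (rsum_re_bound n (zmod a)).
- rewrite <- RtoC_minus, Cmod_R. exact HN.
- intros k. unfold zfold, zmod. now rewrite RtoC_plus.
Qed.

Lemma Zabs_shift (a : Z -> C) (s : Z) : asum a -> Zabs (fun k => a (k + s)%Z) = Zabs a.
Proof.
intros H. apply RtoC_inj.
rewrite <- (Zseries_Cmod _ (asum_shift a s H)), <- (Zseries_Cmod _ H).
apply (Zseries_shift (fun k => RtoC (Cmod (a k)))), asum_Cmod, H.
Qed.

(** * Interchange of two series over the integers *)

Section Fubini.
Variables (f : Z -> Z -> C) (s : Z -> Z) (beta g : Z -> C).
Hypothesis Hbeta : asum beta.
Hypothesis Hg : asum g.
Hypothesis Hf : forall n k, Cmod (f n (k + s n)%Z) <= Cmod (beta n) * Cmod (g k).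

(** The shift [s n] in the hypothesis is there because the n-th row of the double series below is
    usually concentrated around a centre that moves with n, and a bound of product form is available
    only after recentring each row. *)
Lemma fubini_inner (n : Z) : asum (f n).
Proof.
apply (asum_unshift _ (s n)). apply (asum_le _ (fun k => beta n * g k)%C).
- intros k. rewrite Cmod_mult. apply Hf.
- now apply asum_scal.
Qed.

Lemma fubini_inner_Zabs (n : Z) : Zabs (f n) <= Cmod (beta n) * Zabs g.
Proof.
rewrite <- (Zabs_shift (f n) (s n) (fubini_inner n)), <- Zabs_scal.
apply Zabs_le; [|now apply asum_scal].
intros k. rewrite Cmod_mult. apply Hf.
Qed.

Let dom (n : Z) : C := (RtoC (Zabs g) * beta n)%C.

Lemma fubini_dom : asum dom.
Proof. now apply asum_scal. Qed.

Lemma fubini_dom_mod (n : Z) : Cmod (dom n) = Cmod (beta n) * Zabs g.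
Proof.
unfold dom. rewrite Cmod_mult, Cmod_R, Rabs_right; [ring|].
apply Rle_ge, Zabs_ge0, Hg.
Qed.

Lemma fubini_outer (k : Z) : asum (fun n => f n k).
Proof.
apply (asum_le _ dom); [|exact fubini_dom].
intros n. rewrite fubini_dom_mod. eapply Rle_trans; [|apply fubini_inner_Zabs].
apply (term_le_Zabs (f n)), fubini_inner.
Qed.

Lemma fubini_part (N : nat) :
  csum N (zfold (fun k => Zseries (fun n => f n k))) =
  Zseries (fun n => csum N (zfold (f n))).
Proof.
symmetry. etransitivity; [apply (Zseries_csum N (fun i n => zfold (f n) i))|].
- intros i _. apply asum_plus; apply fubini_outer.
- apply csum_ext. intros i _.
  apply (Zseries_plus (fun n => f n (Z.of_nat i)) (fun n => f n (- Z.of_nat (S i))%Z));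
    apply fubini_outer.
Qed.

(** Summed over n, the partial sums in k of the moduli form the single series [G]. It is dominated
    by [dom] whatever N is, and this uniform bound gives summability in k. *)
Lemma fubini_sum_asum : asum (fun k => Zseries (fun n => f n k)).
Proof.
apply (asum_bound _ (Zabs dom)). intros N.
assert (Hm : forall k, asum (fun n => RtoC (Cmod (f n k))))
  by (intros k; apply (asum_Cmod (fun n => f n k)), fubini_outer).
set (G := fun n => RtoC (rsum N (zmod (f n)))).
assert (HG : forall n, Cmod (G n) <= Cmod (dom n)).
{ intros n. unfold G. rewrite Cmod_R, Rabs_right.
  - rewrite fubini_dom_mod. eapply Rle_trans; [|apply fubini_inner_Zabs].
    apply zpart_le_Zabs, fubini_inner.
  - apply Rle_ge. induction N; simpl; [lra|].
    apply Rplus_le_le_0_compat; [exact IHN|apply zmod_ge0]. }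
assert (AG : asum G) by (apply (asum_le _ dom); [exact HG|exact fubini_dom]).
assert (E : Zseries G = csum N (fun i => RtoC (Zabs (fun n => f n (Z.of_nat i)) +
              Zabs (fun n => f n (- Z.of_nat (S i))%Z)))).
{ rewrite (Zseries_ext G (fun n => csum N (fun i => RtoC (Cmod (f n (Z.of_nat i))) +
      RtoC (Cmod (f n (- Z.of_nat (S i))%Z)))%C)).
  - rewrite (Zseries_csum N (fun i n => RtoC (Cmod (f n (Z.of_nat i))) +
      RtoC (Cmod (f n (- Z.of_nat (S i))%Z)))%C) by (intros; apply asum_plus; apply Hm).
    apply csum_ext. intros i _. rewrite Zseries_plus by apply Hm.
    rewrite RtoC_plus. f_equal; apply (Zseries_Cmod (fun n => f n _)), fubini_outer.
  - intros n. unfold G. symmetry. apply rsum_re_bound. intros i. now rewrite <- RtoC_plus. }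
assert (L : rsum N (zmod (fun k => Zseries (fun n => f n k))) <= Cmod (Zseries G)).
{ rewrite E. rewrite (rsum_re_bound N _ _ (fun i => eq_refl)).
  rewrite Cmod_R. eapply Rle_trans; [|apply Rle_abs].
  apply rsum_le. intros i _. apply Rplus_le_compat; apply (Zseries_le (fun n => f n _)),
      fubini_outer. }
eapply Rle_trans; [exact L|]. eapply Rle_trans; [apply (Zseries_le _ AG)|].
apply Zabs_le; [exact HG|exact fubini_dom].
Qed.

(** Finite sums over k commute with the series over n; letting the number of terms grow inside that
    series is an instance of [Tannery] with majorant [dom]. *)
Lemma fubini :
  Zseries (fun n => Zseries (f n)) = Zseries (fun k => Zseries (fun n => f n k)).
Proof.
eapply Cconv_unique; [|apply Zseries_conv, fubini_sum_asum].
eapply Cconv_ext; [intros N; symmetry; apply fubini_part|].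
apply (Tannery _ _ dom fubini_dom).
- intros N n. rewrite fubini_dom_mod. eapply Rle_trans; [|apply fubini_inner_Zabs].
  eapply Rle_trans; [apply csum_mod_le|].
  eapply Rle_trans; [|apply (zpart_le_Zabs (f n) N), fubini_inner].
  apply rsum_le. intros. apply zfold_le.
- intros n. apply Zseries_conv, fubini_inner.
Qed.

Lemma fubini_asum_outer : asum (fun n => Zseries (f n)).
Proof.
apply (asum_le _ dom); [|exact fubini_dom].
intros n. rewrite fubini_dom_mod. eapply Rle_trans; [|apply fubini_inner_Zabs].
apply Zseries_le, fubini_inner.
Qed.

End Fubini.

(** * Exponentials and Laurent series *)

Lemma Cexp_plus (x y : C) : Cexp (x + y) = (Cexp x * Cexp y)%C.
Proof.
unfold Cexp. destruct x as [a b], y as [c d]. simpl.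
rewrite exp_plus, cos_plus, sin_plus.
apply injective_projections; simpl; ring.
Qed.

Lemma Cexp_0 : Cexp (RtoC 0) = RtoC 1.
Proof.
unfold Cexp. simpl. rewrite exp_0, cos_0, sin_0.
apply injective_projections; simpl; ring.
Qed.

Lemma Cmod_Cexp (x : C) : Cmod (Cexp x) = exp (Re x).
Proof.
unfold Cmod, Cexp. simpl.
replace (exp (Re x) * cos (Im x) * (exp (Re x) * cos (Im x) * 1) +
         exp (Re x) * sin (Im x) * (exp (Re x) * sin (Im x) * 1))
  with ((exp (Re x))² * ((sin (Im x))² + (cos (Im x))²)) by (unfold Rsqr; ring).
rewrite sin2_cos2, Rmult_1_r. apply sqrt_Rsqr, Rlt_le, exp_pos.
Qed.

Lemma Cexp_neq0 (x : C) : Cexp x <> 0.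
Proof.
apply Cmod_gt_0. rewrite Cmod_Cexp. apply exp_pos.
Qed.

(** A logarithm kept opaque under [simpl]: an equality between products of powers becomes an
    identity linear in the components of [elog], which [emono] can leave to [field]. *)
Definition elog (x : C) : C := (RtoC (2 * PI) * Ci * x)%C.
Arguments elog : simpl never.

Lemma epowE (x : C) (a : R) : epow x a = Cexp (RtoC a * elog x)%C.
Proof.
unfold epow, elog. f_equal. rewrite !RtoC_mult. ring.
Qed.

Lemma epow_neq0 (x : C) (a : R) : epow x a <> 0.
Proof. apply Cexp_neq0. Qed.

Lemma Cmod_epow (x : C) (a : R) : Cmod (epow x a) = exp (- (2 * PI * Im x) * a).
Proof.
rewrite epowE, Cmod_Cexp. f_equal.
unfold elog. destruct x as [u v]. simpl. ring.
Qed.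

Lemma Cinv_Cexp (x : C) : (/ Cexp x)%C = Cexp (- x).
Proof.
assert (E : (Cexp x * Cexp (- x))%C = RtoC 1).
{ rewrite <- Cexp_plus. replace (x + - x)%C with (RtoC 0) by ring. apply Cexp_0. }
rewrite <- (Cmult_1_r (/ Cexp x)), <- E. field. apply Cexp_neq0.
Qed.

Ltac push_IZR :=
  rewrite ?INR_IZR_INZ, ?Nat2Z.inj_add, ?Nat2Z.inj_mul, ?Nat2Z.inj_succ;
  unfold Z.succ; simpl Z.of_nat;
  repeat first [rewrite plus_IZR | rewrite minus_IZR | rewrite opp_IZR | rewrite mult_IZR].

(* Equality of two products of powers [epow x a]: compare exponents. *)
Ltac emono :=
  unfold Cdiv; rewrite ?epowE; repeat first [rewrite Cinv_Cexp | rewrite <- Cexp_plus]; push_IZR;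
      f_equal;
  apply injective_projections; simpl; try field; try (now auto).

Lemma epow_0 (x : C) : epow x 0 = RtoC 1.
Proof. rewrite epowE. replace (RtoC 0 * elog x)%C with (RtoC 0) by ring. apply Cexp_0. Qed.

Lemma epow_add (x : C) (a b : R) : epow x (a + b) = (epow x a * epow x b)%C.
Proof. emono. Qed.

Lemma epow_plus (x y : C) (a : R) : epow (x + y) a = (epow x a * epow y a)%C.
Proof. emono. Qed.

Lemma epow_scale (t : R) (x : C) (a : R) : epow (RtoC t * x) a = epow x (t * a).
Proof. emono. Qed.

Lemma epow_opp (x : C) (a : R) : epow x (- a) = (/ epow x a)%C.
Proof. emono. Qed.

Lemma epow_zero_l (a : R) : epow (RtoC 0) a = RtoC 1.
Proof.
replace (RtoC 0) with (RtoC 0 * RtoC 0)%C at 1 by ring.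
rewrite epow_scale, Rmult_0_l. apply epow_0.
Qed.

Lemma Cpow_epow (x : C) (a : R) (n : nat) : Cpow (epow x a) n = epow x (a * n).
Proof.
induction n as [|n IH].
- simpl. rewrite Rmult_0_r, epow_0. reflexivity.
- rewrite Cpow_S, IH, S_INR. emono.
Qed.

Lemma Cpowz_epow (x : C) (a : R) (n : Z) : Cpowz (epow x a) n = epow x (a * IZR n).
Proof.
destruct n as [|k|k]; simpl Cpowz.
- now rewrite Rmult_0_r, epow_0.
- rewrite Cpow_epow, INR_IPR. reflexivity.
- rewrite Cpow_epow, INR_IPR, <- epow_opp. f_equal. unfold IZR. ring.
Qed.

(** A logarithm of -1 in the sense of [epow]. Signs (-1)^n thereby become powers like the others and
    obey the same exponent rules. *)
Definition half : C := RtoC (1 / 2).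

Lemma epow_half1 : epow half 1 = RtoC (-1).
Proof.
unfold epow.
assert (E : (RtoC (2 * PI * 1) * Ci * half)%C = (0, PI))
  by (apply injective_projections; simpl; field).
rewrite E. unfold Cexp. simpl. rewrite exp_0, cos_PI, sin_PI.
apply injective_projections; simpl; ring.
Qed.

Lemma epow_half2 : epow half 2 = RtoC 1.
Proof.
replace 2 with (1 + 1) by ring. rewrite epow_add, epow_half1, <- RtoC_mult.
f_equal. ring.
Qed.

Lemma epow_half_even (k : Z) : epow half (IZR (2 * k)) = RtoC 1.
Proof.
rewrite mult_IZR, <- Cpowz_epow, epow_half2.
rewrite <- (epow_0 (RtoC 0)), Cpowz_epow. f_equal. ring.
Qed.

Definition sg (n : Z) : C := epow half (IZR n).

Lemma Cpowz_m1 (n : Z) : Cpowz (RtoC (-1)) n = sg n.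
Proof. rewrite <- epow_half1, Cpowz_epow. unfold sg. f_equal. ring. Qed.

Lemma Cpow_m1 (n : nat) : Cpow (RtoC (-1)) n = sg (Z.of_nat n).
Proof. rewrite <- epow_half1, Cpow_epow. unfold sg. rewrite INR_IZR_INZ. f_equal. ring. Qed.

Lemma Cmod_sg (n : Z) : Cmod (sg n) = 1.
Proof.
unfold sg. rewrite Cmod_epow. unfold half. simpl.
replace (- (2 * PI * 0) * IZR n) with 0 by ring. apply exp_0.
Qed.

Lemma opp_epow (x : C) (a : R) : (- epow x a)%C = (epow half 1 * epow x a)%C.
Proof. rewrite epow_half1. replace (RtoC (-1)) with (- RtoC 1)%C by (now rewrite <- RtoC_opp).
    ring. Qed.

Lemma IZR_binom2 (n : Z) : IZR (binom2 n) = IZR n * (IZR n - 1) / 2.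
Proof.
unfold binom2.
assert (E : (n * (n - 1) = 2 * (n * (n - 1) / 2))%Z).
{ apply Z_div_exact_2; [lia|].
  destruct (Z.Even_or_Odd n) as [[k ->]|[k ->]].
  - replace (2 * k * (2 * k - 1))%Z with (k * (2 * k - 1) * 2)%Z by ring. apply Z_mod_mult.
  - replace ((2 * k + 1) * (2 * k + 1 - 1))%Z with ((2 * k + 1) * k * 2)%Z by ring.
    apply Z_mod_mult. }
apply (f_equal IZR) in E. rewrite !mult_IZR, minus_IZR in E. lra.
Qed.

Lemma Cmod_exp (x : R) : Cmod (RtoC (exp x)) = exp x.
Proof. rewrite Cmod_R. apply Rabs_right, Rle_ge, Rlt_le, exp_pos. Qed.

Lemma asum_exp_abs (c : R) : 0 < c -> asum (fun k => RtoC (exp (- c * Rabs (IZR k)))).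
Proof.
intros Hc.
apply (ex_series_dom _ (fun n => 2 * (exp (- c)) ^ n)).
- intros n. split; [apply zmod_ge0|]. unfold zmod. rewrite !Cmod_exp.
  assert (E : (exp (- c)) ^ n = exp (- c * INR n)).
  { induction n as [|n IH].
    - simpl. rewrite Rmult_0_r, exp_0. ring.
    - rewrite S_INR. simpl. rewrite IH, <- exp_plus. f_equal. ring. }
  rewrite E.
  rewrite opp_IZR, Rabs_Ropp, <- !INR_IZR_INZ, !(Rabs_right (INR _)) by (apply Rle_ge, pos_INR).
  assert (exp (- c * S n) <= exp (- c * n)).
  { rewrite S_INR. destruct (Req_dec (- c * (n + 1)) (- c * n)) as [->|NE]; [lra|].
    apply Rlt_le, exp_increasing. lra. }
  lra.
- apply (ex_series_scal 2 (fun n => exp (- c) ^ n)).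
  apply ex_series_geom. rewrite <- Cmod_R, Cmod_exp.
  rewrite <- exp_0. apply exp_increasing. lra.
Qed.

Lemma exp_le (x y : R) : x <= y -> exp x <= exp y.
Proof. intros [H| ->]; [now apply Rlt_le, exp_increasing|lra]. Qed.

Lemma asum_gauss (a : Z -> C) (K A B : R) :
  0 < A -> (forall k, Cmod (a k) <= K * exp (- A * IZR k ^ 2 + B * IZR k)) -> asum a.
Proof.
intros HA H.
(* [M] is the maximum over y of -A y^2 + (|B| + 1) y, so each term is at most a constant times
   exp(-|k|). *)
set (M := (Rabs B + 1) ^ 2 / (4 * A)).
apply (asum_le _ (fun k => RtoC (Rabs K * exp M) * RtoC (exp (- (1) * Rabs (IZR k))))%C);
  [|apply asum_scal, asum_exp_abs; lra].
intros k. eapply Rle_trans; [apply H|].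
rewrite Cmod_mult, RtoC_mult, Cmod_mult, !Cmod_exp, Cmod_R, Rabs_Rabsolu.
rewrite Rmult_assoc, <- exp_plus.
eapply Rle_trans; [apply Rmult_le_compat_r; [apply Rlt_le, exp_pos|apply Rle_abs]|].
apply Rmult_le_compat_l; [apply Rabs_pos|]. apply exp_le.
set (x := IZR k). assert (Hx : x ^ 2 = Rabs x ^ 2) by (rewrite pow2_abs; ring).
assert (HB : B * x <= Rabs B * Rabs x) by (rewrite <- Rabs_mult; apply Rle_abs).
assert (S : M = A * ((Rabs B + 1) / (2 * A)) ^ 2) by (unfold M; field; lra).
rewrite Hx, S. set (y := Rabs x) in *. set (b := Rabs B) in *.
assert (0 <= A * (y - (b + 1) / (2 * A)) ^ 2) by (apply Rmult_le_pos; [lra|apply pow2_ge_0]).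
replace (A * (y - (b + 1) / (2 * A)) ^ 2) with
  (A * y ^ 2 - (b + 1) * y + A * ((b + 1) / (2 * A)) ^ 2) in H0 by (field; lra).
lra.
Qed.

(* Laurent series in z = exp (2 pi i w). *)
Definition lterm (a : Z -> C) (w : C) (k : Z) : C := (a k * epow w (IZR k))%C.
Definition laurent (a : Z -> C) (w : C) : C := Zseries (lterm a w).
Definition entire (a : Z -> C) : Prop := forall w, asum (lterm a w).

Lemma entire_gauss (a : Z -> C) (K A B : R) :
  0 < A -> (forall k, Cmod (a k) <= K * exp (- A * IZR k ^ 2 + B * IZR k)) -> entire a.
Proof.
intros HA H w. apply (asum_gauss _ K A (B - 2 * PI * Im w)); [exact HA|].
intros k. unfold lterm. rewrite Cmod_mult, Cmod_epow.
eapply Rle_trans; [apply Rmult_le_compat_r; [apply Rlt_le, exp_pos|apply H]|].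
rewrite Rmult_assoc, <- exp_plus. right. f_equal. f_equal. ring.
Qed.

Lemma laurent_ext (a b : Z -> C) (w : C) :
  (forall k, a k = b k) -> laurent a w = laurent b w.
Proof. intros H. apply Zseries_ext. intros k. unfold lterm. now rewrite H. Qed.

Lemma entire_plus (a b : Z -> C) : entire a -> entire b -> entire (fun k => a k + b k)%C.
Proof.
intros Ha Hb w. apply (asum_ext (fun k => lterm a w k + lterm b w k)%C).
- intros k. unfold lterm. ring.
- now apply asum_plus.
Qed.

Lemma laurent_plus (a b : Z -> C) (w : C) : entire a -> entire b ->
  laurent (fun k => a k + b k)%C w = (laurent a w + laurent b w)%C.
Proof.
intros Ha Hb. unfold laurent. rewrite <- Zseries_plus; [|apply Ha|apply Hb].
apply Zseries_ext. intros k. unfold lterm. ring.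
Qed.

Lemma entire_scal (c : C) (a : Z -> C) : entire a -> entire (fun k => c * a k)%C.
Proof.
intros Ha w. apply (asum_ext (fun k => c * lterm a w k)%C).
- intros k. unfold lterm. ring.
- now apply asum_scal.
Qed.

Lemma laurent_scal (c : C) (a : Z -> C) (w : C) : entire a ->
  laurent (fun k => c * a k)%C w = (c * laurent a w)%C.
Proof.
intros Ha. unfold laurent. rewrite <- Zseries_scal; [|apply Ha].
apply Zseries_ext. intros k. unfold lterm. ring.
Qed.

Lemma laurent_shift (a : Z -> C) (s : Z) (w : C) : asum (lterm a w) ->
  (epow w (IZR s) * laurent (fun k => a (k + s)%Z) w)%C = laurent a w.
Proof.
intros Ha. unfold laurent. rewrite <- Zseries_scal.
- rewrite <- (Zseries_shift (lterm a w) s Ha). apply Zseries_ext. intros k.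
  unfold lterm. rewrite plus_IZR, epow_add. ring.
- apply (asum_ext (fun k => (/ epow w (IZR s)) * lterm a w (k + s))%C).
  + intros k. unfold lterm. rewrite plus_IZR, epow_add. field. apply epow_neq0.
  + apply asum_scal, asum_shift, Ha.
Qed.

Lemma laurent_translate (a : Z -> C) (t : R) (tau w : C) :
  laurent (fun k => epow tau (t * IZR k) * a k)%C w = laurent a (w + RtoC t * tau)%C.
Proof.
apply Zseries_ext. intros k. unfold lterm. rewrite epow_plus, epow_scale. ring.
Qed.

Lemma entire_translate (a : Z -> C) (t : R) (tau : C) :
  entire a -> entire (fun k => epow tau (t * IZR k) * a k)%C.
Proof.
intros H w. apply (asum_ext (lterm a (w + RtoC t * tau)%C)); [|apply H].
intros k. unfold lterm. rewrite epow_plus, epow_scale. ring.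
Qed.

Lemma entire_asum (a : Z -> C) : entire a -> asum a.
Proof.
intros H. apply (asum_ext (lterm a (RtoC 0))); [|apply H].
intros k. unfold lterm. rewrite epow_zero_l. ring.
Qed.

(** * Families of Laurent series summed coefficient by coefficient *)

Section Family.
Variables (f : Z -> Z -> C) (w : C) (s : Z -> Z) (beta g : Z -> C).
Hypothesis Hbeta : asum beta.
Hypothesis Hg : asum g.
Hypothesis Hf : forall n k,
  Cmod (f n (k + s n)%Z * epow w (IZR (k + s n))) <= Cmod (beta n) * Cmod (g k).

Lemma family_outer (k : Z) : asum (fun n => f n k).
Proof.
apply (asum_ext (fun n => / epow w (IZR k) * lterm (f n) w k)%C).
- intros n. unfold lterm. field. apply epow_neq0.
- apply asum_scal.
  exact (fubini_outer (fun n => lterm (f n) w) s beta g Hbeta Hg Hf k).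
Qed.

Lemma family_ext (k : Z) :
  Zseries (fun n => lterm (f n) w k) = lterm (fun k => Zseries (fun n => f n k)) w k.
Proof.
unfold lterm. rewrite Cmult_comm, <- Zseries_scal by apply family_outer.
apply Zseries_ext. intros n. ring.
Qed.

Lemma family_asum : asum (lterm (fun k => Zseries (fun n => f n k)) w).
Proof.
eapply asum_ext; [apply family_ext|].
exact (fubini_sum_asum (fun n => lterm (f n) w) s beta g Hbeta Hg Hf).
Qed.

Lemma family_laurent :
  laurent (fun k => Zseries (fun n => f n k)) w = Zseries (fun n => laurent (f n) w).
Proof.
unfold laurent at 2. symmetry.
etransitivity; [exact (fubini (fun n => lterm (f n) w) s beta g Hbeta Hg Hf)|].
apply Zseries_ext, family_ext.
Qed.

Lemma family_inner (n : Z) : asum (lterm (f n) w).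
Proof. exact (fubini_inner (fun n => lterm (f n) w) s beta g Hg Hf n). Qed.

Lemma family_asum_outer : asum (fun n => laurent (f n) w).
Proof. exact (fubini_asum_outer (fun n => lterm (f n) w) s beta g Hbeta Hg Hf). Qed.

End Family.

Definition conv (a b : Z -> C) (k : Z) : C := Zseries (fun i => a i * b (k - i)%Z)%C.

Lemma conv_family (a b : Z -> C) (w : C) (n k : Z) :
  Cmod (a n * b (k + n - n)%Z * epow w (IZR (k + n))) <=
  Cmod (lterm a w n) * Cmod (lterm b w k).
Proof.
rewrite <- Cmod_mult. right. f_equal. unfold lterm.
replace (k + n - n)%Z with k by lia. rewrite plus_IZR, epow_add. ring.
Qed.

Lemma laurent_conv (a b : Z -> C) (w : C) : asum (lterm a w) -> asum (lterm b w) ->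
  laurent (conv a b) w = (laurent a w * laurent b w)%C.
Proof.
intros Ha Hb.
etransitivity; [exact (family_laurent (fun n k => a n * b (k - n)%Z)%C w (fun n => n) _ _
   Ha Hb (conv_family a b w))|].
transitivity (Zseries (fun n => laurent b w * lterm a w n)%C).
2:{ rewrite Zseries_scal by exact Ha. unfold laurent. ring. }
apply Zseries_ext. intros n.
transitivity (Zseries (fun k => lterm (fun k => a n * b (k - n)%Z)%C w (k + n)%Z)).
- symmetry. apply (Zseries_shift (lterm (fun k => a n * b (k - n)%Z)%C w) n).
  exact (family_inner (fun n k => a n * b (k - n)%Z)%C w (fun n => n) _ _
           Hb (conv_family a b w) n).
- rewrite Cmult_comm. unfold laurent. rewrite <- Zseries_scal by exact Hb.
  apply Zseries_ext. intros k. unfold lterm.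
  replace (k + n - n)%Z with k by lia. rewrite plus_IZR, epow_add. ring.
Qed.

(** * Theta functions *)

Lemma sg_plus (m n : Z) : sg (m + n) = (sg m * sg n)%C.
Proof. unfold sg. now rewrite plus_IZR, epow_add. Qed.

Lemma sg_1 : sg 1 = (- RtoC 1)%C.
Proof. unfold sg. rewrite epow_half1. apply injective_projections; simpl; ring. Qed.

Lemma sg_succ (n : Z) : sg (n + 1) = (- sg n)%C.
Proof. rewrite sg_plus, sg_1. ring. Qed.

Lemma sg_sqr (n : Z) : (sg n * sg n)%C = RtoC 1.
Proof. rewrite <- sg_plus. replace (n + n)%Z with (2 * n)%Z by lia. apply epow_half_even. Qed.

Lemma sg_opp (n : Z) : sg (- n) = sg n.
Proof.
rewrite <- (Cmult_1_r (sg (- n))), <- (sg_sqr n), Cmult_assoc, <- sg_plus.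
replace (- n + n)%Z with 0%Z by lia. unfold sg at 1. rewrite epow_0. ring.
Qed.

Lemma sg_even (n : Z) : sg (2 * n) = RtoC 1.
Proof. apply epow_half_even. Qed.

Definition theta_coeff (tau : C) (k : Z) : C :=
  (sg k * epow tau (IZR k * (IZR k - 1) / 2))%C.

Definition theta (tau w : C) : C := laurent (theta_coeff tau) w.

Definition sig_term (tau : C) (k n : Z) : C :=
  if (n <? 0)%Z then RtoC 0
  else (sg n * epow tau (IZR n * (IZR n + 1) / 2 + IZR n * IZR k))%C.

(** [sig] uses this series only for k >= 0. At -k with k > 0 the terms n and 2k - 1 - n cancel for 0
    <= n < 2k and the rest is q^k times the series at k; defining [sig] by that form makes a bound
    uniform in k visible. *)
Definition sig_pos (tau : C) (k : Z) : C := Zseries (sig_term tau k).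

(* The Laurent coefficients of (q)_oo^3 / j(z; q) in the annulus |q| < |z| < 1. *)
Definition sig (tau : C) (k : Z) : C :=
  if (k <? 0)%Z then (epow tau (- IZR k) * sig_pos tau (- k))%C else sig_pos tau k.

(* The Laurent coefficients of j(z; q) / (1 - z). *)
Definition rtheta_coeff (tau : C) (k : Z) : C :=
  (sg k * epow tau (IZR k * (IZR k + 1) / 2) * sig tau k)%C.

Definition rtheta (tau w : C) : C := laurent (rtheta_coeff tau) w.

Section Theta.
Variable tau : C.
Hypothesis Htau : 0 < Im tau.

Notation Q := (epow tau).

Let T := 2 * PI * Im tau.

Lemma T_pos : 0 < T.
Proof. unfold T. pose proof PI_RGT_0. apply Rmult_lt_0_compat; lra. Qed.

Lemma Cmod_q (a : R) : Cmod (Q a) = exp (- T * a).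
Proof. apply Cmod_epow. Qed.

Lemma Cmod_q_le1 (a : R) : 0 <= a -> Cmod (Q a) <= 1.
Proof.
intros H. rewrite Cmod_q, <- exp_0. apply exp_le. pose proof T_pos. nra.
Qed.

Lemma q_neq1 (a : R) : a <> 0 -> Q a <> RtoC 1.
Proof.
intros H E. apply (f_equal Cmod) in E. rewrite Cmod_q, Cmod_1, <- exp_0 in E.
apply exp_inv in E. pose proof T_pos. apply H. nra.
Qed.

Lemma entire_qgauss (a : Z -> C) (K A B D : R) : 0 < A ->
  (forall k, Cmod (a k) <= K * Cmod (Q (A * IZR k ^ 2 + B * IZR k + D))) -> entire a.
Proof.
intros HA H. apply (entire_gauss a (K * exp (- T * D)) (T * A) (- T * B)).
- apply Rmult_lt_0_compat; [apply T_pos|exact HA].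
- intros k. eapply Rle_trans; [apply H|]. right. rewrite Cmod_q, Rmult_assoc, <- exp_plus.
  f_equal. f_equal. ring.
Qed.

Lemma asum_qgauss (a : Z -> C) (K A B D : R) : 0 < A ->
  (forall k, Cmod (a k) <= K * Cmod (Q (A * IZR k ^ 2 + B * IZR k + D))) -> asum a.
Proof. intros HA H. exact (entire_asum _ (entire_qgauss a K A B D HA H)). Qed.

Lemma asum_sig_term (k : Z) : asum (sig_term tau k).
Proof.
apply (asum_qgauss _ 1 (1 / 2) (1 / 2 + IZR k) 0); [lra|].
intros n. rewrite Rmult_1_l. unfold sig_term. destruct (n <? 0)%Z.
- rewrite Cmod_0. apply Cmod_ge_0.
- rewrite Cmod_mult, Cmod_sg, Rmult_1_l. right. f_equal. f_equal. field.
Qed.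

(** Shifting n by one turns the general term for k - 1 into -q^k times that for k. The former term n
    = 0 now sits at index -1 and accounts for the 1. *)
Lemma sig_pos_rec (k : Z) :
  sig_pos tau (k - 1) = (1 - Q (IZR k) * sig_pos tau k)%C.
Proof.
unfold sig_pos. rewrite <- (Zseries_succ _ (asum_sig_term (k - 1))).
rewrite (Zseries_ext _ (fun n => delta (-1) n + (- Q (IZR k)) * sig_term tau k n)%C).
- rewrite Zseries_plus, Zseries_scal.
  + rewrite (Zseries_single (delta (-1)) (-1)).
    * unfold delta. destruct (Z.eq_dec (-1) (-1)); [ring|easy].
    * intros n Hn. unfold delta. now destruct (Z.eq_dec n (-1)).
  + apply asum_sig_term.
  + apply (asum_single _ (-1)). intros n Hn. unfold delta. now destruct (Z.eq_dec n (-1)).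
  + apply asum_scal, asum_sig_term.
- intros n. unfold sig_term, delta.
  destruct (Z.ltb_spec (n + 1) 0); destruct (Z.ltb_spec n 0); destruct (Z.eq_dec n (-1));
    try lia; try ring.
  + subst n. change (-1 + 1)%Z with 0%Z. unfold sg.
    replace (0 * (0 + 1) / 2 + 0 * IZR (k - 1)) with 0 by field.
    rewrite !epow_0. ring.
  + rewrite sg_succ.
    replace (Q (IZR (n + 1) * (IZR (n + 1) + 1) / 2 + IZR (n + 1) * IZR (k - 1)))
      with (Q (IZR k) * Q (IZR n * (IZR n + 1) / 2 + IZR n * IZR k))%C
      by emono.
    ring.
Qed.

Lemma sig_opp (k : Z) : sig tau (- k) = (Q (IZR k) * sig tau k)%C.
Proof.
unfold sig. destruct (Z.ltb_spec (- k) 0); destruct (Z.ltb_spec k 0); try lia.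
- rewrite opp_IZR, Ropp_involutive, Z.opp_involutive. reflexivity.
- rewrite Cmult_assoc, <- epow_add, Rplus_opp_r, epow_0. ring.
- replace k with 0%Z by lia. simpl. rewrite epow_0. ring.
Qed.

(** By the reflection [sig_opp] the relation reads sig(k-1) + sig(-k) = 1, which is symmetric under
    k -> 1 - k. So the case k <= 0 follows from the series recursion at 1 - k >= 1. *)
Lemma sig_rec (k : Z) : sig tau (k - 1) = (1 - Q (IZR k) * sig tau k)%C.
Proof.
destruct (Z_le_gt_dec 1 k) as [L|L].
- unfold sig. destruct (Z.ltb_spec (k - 1) 0); destruct (Z.ltb_spec k 0); try lia.
  apply sig_pos_rec.
- assert (E := sig_pos_rec (1 - k)).
  replace (1 - k - 1)%Z with (- k)%Z in E by lia.
  rewrite <- sig_opp. unfold sig.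
  destruct (Z.ltb_spec (k - 1) 0); destruct (Z.ltb_spec (- k) 0); try lia.
  rewrite E, <- opp_IZR. replace (- (k - 1))%Z with (1 - k)%Z by lia. ring.
Qed.

Definition sig_bd : R := Zabs (fun n => Q (IZR n * (IZR n + 1) / 2)).

Lemma asum_tri : asum (fun n => Q (IZR n * (IZR n + 1) / 2)).
Proof.
apply (asum_qgauss _ 1 (1 / 2) (1 / 2) 0); [lra|].
intros n. rewrite Rmult_1_l. right. f_equal. f_equal. field.
Qed.

Lemma sig_pos_le (k : Z) : (0 <= k)%Z -> Cmod (sig_pos tau k) <= sig_bd.
Proof.
intros H. eapply Rle_trans; [apply Zseries_le, asum_sig_term|].
apply Zabs_le; [|apply asum_tri]. intros n. unfold sig_term.
destruct (Z.ltb_spec n 0).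
- rewrite Cmod_0. apply Cmod_ge_0.
- rewrite epow_add, !Cmod_mult, Cmod_sg, Rmult_1_l.
  rewrite <- (Rmult_1_r (Cmod (Q (IZR n * (IZR n + 1) / 2)))) at 2.
  apply Rmult_le_compat_l; [apply Cmod_ge_0|]. apply Cmod_q_le1.
  apply IZR_le in H, H0. nra.
Qed.

Lemma sig_le (k : Z) : Cmod (sig tau k) <= sig_bd.
Proof.
unfold sig. destruct (Z.ltb_spec k 0).
- rewrite Cmod_mult. rewrite <- (Rmult_1_l sig_bd).
  apply Rmult_le_compat; try apply Cmod_ge_0; [|apply sig_pos_le; lia].
  apply Cmod_q_le1. apply IZR_lt in H. lra.
- apply sig_pos_le. lia.
Qed.

Lemma sig_bd_ge0 : 0 <= sig_bd.
Proof. apply Zabs_ge0, asum_tri. Qed.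

Lemma Cmod_sig_bd : Cmod (RtoC sig_bd) = sig_bd.
Proof. rewrite Cmod_R. apply Rabs_right, Rle_ge, sig_bd_ge0. Qed.

Lemma asum_mul_sig (e : Z -> C) (k : Z) : asum e -> asum (fun i => e i * sig tau (k - i))%C.
Proof.
intros H. apply (asum_le _ (fun i => RtoC sig_bd * e i)%C); [|now apply asum_scal].
intros i. rewrite !Cmod_mult, Cmod_sig_bd.
rewrite Rmult_comm. apply Rmult_le_compat_r; [apply Cmod_ge_0|apply sig_le].
Qed.

(** Inserting [sig_rec] under the convolution, the constant 1 contributes the value of the Laurent
    series at z = q, which is assumed to vanish. This is how a zero of e acts on coefficients. *)
Lemma conv_sig_step (e : Z -> C) (k : Z) : asum e -> asum (fun i => Q (IZR i) * e i)%C ->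
  laurent e tau = RtoC 0 ->
  conv (fun i => Q (IZR i) * e i)%C (sig tau) (k - 1) =
  (- Q (IZR k) * conv e (sig tau) k)%C.
Proof.
intros H H1 H0. rewrite <- (Cplus_0_l (- _ * _)), <- H0. unfold laurent, conv.
assert (A := asum_mul_sig e k H).
rewrite <- Zseries_scal by exact A.
rewrite <- Zseries_plus.
- apply Zseries_ext. intros i. unfold lterm.
  replace (k - 1 - i)%Z with (k - i - 1)%Z by lia. rewrite sig_rec.
  replace (Q (IZR k)) with (Q (IZR i) * Q (IZR (k - i)))%C by emono.
  ring.
- apply (asum_ext (fun i => Q (IZR i) * e i)%C); [|exact H1].
  intros i. unfold lterm. ring.
- now apply asum_scal.
Qed.

Lemma entire_theta : entire (theta_coeff tau).
Proof.
apply (entire_qgauss _ 1 (1 / 2) (- 1 / 2) 0); [lra|].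
intros k. rewrite Rmult_1_l. unfold theta_coeff.
rewrite Cmod_mult, Cmod_sg, Rmult_1_l. right. f_equal. f_equal. field.
Qed.

Lemma theta_coeff_shift (n k : Z) :
  (Q (IZR n * IZR k) * theta_coeff tau k)%C =
  (sg n * Q (- (IZR n * (IZR n - 1) / 2)) * theta_coeff tau (k + n))%C.
Proof.
unfold theta_coeff. rewrite sg_plus.
replace (Q (IZR (k + n) * (IZR (k + n) - 1) / 2)) with
  (Q (IZR n * IZR k) * Q (IZR k * (IZR k - 1) / 2)
   * Q (IZR n * (IZR n - 1) / 2))%C by emono.
rewrite epow_opp.
transitivity (Q (IZR n * IZR k) * (sg k * Q (IZR k * (IZR k - 1) / 2)) * (sg n * sg n))%C.
- rewrite sg_sqr. ring.
- field. apply epow_neq0.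
Qed.

Lemma theta_shift (n : Z) (w : C) :
  theta tau (w + (IZR n) * tau) =
  (sg n * Q (- (IZR n * (IZR n - 1) / 2)) * epow w (- IZR n) * theta tau w)%C.
Proof.
unfold theta. rewrite <- laurent_translate.
rewrite (laurent_ext _ _ _ (theta_coeff_shift n)).
rewrite laurent_scal.
- rewrite <- (laurent_shift (theta_coeff tau) n w (entire_theta w)).
  rewrite !epow_opp. field. split; apply epow_neq0.
- intros v. apply (asum_ext (fun k => / epow v (IZR n) * lterm (theta_coeff tau) v (k + n))%C).
  + intros k. unfold lterm. rewrite plus_IZR, epow_add. field. apply epow_neq0.
  + apply asum_scal, asum_shift, entire_theta.
Qed.

(** The coefficient form of (1 - z) [rtheta] = [theta]. It provides j(z)/(1 - z) as a series
    converging for every z, so no removable singularity at z = 1 has to be treated. *)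
Lemma rtheta_coeff_diff (k : Z) :
  (rtheta_coeff tau k - rtheta_coeff tau (k - 1))%C = theta_coeff tau k.
Proof.
unfold rtheta_coeff, theta_coeff. rewrite sig_rec.
assert (S : sg k = (- sg (k - 1))%C) by (rewrite <- sg_succ; f_equal; lia).
rewrite S.
replace (Q (IZR k * (IZR k + 1) / 2)) with
  (Q (IZR k) * Q (IZR k * (IZR k - 1) / 2))%C by emono.
replace (Q (IZR (k - 1) * (IZR (k - 1) + 1) / 2)) with
  (Q (IZR k * (IZR k - 1) / 2)) by emono.
ring.
Qed.

Lemma rtheta_coeff_le (k : Z) :
  Cmod (rtheta_coeff tau k) <= sig_bd * Cmod (Q (IZR k * (IZR k + 1) / 2)).
Proof.
unfold rtheta_coeff. rewrite !Cmod_mult, Cmod_sg, Rmult_1_l, Rmult_comm.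
apply Rmult_le_compat_r; [apply Cmod_ge_0|apply sig_le].
Qed.

Lemma entire_rtheta : entire (rtheta_coeff tau).
Proof.
apply (entire_qgauss _ sig_bd (1 / 2) (1 / 2) 0); [lra|].
intros k. eapply Rle_trans; [apply rtheta_coeff_le|]. right. f_equal. f_equal. f_equal. field.
Qed.

Lemma rtheta_theta (w : C) : ((1 - epow w 1) * rtheta tau w)%C = theta tau w.
Proof.
assert (A : asum (fun k => lterm (rtheta_coeff tau) w (k + -1)))
  by apply asum_shift, entire_rtheta.
transitivity (rtheta tau w + (- epow w 1) * Zseries (fun k => lterm (rtheta_coeff tau) w (k +
    -1)))%C.
- rewrite (Zseries_shift _ _ (entire_rtheta w)). unfold rtheta, laurent. ring.
- unfold rtheta, laurent. rewrite <- Zseries_scal by exact A.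
  rewrite <- Zseries_plus; [|apply entire_rtheta|now apply asum_scal].
  apply Zseries_ext. intros k. unfold lterm. rewrite <- rtheta_coeff_diff.
  rewrite plus_IZR. replace (k + -1)%Z with (k - 1)%Z by lia.
  replace (epow w (IZR k)) with (epow w 1 * epow w (IZR k + -1))%C by emono. ring.
Qed.

Lemma theta_0 : theta tau (RtoC 0) = 0.
Proof. rewrite <- rtheta_theta, epow_zero_l. ring. Qed.

Lemma theta_q (n : Z) : theta tau ((IZR n) * tau) = 0.
Proof.
rewrite <- (Cplus_0_l ((IZR n) * tau)), theta_shift, theta_0. ring.
Qed.

(** The value of j(z)/(1 - z) at z = 1. The name anticipates [jacobi_eta3]; until then only the
    series is used. *)
Definition eta3 : C := rtheta tau (RtoC 0).

Lemma rtheta_q (n : Z) : n <> 0%Z -> rtheta tau ((IZR n) * tau) = 0.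
Proof.
intros H. assert (E := rtheta_theta ((IZR n) * tau)).
rewrite theta_q, epow_scale, Rmult_1_r in E.
assert (N : (1 - Q (IZR n))%C <> 0).
{ intros E'. apply Ceq_minus in E'. apply (q_neq1 (IZR n)); [|easy].
  now apply not_0_IZR. }
rewrite <- (Cmult_1_l (rtheta _ _)), <- (Cinv_l _ N), <- Cmult_assoc, E. ring.
Qed.

(** For k <> 0 the relation q^i theta_i = -theta_(i+1) combines with [conv_sig_step] into x = q^k x
    for the convolution x, and q^k is not 1. At k = 0 the reflection of [sig] produces the series of
    [rtheta] at z = 1. *)
Lemma conv_theta_sig (k : Z) :
  conv (theta_coeff tau) (sig tau) k = if Z.eq_dec k 0 then eta3 else RtoC 0.
Proof.
destruct (Z.eq_dec k 0) as [->|Hk].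
- unfold conv, eta3, rtheta, laurent. apply Zseries_ext. intros i.
  unfold lterm, theta_coeff, rtheta_coeff. rewrite epow_zero_l.
  replace (0 - i)%Z with (- i)%Z by lia. rewrite sig_opp.
  replace (Q (IZR i * (IZR i + 1) / 2)) with
    (Q (IZR i) * Q (IZR i * (IZR i - 1) / 2))%C by emono.
  ring.
- assert (E := conv_sig_step (theta_coeff tau) k (entire_asum _ entire_theta)).
  assert (E1 : forall i, (Q (IZR i) * theta_coeff tau i)%C = (- theta_coeff tau (i + 1))%C).
  { intros i. assert (X := theta_coeff_shift 1 i). rewrite Rmult_1_l in X. rewrite X, sg_1.
    replace (- (1 * (1 - 1) / 2)) with 0 by field. rewrite epow_0. ring. }
  assert (E2 : conv (fun i => Q (IZR i) * theta_coeff tau i)%C (sig tau) (k - 1) =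
     (- RtoC 1 * conv (theta_coeff tau) (sig tau) k)%C).
  { unfold conv. rewrite <- (Zseries_succ _ (asum_mul_sig _ k (entire_asum _ entire_theta))).
    rewrite <- Zseries_scal.
    - apply Zseries_ext. intros i. rewrite E1.
      replace (k - (i + 1))%Z with (k - 1 - i)%Z by lia. ring.
    - exact (asum_succ _ (asum_mul_sig _ k (entire_asum _ entire_theta))). }
  rewrite E2 in E.
  assert (T1 : laurent (theta_coeff tau) tau = 0).
  { assert (X := theta_q 1). rewrite Cmult_1_l in X. exact X. }
  assert (A1 : asum (fun i => Q (IZR i) * theta_coeff tau i)%C).
  { apply (asum_ext (lterm (theta_coeff tau) tau)); [|apply entire_theta].
    intros i. unfold lterm. ring. }
  specialize (E A1 T1).
  assert (N : (1 - Q (IZR k))%C <> 0).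
  { intros E'. apply Ceq_minus in E'. apply (q_neq1 (IZR k)); [|easy]. now apply not_0_IZR. }
  set (x := conv (theta_coeff tau) (sig tau) k) in *.
  assert (E3 : ((1 - Q (IZR k)) * x)%C = 0).
  { replace ((1 - Q (IZR k)) * x)%C with
      (- (- RtoC 1 * x) + - Q (IZR k) * x)%C by ring. rewrite E. ring. }
  rewrite <- (Cmult_1_l x), <- (Cinv_l _ N), <- Cmult_assoc, E3. ring.
Qed.

(* If theta vanishes at z and z is not a power of q, every j(q^n z)/(1 - q^n z)
   vanishes; but Sum_n q^(n^2) z^n j(q^n z)/(1 - q^n z) = eta3. *)
Lemma theta_neq0 (w : C) : eta3 <> RtoC 0 ->
  (forall n : Z, epow w 1 <> Q (IZR n)) -> theta tau w <> 0.
Proof.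
intros Heta Hw H0. apply Heta.
(* The coefficient of z^K in the n-th summand. Summed over n it is (-1)^K q^(K(K+1)/2) times the
   convolution of theta with [sig] at K, so only K = 0 survives and gives [eta3]. *)
set (f := fun n K : Z => (Q (IZR n * IZR K) * rtheta_coeff tau (K - n))%C).
assert (Hb : asum (fun n => Q (IZR n * (IZR n - 1) / 2))).
{ apply (asum_ext (fun n => Q (IZR (n + -1) * (IZR (n + -1) + 1) / 2))).
  - intros n. rewrite plus_IZR. f_equal. field.
  - exact (asum_shift _ (-1) asum_tri). }
assert (Hg : asum (fun k => RtoC sig_bd * (Q (IZR k * (IZR k + 1) / 2) * epow w (IZR k)))%C).
{ apply asum_scal.
  apply (entire_qgauss (fun k => Q (IZR k * (IZR k + 1) / 2)) 1 (1 / 2) (1 / 2) 0); [lra|].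
  intros k. rewrite Rmult_1_l. right. f_equal. f_equal. field. }
assert (Hf : forall n k, Cmod (f n (k + 0)%Z * epow w (IZR (k + 0))) <=
   Cmod (Q (IZR n * (IZR n - 1) / 2)) *
   Cmod (RtoC sig_bd * (Q (IZR k * (IZR k + 1) / 2) * epow w (IZR k)))).
{ intros n k. rewrite Z.add_0_r. unfold f. rewrite !Cmod_mult, Cmod_sig_bd.
  assert (L := rtheta_coeff_le (k - n)).
  assert (E : Cmod (Q (IZR n * IZR k)) * Cmod (Q (IZR (k - n) * (IZR (k - n) + 1) / 2)) =
     Cmod (Q (IZR n * (IZR n - 1) / 2)) * Cmod (Q (IZR k * (IZR k + 1) / 2))).
  { rewrite <- !Cmod_mult. f_equal. emono. }
  apply (Rle_trans _ (Cmod (Q (IZR n * IZR k)) * (sig_bd * Cmod (Q (IZR (k - n) * (IZR (k - n) +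
      1) / 2))) * Cmod (epow w (IZR k)))).
  - apply Rmult_le_compat_r; [apply Cmod_ge_0|].
    apply Rmult_le_compat_l; [apply Cmod_ge_0|exact L].
  - right. rewrite (Rmult_comm sig_bd), <- Rmult_assoc, E. ring. }
assert (L := family_laurent f w (fun _ => 0%Z) _ _ Hb Hg Hf).
transitivity (laurent (fun k => Zseries (fun n => f n k)) w).
- rewrite (laurent_ext _ (fun K => sg K * Q (IZR K * (IZR K + 1) / 2) *
      conv (theta_coeff tau) (sig tau) K)%C).
  + unfold laurent. rewrite (Zseries_single _ 0).
    * unfold lterm. rewrite conv_theta_sig. simpl. unfold sg.
      replace (0 * (0 + 1) / 2) with 0 by field. rewrite !epow_0. ring.
    * intros k Hk. unfold lterm. rewrite conv_theta_sig.
      destruct (Z.eq_dec k 0); [easy|]. ring.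
  + intros K. unfold conv. rewrite <- Zseries_scal by apply asum_mul_sig, entire_asum, entire_theta.
    apply Zseries_ext. intros n. unfold f, rtheta_coeff, theta_coeff.
    replace (K - n)%Z with (K + - n)%Z by lia. rewrite sg_plus, sg_opp.
    transitivity ((Q (IZR n * IZR K) * Q (IZR (K + - n) * (IZR (K + - n) + 1) / 2)) *
       (sg K * sg n * sig tau (K + - n)))%C; [ring|].
    replace (Q (IZR n * IZR K) * Q (IZR (K + - n) * (IZR (K + - n) + 1) / 2))%C
      with (Q (IZR K * (IZR K + 1) / 2) * Q (IZR n * (IZR n - 1) / 2))%C by emono.
    ring.
- rewrite L. rewrite <- Zseries_zero. apply Zseries_ext. intros n.
  assert (V : rtheta tau (w + (IZR n) * tau) = 0).
  { assert (E := rtheta_theta (w + (IZR n) * tau)).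
    rewrite theta_shift, H0, Cmult_0_r in E.
    assert (N : (1 - epow (w + (IZR n) * tau) 1)%C <> 0).
    { intros E'. apply Ceq_minus in E'. apply (Hw (- n)%Z).
      rewrite epow_plus, epow_scale, Rmult_1_r in E'.
      rewrite opp_IZR, epow_opp. rewrite <- (Cmult_1_l (/ _)), E'. field. apply epow_neq0. }
    rewrite <- (Cmult_1_l (rtheta _ _)), <- (Cinv_l _ N), <- Cmult_assoc, E. ring. }
  rewrite <- (laurent_shift _ n).
  + rewrite (laurent_ext _ (fun k => Q (IZR n * IZR n) * (Q (IZR n * IZR k) * rtheta_coeff tau
      k))%C).
    * rewrite laurent_scal by apply entire_translate, entire_rtheta.
      rewrite laurent_translate. unfold rtheta in V. rewrite V. ring.
    * intros k. unfold f. replace (k + n - n)%Z with k by lia.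
      rewrite Cmult_assoc. f_equal. emono.
  + exact (family_inner f w (fun _ => 0%Z) _ _ Hg Hf n).
Qed.

End Theta.

(** * Jacobi's identity for the cube of the Euler product *)

Lemma entire_asum_IZR (a : Z -> C) : entire a -> asum (fun k => RtoC (IZR k) * a k)%C.
Proof.
(* At w = v and w = -v the modulus of z^k is e^(-k) and e^k, whose sum dominates |k|. *)
intros H. set (v := (0, / (2 * PI)) : C).
apply (asum_le _ (fun k => RtoC (Cmod (lterm a v k)) + RtoC (Cmod (lterm a (- v) k)))%C).
- intros k. rewrite <- RtoC_plus, Cmod_R.
  rewrite Rabs_right by (apply Rle_ge, Rplus_le_le_0_compat; apply Cmod_ge_0).
  unfold lterm. rewrite !Cmod_mult, !Cmod_epow, Cmod_R. unfold v. simpl.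
  pose proof PI_RGT_0.
  replace (- (2 * PI * / (2 * PI)) * IZR k) with (- IZR k) by (field; lra).
  replace (- (2 * PI * - / (2 * PI)) * IZR k) with (IZR k) by (field; lra).
  assert (E1 := exp_ineq1_le (IZR k)). assert (E2 := exp_ineq1_le (- IZR k)).
  pose proof (exp_pos (IZR k)). pose proof (exp_pos (- IZR k)).
  pose proof (Cmod_ge_0 (a k)).
  assert (Rabs (IZR k) <= exp (- IZR k) + exp (IZR k)) by (apply Rabs_le; lra). nra.
- apply asum_plus; apply asum_Cmod, H.
Qed.

Lemma moment_shift (a : Z -> C) (s : Z) : asum a -> asum (fun k => RtoC (IZR k) * a k)%C ->
  asum (fun k => RtoC (IZR k) * a (k + s)%Z)%C /\
  Zseries (fun k => RtoC (IZR k) * a (k + s)%Z)%C =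
  (Zseries (fun k => RtoC (IZR k) * a k) - RtoC (IZR s) * Zseries a)%C.
Proof.
intros Ha Hk.
assert (A : asum (fun k => RtoC (IZR k) * a k + - RtoC (IZR s) * a k)%C)
  by (apply asum_plus; [exact Hk|now apply asum_scal]).
assert (E : forall k, (RtoC (IZR (k + s)) * a (k + s)%Z + - RtoC (IZR s) * a (k + s)%Z)%C
    = (RtoC (IZR k) * a (k + s)%Z)%C) by (intros k; rewrite plus_IZR, RtoC_plus; ring).
split.
- exact (asum_ext _ _ E (asum_shift _ s A)).
- rewrite <- (Zseries_ext _ _ E), (Zseries_shift _ s A).
  rewrite Zseries_plus, Zseries_scal; try assumption; [ring|now apply asum_scal].
Qed.

Lemma Cconv_CLim (u : nat -> C) (l : C) : Cconv u l -> CLim_seq u = l.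
Proof.
intros H. unfold CLim_seq. destruct l as [a b].
assert (HR : is_lim_seq (fun n => Re (u n)) a).
{ apply is_lim_seq_spec. intros eps. destruct (H eps (cond_pos eps)) as [N HN].
  exists N. intros n Hn. eapply Rle_lt_trans; [|apply (HN n Hn)].
  exact (re_le_Cmod (u n - (a, b))). }
assert (HI : is_lim_seq (fun n => Im (u n)) b).
{ apply is_lim_seq_spec. intros eps. destruct (H eps (cond_pos eps)) as [N HN].
  exists N. intros n Hn. eapply Rle_lt_trans; [|apply (HN n Hn)].
  exact (im_le_Cmod (u n - (a, b))). }
now rewrite (is_lim_seq_unique _ _ HR), (is_lim_seq_unique _ _ HI).
Qed.

Lemma Cconv_bounded (u : nat -> C) (l : C) : Cconv u l ->
  exists N, forall n, (N <= n)%nat -> Cmod (u n) <= Cmod l + 1.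
Proof.
intros H. destruct (H 1) as [N HN]; [lra|]. exists N. intros n Hn.
specialize (HN n Hn). assert (T := Cmod_triangle (u n - l) l).
replace (u n - l + l)%C with (u n) in T by ring. lra.
Qed.

Lemma Cconv_mult (u v : nat -> C) (l m : C) :
  Cconv u l -> Cconv v m -> Cconv (fun n => u n * v n)%C (l * m)%C.
Proof.
intros Hu Hv eps He. destruct (Cconv_bounded v m Hv) as [N1 H1].
pose proof (Cmod_ge_0 l) as Pl. pose proof (Cmod_ge_0 m) as Pm.
set (K := Cmod l + Cmod m + 1). assert (HK : 0 < K) by (unfold K; lra).
destruct (Hu (eps / (2 * K))) as [N2 H2]; [apply Rdiv_lt_0_compat; lra|].
destruct (Hv (eps / (2 * K))) as [N3 H3]; [apply Rdiv_lt_0_compat; lra|].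
exists (N1 + N2 + N3)%nat. intros n Hn.
specialize (H1 n ltac:(lia)). specialize (H2 n ltac:(lia)). specialize (H3 n ltac:(lia)).
replace (u n * v n - l * m)%C with ((u n - l) * v n + l * (v n - m))%C by ring.
eapply Rle_lt_trans; [apply Cmod_triangle|]. rewrite !Cmod_mult.
pose proof (Cmod_ge_0 (u n - l)). pose proof (Cmod_ge_0 (v n - m)).
pose proof (Cmod_ge_0 (v n)).
assert (A1 : Cmod (u n - l) * Cmod (v n) <= Cmod (u n - l) * K)
  by (apply Rmult_le_compat_l; unfold K; lra).
assert (A2 : Cmod l * Cmod (v n - m) <= Cmod (v n - m) * K)
  by (rewrite Rmult_comm; apply Rmult_le_compat_l; unfold K; lra).
assert (B : eps / (2 * K) * K = eps / 2) by (field; lra).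
assert (A3 : Cmod (u n - l) * K < eps / 2) by (rewrite <- B; now apply Rmult_lt_compat_r).
assert (A4 : Cmod (v n - m) * K < eps / 2) by (rewrite <- B; now apply Rmult_lt_compat_r).
lra.
Qed.

Lemma Cconv_inv (u : nat -> C) (l : C) (K : R) : l <> RtoC 0 ->
  (forall n, u n <> 0) -> (forall n, Cmod (/ u n) <= K) ->
  Cconv u l -> Cconv (fun n => / u n)%C (/ l)%C.
Proof.
intros Hl Hu HK H.
assert (Pl : 0 < Cmod l) by now apply Cmod_gt_0.
assert (PK : 0 < K).
{ eapply Rlt_le_trans; [|apply (HK O)]. rewrite Cmod_inv by apply Hu.
  apply Rinv_0_lt_compat. apply Cmod_gt_0, Hu. }
intros eps He. destruct (H (eps * Cmod l / K)) as [N HN].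
{ apply Rdiv_lt_0_compat; [|exact PK]. now apply Rmult_lt_0_compat. }
exists N. intros n Hn. specialize (HN n Hn). specialize (HK n). specialize (Hu n).
replace (/ u n - / l)%C with (/ u n * (l - u n) * / l)%C by (field; now split).
rewrite !Cmod_mult, (Cmod_inv l Hl), Cmod_sub_sym.
apply (Rle_lt_trans _ (K * Cmod (u n - l) * / Cmod l)).
- apply Rmult_le_compat_r; [apply Rlt_le, Rinv_0_lt_compat, Pl|].
  apply Rmult_le_compat_r; [apply Cmod_ge_0|exact HK].
- apply (Rlt_le_trans _ (K * (eps * Cmod l / K) * / Cmod l)).
  + apply Rmult_lt_compat_r; [apply Rinv_0_lt_compat, Pl|].
    now apply Rmult_lt_compat_l.
  + right. field. split; lra.
Qed.

Lemma Cconv_eventually (u v : nat -> C) (l : C) (N : nat) :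
  (forall n, (N <= n)%nat -> u n = v n) -> Cconv u l -> Cconv v l.
Proof.
intros E H eps He. destruct (H eps He) as [M HM]. exists (N + M)%nat.
intros n Hn. rewrite <- E by lia. apply HM. lia.
Qed.

Section Jacobi.
Variable tau : C.
Hypothesis Htau : 0 < Im tau.

Notation Q := (epow tau).

Let q := Q 1.
Let x := Cmod q.

Lemma q_pow (n : nat) : Cpow q n = Q n.
Proof. unfold q. rewrite Cpow_epow. f_equal. ring. Qed.

Lemma x_bounds : 0 < x < 1.
Proof.
unfold x, q. split; [apply Cmod_gt_0, epow_neq0|].
rewrite Cmod_q, Rmult_1_r, <- exp_0. apply exp_increasing. pose proof (T_pos tau Htau). lra.
Qed.

Let P := qpoch_fin q.

Lemma one_sub_pow_neq0 (n : nat) : (1 - Cpow q (S n))%C <> 0.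
Proof.
rewrite q_pow. intros E. apply Ceq_minus in E.
apply (q_neq1 tau Htau (INR (S n))); [|easy]. rewrite S_INR. pose proof (pos_INR n). lra.
Qed.

Lemma qpoch_fin_neq0 (n : nat) : P n <> 0.
Proof.
induction n as [|n IH]; simpl.
- intros E. apply RtoC_inj in E. lra.
- apply Cmult_neq_0; [exact IH|apply (one_sub_pow_neq0 n)].
Qed.

Lemma qpoch_fin_le (n : nat) : Cmod (P n) <= exp (/ (1 - x)).
Proof.
pose proof x_bounds as Hx.
assert (S : Cmod (P n) <= exp ((1 - x ^ n) / (1 - x))).
{ induction n as [|n IH].
  - change (P 0) with (RtoC 1). rewrite Cmod_1. simpl. replace ((1 - 1) / (1 - x)) with 0 by
      (field; lra). rewrite exp_0. lra.
  - change (P (S n)) with (P n * (1 - Cpow q (S n)))%C.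
    replace ((1 - x ^ S n) / (1 - x)) with ((1 - x ^ n) / (1 - x) + x ^ n) by (simpl; field; lra).
    rewrite exp_plus, Cmod_mult.
    apply Rmult_le_compat; try apply Cmod_ge_0; [exact IH|].
    eapply Rle_trans; [apply Cmod_triangle|]. rewrite Cmod_opp, Cmod_1, Cmod_pow. fold x.
    eapply Rle_trans; [|apply exp_ineq1_le].
    assert (0 <= x ^ n) by (apply pow_le; lra). simpl. nra. }
eapply Rle_trans; [exact S|]. apply exp_le.
assert (0 <= x ^ n) by (apply pow_le; lra).
unfold Rdiv. rewrite <- (Rmult_1_l (/ (1 - x))) at 2.
apply Rmult_le_compat_r; [|lra]. apply Rlt_le, Rinv_0_lt_compat. lra.
Qed.

Let K := exp (/ (1 - x) ^ 2).

(** From 1/(1 - x^(n+1)) <= 1 + x^n/(1 - x) <= exp(x^n/(1 - x)) the exponents add up to a geometric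
    sum. The uniform bound yields both the nonvanishing of the infinite product and the majorant for
    [Tannery]. *)
Lemma qpoch_inv_le (n : nat) : Cmod (/ P n) <= K.
Proof.
pose proof x_bounds as Hx.
assert (S : Cmod (/ P n) <= exp ((1 - x ^ n) / (1 - x) ^ 2)).
{ induction n as [|n IH].
  - change (P 0) with (RtoC 1). simpl. rewrite Cmod_inv by (intros E; apply RtoC_inj in E; lra).
      rewrite Cmod_1.
    replace ((1 - 1) / ((1 - x) * ((1 - x) * 1))) with 0 by (field; lra). rewrite exp_0. lra.
  - change (P (S n)) with (P n * (1 - Cpow q (S n)))%C.
    assert (Hn := qpoch_fin_neq0 n). assert (H1 := one_sub_pow_neq0 n).
    replace (/ (P n * (1 - Cpow q (S n))))%C with (/ P n * / (1 - Cpow q (S n)))%C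
      by (field; split; assumption).
    replace ((1 - x ^ S n) / (1 - x) ^ 2) with ((1 - x ^ n) / (1 - x) ^ 2 + x ^ n / (1 - x))
      by (simpl; field; lra).
    rewrite exp_plus, Cmod_mult.
    apply Rmult_le_compat; try apply Cmod_ge_0; [exact IH|].
    rewrite Cmod_inv by exact H1.
    assert (Px : 0 <= x ^ n) by (apply pow_le; lra).
    assert (P1 : x ^ n <= 1).
    { rewrite <- (pow1 n). apply pow_incr. lra. }
    assert (D : 1 - x * x ^ n <= Cmod (1 - Cpow q (S n))).
    { assert (T := Cmod_triangle (1 - Cpow q (S n)) (Cpow q (S n))).
      replace (1 - Cpow q (S n) + Cpow q (S n))%C with (RtoC 1) in T by ring.
      rewrite Cmod_1, Cmod_pow in T. fold x in T. simpl pow in T. lra. }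
    assert (D2 : 0 < 1 - x * x ^ n) by nra.
    apply (Rle_trans _ (/ (1 - x * x ^ n))); [apply Rinv_le_contravar; lra|].
    eapply Rle_trans; [|apply exp_ineq1_le].
    apply (Rmult_le_reg_l (1 - x * x ^ n)); [exact D2|].
    rewrite Rinv_r by lra.
    apply (Rmult_le_reg_l (1 - x)); [lra|].
    replace ((1 - x) * ((1 - x * x ^ n) * (1 + x ^ n / (1 - x)))) with
      ((1 - x * x ^ n) * (1 - x + x ^ n)) by (field; lra).
    assert (0 <= x ^ n * ((1 - x) * (1 - x) + x * (1 - x ^ n))).
    { apply Rmult_le_pos; [exact Px|]. apply Rplus_le_le_0_compat; apply Rmult_le_pos; lra. }
    lra. }
eapply Rle_trans; [exact S|]. apply exp_le.
assert (0 <= x ^ n) by (apply pow_le; lra).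
unfold Rdiv. rewrite <- (Rmult_1_l (/ (1 - x) ^ 2)) at 2.
apply Rmult_le_compat_r; [|lra]. apply Rlt_le, Rinv_0_lt_compat. apply pow_lt. lra.
Qed.

(** The increments of the partial products are -P_n q^(n+1), so the products are the partial sums of
    a series with a geometric majorant. *)
Lemma qpoch_conv : Cconv P (qpoch q).
Proof.
pose proof x_bounds as Hx.
assert (H : ex_series (fun n => Cmod (- P n * Cpow q (S n)))).
{ apply (ex_series_dom _ (fun n => exp (/ (1 - x)) * x ^ n)).
  - intros n. split; [apply Cmod_ge_0|]. rewrite Cmod_mult, Cmod_opp.
    apply Rmult_le_compat; try apply Cmod_ge_0; [apply qpoch_fin_le|].
    rewrite Cpow_S, Cmod_mult, Cmod_pow. fold x.
    assert (0 <= x ^ n) by (apply pow_le; lra). nra.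
  - apply (ex_series_scal (exp (/ (1 - x))) (fun n => x ^ n)).
    apply ex_series_geom. rewrite Rabs_right; lra. }
assert (L := Cconv_plus _ _ _ _ (Cconv_const (RtoC 1)) (CSeries_conv _ H)).
assert (L' : Cconv P (RtoC 1 + CSeries (fun n => - P n * Cpow q (S n)))%C).
{ eapply Cconv_ext; [|exact L]. intros n. cbn beta. induction n as [|n IH].
  - change (P 0) with (RtoC 1). cbn [csum]. ring.
  - cbn [csum]. rewrite Cplus_assoc, IH. change (P (S n)) with (P n * (1 - Cpow q (S n)))%C.
    ring. }
unfold qpoch. fold P. now rewrite (Cconv_CLim _ _ L').
Qed.

Lemma qpoch_neq0 : qpoch q <> 0.
Proof.
intros E. assert (H := qpoch_conv). rewrite E in H.
destruct (H (/ K)) as [N HN]; [apply Rinv_0_lt_compat, exp_pos|].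
specialize (HN N (le_n N)). assert (B := qpoch_inv_le N).
rewrite Cmod_inv in B by apply qpoch_fin_neq0.
replace (P N - RtoC 0)%C with (P N) in HN by ring.
assert (0 < Cmod (P N)) by apply Cmod_gt_0, qpoch_fin_neq0.
assert (PK : 0 < K) by apply exp_pos.
apply Rinv_le_contravar in B; [|now apply Rinv_0_lt_compat].
rewrite Rinv_inv in B. lra.
Qed.

(** The convention 1/(q)_m = 0 for m < 0 supports [jtp_coeff n] on -n <= k <= n + 1 and makes
    [invq_step] valid without boundary cases. *)
Definition invq (m : Z) : C :=
  if (m <? 0)%Z then RtoC 0 else (/ P (Z.to_nat m))%C.

Lemma invq_step (m : Z) : (invq m * (1 - Q (IZR m)))%C = invq (m - 1).
Proof.
unfold invq. destruct (Z.ltb_spec m 0); destruct (Z.ltb_spec (m - 1) 0); try lia.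
- ring.
- replace m with 0%Z by lia. rewrite epow_0. ring.
- replace (Z.to_nat m) with (S (Z.to_nat (m - 1))) by lia.
  set (n := Z.to_nat (m - 1)).
  assert (E : Q (IZR m) = Cpow q (S n)).
  { rewrite q_pow. f_equal. rewrite INR_IZR_INZ. f_equal. unfold n. lia. }
  rewrite E. change (P (S n)) with (P n * (1 - Cpow q (S n)))%C.
  field. split; [apply qpoch_fin_neq0|apply one_sub_pow_neq0].
Qed.

Lemma invq_le (m : Z) : Cmod (invq m) <= K.
Proof.
unfold invq. destruct (m <? 0)%Z; [|apply qpoch_inv_le].
rewrite Cmod_0. apply Rlt_le, exp_pos.
Qed.

Lemma invq_conv (k : Z) : Cconv (fun n => invq (Z.of_nat n + k)) (/ qpoch q)%C.
Proof.
assert (L := Cconv_inv P (qpoch q) K qpoch_neq0 qpoch_fin_neq0 qpoch_inv_le qpoch_conv).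
intros eps He. destruct (L eps He) as [N HN]. exists (N + Z.to_nat (- k))%nat.
intros n Hn. unfold invq. destruct (Z.ltb_spec (Z.of_nat n + k) 0); [lia|].
apply HN. lia.
Qed.

(* The coefficients of prod_{i <= n} (1 - z q^i)(1 - q^i / z) (1 - z), by the
   q-binomial theorem. *)
Definition jtp_coeff (n : nat) (k : Z) : C :=
  (theta_coeff tau k *
   (P (2 * n + 1) * (invq (Z.of_nat n + k) * invq (Z.of_nat n + 1 - k))))%C.

Lemma jtp_coeff_le (n : nat) (k : Z) :
  Cmod (jtp_coeff n k) <= Cmod (RtoC (exp (/ (1 - x)) * (K * K)) * theta_coeff tau k).
Proof.
unfold jtp_coeff, K. rewrite Cmod_mult, (Cmod_mult (RtoC _)), !RtoC_mult, !Cmod_mult, !Cmod_exp.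
rewrite Rmult_comm. apply Rmult_le_compat_r; [apply Cmod_ge_0|].
apply Rmult_le_compat; try apply Cmod_ge_0.
- apply Rmult_le_pos; apply Cmod_ge_0.
- apply qpoch_fin_le.
- apply Rmult_le_compat; try apply Cmod_ge_0; apply invq_le.
Qed.

(** Multiplication by (1 - z q^(n+1))(1 - q^(n+1)/z) on coefficients. After [invq_step] only two
    [invq] values are left, and what remains is a rational identity in [A] = q^N and [B] = q^k. *)
Lemma jtp_coeff_rec (n : nat) (k : Z) :
  jtp_coeff (S n) k =
  ((RtoC 1 + Q (2 * (n + 1))) * jtp_coeff n k -
   Q (n + 1) * (jtp_coeff n (k - 1) + jtp_coeff n (k + 1)))%C.
Proof.
unfold jtp_coeff.
set (N := Z.of_nat (S n)).
replace (Z.of_nat n) with (N - 1)%Z by (unfold N; lia).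
replace (N - 1 + k)%Z with (N + k - 1)%Z by lia.
replace (N - 1 + 1 - k)%Z with (N + 1 - k - 1)%Z by lia.
replace (N - 1 + (k - 1))%Z with (N + k - 1 - 1)%Z by lia.
replace (N - 1 + 1 - (k - 1))%Z with (N + 1 - k)%Z by lia.
replace (N - 1 + (k + 1))%Z with (N + k)%Z by lia.
replace (N - 1 + 1 - (k + 1))%Z with (N + 1 - k - 1 - 1)%Z by lia.
rewrite <- !invq_step.
set (X := invq (N + k)). set (Y := invq (N + 1 - k)).
replace (2 * S n + 1)%nat with (S (S (2 * n + 1))) by lia.
change (P (S (S (2 * n + 1)))) with
  (P (2 * n + 1) * (1 - Cpow q (S (2 * n + 1))) * (1 - Cpow q (S (S (2 * n + 1)))))%C.
rewrite !q_pow.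
assert (HN : IZR N = INR n + 1) by (unfold N; rewrite <- INR_IZR_INZ, S_INR; ring).
clearbody N.
set (A := Q (IZR N)). set (B := Q (IZR k)).
assert (EB : Q (- IZR k) = (/ B)%C) by apply epow_opp.
replace (Q (S (2 * n + 1))) with (A * A)%C.
2:{ unfold A. rewrite <- epow_add. f_equal. rewrite HN, S_INR, plus_INR, mult_INR. simpl. ring. }
replace (Q (S (S (2 * n + 1)))) with (A * A * q)%C.
2:{ unfold A, q. rewrite <- !epow_add. f_equal. rewrite HN, !S_INR, plus_INR, mult_INR. simpl.
    ring. }
replace (Q (2 * (n + 1))) with (A * A)%C.
2:{ unfold A. rewrite <- epow_add. f_equal. rewrite HN. ring. }
replace (Q (n + 1)) with A by (unfold A; now rewrite HN).
replace (Q (IZR (N + k))) with (A * B)%C by (unfold A, B; emono).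
replace (Q (IZR (N + k - 1))) with (A * B / q)%C by (unfold A, B, q; emono).
replace (Q (IZR (N + 1 - k))) with (A * q / B)%C by (unfold A, B, q; emono).
replace (Q (IZR (N + 1 - k - 1))) with (A / B)%C by (unfold A, B, q; emono).
unfold theta_coeff.
replace (sg k) with (- sg (k - 1))%C by (rewrite <- sg_succ; f_equal; lia).
replace (sg (k + 1)) with (sg (k - 1)) by
  (replace (k + 1)%Z with (k - 1 + 1 + 1)%Z by lia; rewrite !sg_succ; ring).
replace (Q (IZR (k - 1) * (IZR (k - 1) - 1) / 2)) with
  (Q (IZR k * (IZR k - 1) / 2) * q / B)%C by (unfold B, q; emono).
replace (Q (IZR (k + 1) * (IZR (k + 1) - 1) / 2)) with
  (Q (IZR k * (IZR k - 1) / 2) * B)%C by (unfold B, q; emono).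
field. repeat split; apply epow_neq0.
Qed.

Let S (n : nat) : C := Zseries (fun k => RtoC (IZR k) * jtp_coeff n k)%C.

Lemma asum_dom : asum (fun k => RtoC (exp (/ (1 - x)) * (K * K)) * (RtoC (IZR k) * theta_coeff tau
    k))%C.
Proof. apply asum_scal, entire_asum_IZR, entire_theta, Htau. Qed.

Lemma dom_le (n : nat) (k : Z) :
  Cmod (RtoC (IZR k) * jtp_coeff n k) <=
  Cmod (RtoC (exp (/ (1 - x)) * (K * K)) * (RtoC (IZR k) * theta_coeff tau k)).
Proof.
replace (RtoC (exp (/ (1 - x)) * (K * K)) * (RtoC (IZR k) * theta_coeff tau k))%C with
  (RtoC (IZR k) * (RtoC (exp (/ (1 - x)) * (K * K)) * theta_coeff tau k))%C by ring.
rewrite (Cmod_mult (RtoC (IZR k)) (jtp_coeff n k)).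
rewrite (Cmod_mult (RtoC (IZR k)) (_ * theta_coeff tau k)).
apply Rmult_le_compat_l; [apply Cmod_ge_0|apply jtp_coeff_le].
Qed.

Lemma asum_jtp_IZR (n : nat) : asum (fun k => RtoC (IZR k) * jtp_coeff n k)%C.
Proof. exact (asum_le _ _ (dom_le n) asum_dom). Qed.

Lemma asum_jtp (n : nat) : asum (jtp_coeff n).
Proof.
apply (asum_le _ _ (jtp_coeff_le n)). apply asum_scal, entire_asum, entire_theta, Htau.
Qed.

(** The first moment is z d/dz at z = 1. In the recursion the zeroth moments coming from the two
    shifts cancel, so each step multiplies by 1 + q^(2n+2) - 2 q^(n+1) = (1 - q^(n+1))^2, starting
    from -1. *)
Lemma jtp_moment (n : nat) : S n = (- (P n * P n))%C.
Proof.
induction n as [|n IH].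
- unfold S. rewrite (Zseries_single _ 1).
  + unfold jtp_coeff, theta_coeff. rewrite sg_1.
    replace (1 * (1 - 1) / 2) with 0 by field. rewrite epow_0.
    change (invq (Z.of_nat 0 + 1)) with (/ P 1)%C.
    change (invq (Z.of_nat 0 + 1 - 1)) with (/ RtoC 1)%C.
    change (P (2 * 0 + 1)) with (P 1). change (P 0) with (RtoC 1).
    field. apply qpoch_fin_neq0.
  + intros k Hk. destruct (Z.eq_dec k 0) as [->|H0]; [ring|].
    unfold jtp_coeff, invq. destruct (Z.ltb_spec (Z.of_nat 0 + k) 0); [ring|].
    destruct (Z.ltb_spec (Z.of_nat 0 + 1 - k) 0); [ring|lia].
- destruct (moment_shift _ (-1) (asum_jtp n) (asum_jtp_IZR n)) as [A1 E1].
  destruct (moment_shift _ 1 (asum_jtp n) (asum_jtp_IZR n)) as [A2 E2].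
  unfold S. rewrite (Zseries_ext _ (fun k =>
     (RtoC 1 + Q (2 * (n + 1))) * (RtoC (IZR k) * jtp_coeff n k) +
     (- Q (n + 1)) * (RtoC (IZR k) * jtp_coeff n (k + -1) + RtoC (IZR k) * jtp_coeff n (k + 1)))%C).
  2:{ intros k. rewrite jtp_coeff_rec. replace (k - 1)%Z with (k + -1)%Z by lia. ring. }
  rewrite Zseries_plus, !Zseries_scal, Zseries_plus; try assumption.
  + rewrite E1, E2. fold (S n). rewrite IH.
    replace (RtoC (-1)) with (- RtoC 1)%C by now rewrite <- RtoC_opp.
    change (P (Datatypes.S n)) with (P n * (1 - Cpow q (Datatypes.S n)))%C.
    rewrite q_pow, S_INR.
    replace (Q (2 * (n + 1))) with (Q (n + 1) * Q (n + 1))%C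
      by (rewrite <- epow_add; f_equal; ring).
    ring.
  + now apply asum_plus.
  + apply asum_jtp_IZR.
  + apply asum_scal, asum_jtp_IZR.
  + now apply asum_scal, asum_plus.
Qed.

(** The derivative of (1 - z) [rtheta] = [theta] at z = 1, carried out as a summation by parts. *)
Lemma eta3_moment : eta3 tau = (- Zseries (fun k => RtoC (IZR k) * theta_coeff tau k))%C.
Proof.
set (c := rtheta_coeff tau).
assert (Ac : asum c) by apply entire_asum, entire_rtheta, Htau.
assert (Ak : asum (fun k => RtoC (IZR k) * c k)%C) by apply entire_asum_IZR, entire_rtheta, Htau.
assert (At : asum (fun k => RtoC (IZR k) * theta_coeff tau k)%C)
  by apply entire_asum_IZR, entire_theta, Htau.
assert (E0 : eta3 tau = Zseries c).
{ apply Zseries_ext. intros k. unfold lterm. rewrite epow_zero_l. unfold c. ring. }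
destruct (moment_shift c (-1) Ac Ak) as [A1 E1].
rewrite (Zseries_ext (fun k => RtoC (IZR k) * theta_coeff tau k)%C
  (fun k => RtoC (IZR k) * c k + - RtoC 1 * (RtoC (IZR k) * c (k + -1)%Z))%C).
- rewrite Zseries_plus, Zseries_scal, E1, E0; try assumption; [|now apply asum_scal].
  replace (RtoC (-1)) with (- RtoC 1)%C by now rewrite <- RtoC_opp. ring.
- intros k. rewrite <- (rtheta_coeff_diff tau Htau k). fold c.
  replace (k + -1)%Z with (k - 1)%Z by lia. ring.
Qed.

(** The limit of [jtp_moment] is taken on both sides: the products tend to -(q)_oo^2, while
    [jtp_coeff n k] tends to theta_k/(q)_oo. Thus the first moment of theta is -(q)_oo^3. *)
Lemma jacobi_eta3 : eta3 tau = Cpow (qpoch q) 3.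
Proof.
assert (L1 : Cconv S (- (qpoch q * qpoch q))%C).
{ apply (Cconv_ext (fun n => - RtoC 1 * (P n * P n))%C).
  - intros n. rewrite jtp_moment. ring.
  - replace (- (qpoch q * qpoch q))%C with (- RtoC 1 * (qpoch q * qpoch q))%C by ring.
    apply Cconv_scal, Cconv_mult; apply qpoch_conv. }
assert (L2 : Cconv S (Zseries (fun k => / qpoch q * (RtoC (IZR k) * theta_coeff tau k))%C)).
{ apply (Tannery _ _ _ asum_dom dom_le). intros k.
  replace (/ qpoch q * (RtoC (IZR k) * theta_coeff tau k))%C with
    (RtoC (IZR k) * (theta_coeff tau k * (qpoch q * (/ qpoch q * / qpoch q))))%C
    by (field; apply qpoch_neq0).
  apply Cconv_scal. unfold jtp_coeff. apply Cconv_scal. apply Cconv_mult.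
  - apply (Cconv_subseq P _ (fun n => (2 * n + 1)%nat)); [intros; lia|apply qpoch_conv].
  - apply Cconv_mult; [apply invq_conv|].
    eapply Cconv_ext; [|apply (invq_conv (1 - k))]. intros n. cbn beta. f_equal. lia. }
assert (E := Cconv_unique _ _ _ L1 L2).
rewrite Zseries_scal in E by apply entire_asum_IZR, entire_theta, Htau.
rewrite eta3_moment.
assert (N := qpoch_neq0).
set (d := Zseries (fun k => RtoC (IZR k) * theta_coeff tau k)%C) in *.
set (y := qpoch q) in *.
transitivity (- (y * (/ y * d)))%C; [field; exact N|]. rewrite <- E. simpl. ring.
Qed.

Lemma eta3_neq0 : eta3 tau <> 0.
Proof. rewrite jacobi_eta3. apply Cpow_nz, qpoch_neq0. Qed.

End Jacobi.

(** * Holomorphic and polar parts of the numerator over theta *)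

Lemma Zseries_opp_val (a : Z -> C) : asum a ->
  Zseries (fun k => - a k)%C = (- Zseries a)%C.
Proof.
intros H. rewrite (Zseries_ext _ (fun k => - RtoC 1 * a k)%C) by (intros; ring).
rewrite Zseries_scal by exact H. ring.
Qed.

Lemma laurent_delta (i : Z) (c w : C) :
  laurent (fun K => c * delta i K)%C w = (c * epow w (IZR i))%C.
Proof.
unfold laurent. rewrite (Zseries_single _ i).
- unfold lterm, delta. destruct (Z.eq_dec i i); [ring|easy].
- intros k Hk. unfold lterm, delta. destruct (Z.eq_dec k i); [easy|ring].
Qed.

Section Core.
Variable tau : C.
Hypothesis Htau : 0 < Im tau.
Variables p j r : Z.
Hypothesis Hp : (1 <= p)%Z.
Hypothesis Hj : (1 <= j)%Z.

Notation Q := (epow tau).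
Notation P := (2 * p + j)%Z.
Let h : C := eta3 tau.

Lemma h_neq0 : h <> 0.
Proof. exact (eta3_neq0 tau Htau). Qed.

(* z -> q^(2p) z multiplies the series by q^(p - pP) z^(-P). *)
Definition quasi (a : Z -> C) : Prop :=
  forall K, (a K * Q (2 * IZR p * IZR K))%C = (Q (IZR p - IZR p * IZR P) * a (K + P)%Z)%C.

Lemma quasi_plus (a b : Z -> C) : quasi a -> quasi b -> quasi (fun k => a k + b k)%C.
Proof. intros Ha Hb K. rewrite Cmult_plus_distr_r, Ha, Hb. ring. Qed.

Lemma quasi_scal (c : C) (a : Z -> C) : quasi a -> quasi (fun k => c * a k)%C.
Proof. intros Ha K. rewrite <- Cmult_assoc, Ha. ring. Qed.

Lemma quasi_csum (n : nat) (a : nat -> Z -> C) :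
  (forall i, (i < n)%nat -> quasi (a i)) -> quasi (fun k => csum n (fun i => a i k)).
Proof.
induction n as [|n IH]; intros H; simpl.
- intros K. ring.
- apply quasi_plus; auto.
Qed.

Lemma entire_csum (n : nat) (a : nat -> Z -> C) :
  (forall i, (i < n)%nat -> entire (a i)) -> entire (fun k => csum n (fun i => a i k)).
Proof.
induction n as [|n IH]; intros H; simpl.
- intros w. apply (asum_ext (fun _ => RtoC 0)); [|apply asum_zero].
  intros k. unfold lterm. ring.
- apply entire_plus; auto.
Qed.

Lemma laurent_csum (n : nat) (a : nat -> Z -> C) (w : C) :
  (forall i, (i < n)%nat -> entire (a i)) ->
  laurent (fun k => csum n (fun i => a i k)) w = csum n (fun i => laurent (a i) w).
Proof.
induction n as [|n IH]; intros H; simpl.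
- transitivity (Zseries (fun _ => RtoC 0)); [|apply Zseries_zero].
  apply Zseries_ext. intros k. unfold lterm. ring.
- rewrite laurent_plus; [now rewrite IH by auto| |auto]. apply entire_csum. auto.
Qed.

Lemma quasi_laurent (a : Z -> C) (w : C) : entire a -> quasi a ->
  laurent a (w + RtoC (2 * IZR p) * tau) =
  (Q (IZR p - IZR p * IZR P) * epow w (- IZR P) * laurent a w)%C.
Proof.
intros Ha Hq. rewrite <- laurent_translate.
rewrite <- (laurent_shift a P w (Ha w)).
rewrite (laurent_ext _ (fun K => Q (IZR p - IZR p * IZR P) * a (K + P)%Z)%C).
- rewrite laurent_scal.
  + rewrite (epow_opp w). field. apply epow_neq0.
  + intros v. apply (asum_ext (fun k => / epow v (IZR P) * lterm a v (k + P))%C).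
    * intros k. unfold lterm. rewrite (plus_IZR k), epow_add. field. apply epow_neq0.
    * apply asum_scal, asum_shift, Ha.
- intros K. rewrite <- Hq. ring.
Qed.

Lemma quasi_zero (a : Z -> C) (t c : Z) : entire a -> quasi a ->
  laurent a ((IZR t) * tau) = RtoC 0 ->
  laurent a ((IZR (t + 2 * p * c)) * tau) = 0.
Proof.
intros Ha Hq H0. revert c.
assert (S : forall t, laurent a ((IZR (t + 2 * p)) * tau) =
   (Q (IZR p - IZR p * IZR P) * epow ((IZR t) * tau) (- IZR P) * laurent a ((IZR t) * tau))%C).
{ intros t'. rewrite <- quasi_laurent by assumption. f_equal.
  rewrite plus_IZR, mult_IZR, RtoC_plus. ring. }
intros c. induction c as [|c IH|c IH] using Z.peano_ind.
- replace (t + 2 * p * 0)%Z with t by ring. exact H0.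
- replace (t + 2 * p * Z.succ c)%Z with (t + 2 * p * c + 2 * p)%Z by ring.
  rewrite S, IH. ring.
- replace (t + 2 * p * c)%Z with (t + 2 * p * Z.pred c + 2 * p)%Z in IH by lia.
  rewrite S in IH.
  set (x := laurent a ((IZR (t + 2 * p * Z.pred c)) * tau)) in *. set (y := (Q _ * epow _ _)%C) in
      IH.
  assert (N : y <> 0) by (apply Cmult_neq_0; apply epow_neq0).
  rewrite <- (Cmult_1_l x), <- (Cinv_l _ N), <- Cmult_assoc, IH. ring.
Qed.

(* The pole of the nu-th summand lies at z = q^(-n). *)
Definition pole (n0 nu : Z) : Z := (2 * p * nu + n0)%Z.

Definition polar_term (n0 u : Z) (w : C) (nu : Z) : C :=
  (Q (IZR j * IZR p * IZR nu ^ 2) * epow w (IZR j * IZR nu)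
   * epow (w + (IZR (pole n0 nu)) * tau) (IZR u)
   / (1 - epow (w + (IZR (pole n0 nu)) * tau) 1))%C.

Definition polar (n0 u : Z) (w : C) : C := Zseries (polar_term n0 u w).

(** With y = q^n z, theta at z is a monomial times (1 - y) [rtheta] at y, so multiplying the nu-th
    summand by theta removes its pole. These are the coefficients of the translate of [rtheta] that
    is left. *)
Definition pt_family (n0 u nu K : Z) : C :=
  let n := pole n0 nu in
  let k := (K - j * nu - n - u)%Z in
  (sg n * Q (IZR j * IZR p * IZR nu ^ 2 + IZR n * (IZR n - 1) / 2 + IZR n * (IZR k + IZR u))
   * rtheta_coeff tau k)%C.

(* The Laurent coefficients of j(z; q) times the polar sum. *)
Definition pt_coeff (n0 u K : Z) : C := Zseries (fun nu => pt_family n0 u nu K).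

Let pt_shift (u nu : Z) : Z := (j * nu + u)%Z.
Let pt_beta (n0 u : Z) (w : C) (nu : Z) : C :=
  (epow w (IZR u) * lterm (fun nu => Q (IZR j * IZR p * IZR nu ^ 2 - IZR (pole n0 nu) + IZR (pole
      n0 nu) * IZR u)) (RtoC (IZR j) * w) nu)%C.
Let pt_g (w : C) (k : Z) : C :=
  (RtoC (sig_bd tau) * lterm (fun k => Q (IZR k * (IZR k + 1) / 2)) w k)%C.

Lemma jp_pos : 0 < IZR j * IZR p.
Proof. apply Rmult_lt_0_compat; apply IZR_lt; lia. Qed.

Lemma asum_pt_beta (n0 u : Z) (w : C) : asum (pt_beta n0 u w).
Proof.
apply asum_scal.
apply (entire_qgauss tau Htau _ 1 (IZR j * IZR p) (2 * IZR p * (IZR u - 1)) (IZR n0 * (IZR u - 1)));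
  [apply jp_pos|].
intros nu. rewrite Rmult_1_l. right. f_equal. f_equal. unfold pole.
rewrite plus_IZR, !mult_IZR. ring.
Qed.

Lemma asum_pt_g (w : C) : asum (pt_g w).
Proof.
apply asum_scal.
apply (entire_qgauss tau Htau _ 1 (1 / 2) (1 / 2) 0); [lra|].
intros k. rewrite Rmult_1_l. right. f_equal. f_equal. field.
Qed.

(** The row is recentred at j nu + u and not at its own centre j nu + n + u. Then n(n-1)/2 + n(k-n)
    + (k-n)(k-n+1)/2 collapses to k(k+1)/2 - n, with no cross term in n and k, and the bound
    factors. *)
Lemma pt_dom (n0 u : Z) (w : C) (nu k : Z) :
  Cmod (pt_family n0 u nu (k + pt_shift u nu) * epow w (IZR (k + pt_shift u nu))) <=
  Cmod (pt_beta n0 u w nu) * Cmod (pt_g w k).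
Proof.
unfold pt_family. set (n := pole n0 nu). unfold pt_shift.
replace (k + (j * nu + u) - j * nu - n - u)%Z with (k - n)%Z by lia.
rewrite !Cmod_mult, Cmod_sg, Rmult_1_l.
assert (L := rtheta_coeff_le tau Htau (k - n)).
unfold pt_beta, pt_g, lterm. rewrite !Cmod_mult, Cmod_sig_bd by exact Htau.
fold n.
set (X := Cmod (Q (IZR j * IZR p * IZR nu ^ 2 + IZR n * (IZR n - 1) / 2 + IZR n * (IZR (k - n) +
    IZR u)))).
apply (Rle_trans _ (X * (sig_bd tau * Cmod (Q (IZR (k - n) * (IZR (k - n) + 1) / 2))) * Cmod (epow
    w (IZR (k + (j * nu + u)))))).
- apply Rmult_le_compat_r; [apply Cmod_ge_0|].
  apply Rmult_le_compat_l; [apply Cmod_ge_0|exact L].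
- right.
  transitivity (sig_bd tau * (X * Cmod (Q (IZR (k - n) * (IZR (k - n) + 1) / 2)) * Cmod (epow w
      (IZR (k + (j * nu + u)))))); [ring|].
  transitivity (sig_bd tau * (Cmod (epow w (IZR u)) * Cmod (Q (IZR j * IZR p * IZR nu ^ 2 - IZR n
      + IZR n * IZR u)) * Cmod (epow (RtoC (IZR j) * w) (IZR nu)) * Cmod (Q (IZR k * (IZR k + 1) /
      2)) * Cmod (epow w (IZR k)))); [|ring].
  f_equal. unfold X. rewrite <- !Cmod_mult. f_equal. clearbody n. rewrite epow_scale. emono.
Qed.

Lemma entire_pt (n0 u : Z) : entire (pt_coeff n0 u).
Proof.
intros w. exact (family_asum (pt_family n0 u) w (pt_shift u) _ _
  (asum_pt_beta n0 u w) (asum_pt_g w) (pt_dom n0 u w)).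
Qed.

Lemma asum_pt_family (n0 u K : Z) : asum (fun nu => pt_family n0 u nu K).
Proof.
exact (family_outer (pt_family n0 u) (RtoC 0) (pt_shift u) _ _
  (asum_pt_beta n0 u _) (asum_pt_g _) (pt_dom n0 u _) K).
Qed.

Definition pt_value (n0 u : Z) (w : C) (nu : Z) : C :=
  let n := pole n0 nu in
  (sg n * Q (IZR j * IZR p * IZR nu ^ 2 + IZR n * (IZR n - 1) / 2 + IZR n * IZR u)
   * epow w (IZR j * IZR nu + IZR n + IZR u) * rtheta tau (w + (IZR n) * tau))%C.

Lemma laurent_pt_family (n0 u nu : Z) (w : C) :
  laurent (pt_family n0 u nu) w = pt_value n0 u w nu.
Proof.
assert (A : asum (lterm (pt_family n0 u nu) w)).
{ exact (family_inner (pt_family n0 u) w (pt_shift u) _ _ (asum_pt_g w) (pt_dom n0 u w) nu). }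
rewrite <- (laurent_shift _ (j * nu + pole n0 nu + u) w A).
rewrite (laurent_ext _ (fun k => (sg (pole n0 nu) * Q (IZR j * IZR p * IZR nu ^ 2 +
   IZR (pole n0 nu) * (IZR (pole n0 nu) - 1) / 2 + IZR (pole n0 nu) * IZR u)) *
   (Q (IZR (pole n0 nu) * IZR k) * rtheta_coeff tau k))%C).
- rewrite laurent_scal by apply entire_translate, entire_rtheta, Htau.
  rewrite laurent_translate. unfold pt_value, rtheta.
  rewrite !plus_IZR, mult_IZR. ring.
- intros k. unfold pt_family. set (n := pole n0 nu). clearbody n.
  replace (k + (j * nu + n + u) - j * nu - n - u)%Z with k by lia.
  replace (Q (IZR j * IZR p * IZR nu ^ 2 + IZR n * (IZR n - 1) / 2 + IZR n * (IZR k + IZR u))) with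
    (Q (IZR j * IZR p * IZR nu ^ 2 + IZR n * (IZR n - 1) / 2 + IZR n * IZR u) * Q (IZR n * IZR k))%C
    by emono.
  ring.
Qed.

Lemma laurent_pt (n0 u : Z) (w : C) :
  laurent (pt_coeff n0 u) w = Zseries (pt_value n0 u w).
Proof.
etransitivity; [exact (family_laurent (pt_family n0 u) w (pt_shift u) _ _
  (asum_pt_beta n0 u w) (asum_pt_g w) (pt_dom n0 u w))|].
apply Zseries_ext. intros nu. apply laurent_pt_family.
Qed.

Lemma asum_pt_value (n0 u : Z) (w : C) : asum (pt_value n0 u w).
Proof.
apply (asum_ext (fun nu => laurent (pt_family n0 u nu) w)).
- intros nu. exact (laurent_pt_family n0 u nu w).
- exact (family_asum_outer (pt_family n0 u) w (pt_shift u) _ _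
    (asum_pt_beta n0 u w) (asum_pt_g w) (pt_dom n0 u w)).
Qed.

Lemma pole_neq1 (w : C) (n : Z) : theta tau w <> RtoC 0 ->
  (1 - epow (w + (IZR n) * tau) 1)%C <> 0.
Proof.
intros H E. assert (X := rtheta_theta tau Htau (w + (IZR n) * tau)).
rewrite E, Cmult_0_l, theta_shift in X by exact Htau.
symmetry in X. revert X.
repeat apply Cmult_neq_0; try apply epow_neq0; exact H.
Qed.

Lemma theta_polar_term (n0 u : Z) (w : C) (nu : Z) : theta tau w <> RtoC 0 ->
  (theta tau w * polar_term n0 u w nu)%C = pt_value n0 u w nu.
Proof.
intros H. unfold polar_term, pt_value. set (n := pole n0 nu).
assert (N := pole_neq1 w n H).
assert (X := rtheta_theta tau Htau (w + (IZR n) * tau)).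
rewrite theta_shift in X by exact Htau.
assert (Y : theta tau w = (sg n * Q (IZR n * (IZR n - 1) / 2) * epow w (IZR n) *
   ((1 - epow (w + (IZR n) * tau) 1) * rtheta tau (w + (IZR n) * tau)))%C).
{ rewrite X, !epow_opp.
  transitivity (theta tau w * (sg n * sg n))%C; [rewrite sg_sqr; ring|].
  field. split; apply epow_neq0. }
rewrite Y at 1.
set (D := (1 - epow (w + (IZR n) * tau) 1)%C) in *.
set (V := rtheta tau (w + (IZR n) * tau)).
transitivity ((Q (IZR n * (IZR n - 1) / 2) * epow w (IZR n) *
   (Q (IZR j * IZR p * IZR nu ^ 2) * epow w (IZR j * IZR nu) * epow (w + (IZR n) * tau) (IZR u)))
   * (sg n * V))%C; [field; exact N|].
transitivity ((Q (IZR j * IZR p * IZR nu ^ 2 + IZR n * (IZR n - 1) / 2 + IZR n * IZR u)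
   * epow w (IZR j * IZR nu + IZR n + IZR u)) * (sg n * V))%C; [|ring].
f_equal. clearbody n. rewrite epow_plus, epow_scale. emono.
Qed.

Lemma asum_polar (n0 u : Z) (w : C) : theta tau w <> RtoC 0 -> asum (polar_term n0 u w).
Proof.
intros H. apply (asum_ext (fun nu => / theta tau w * pt_value n0 u w nu)%C).
- intros nu. rewrite <- theta_polar_term by exact H. field. exact H.
- apply asum_scal, asum_pt_value.
Qed.

Lemma theta_polar (n0 u : Z) (w : C) : theta tau w <> RtoC 0 ->
  (theta tau w * polar n0 u w)%C = laurent (pt_coeff n0 u) w.
Proof.
intros H. unfold polar. rewrite <- Zseries_scal by (now apply asum_polar).
rewrite laurent_pt. apply Zseries_ext. intros nu. now apply theta_polar_term.
Qed.

(** Under nu -> nu + 1 the pole index n grows by 2p and j nu by j, so K -> K + P with P = 2p + j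
    leaves k = K - j nu - n - u fixed. Only powers of q remain to be compared. *)
Lemma quasi_pt (n0 u : Z) : quasi (pt_coeff n0 u).
Proof.
intros K. unfold pt_coeff.
rewrite Cmult_comm, <- Zseries_scal by apply asum_pt_family.
rewrite <- Zseries_scal by apply asum_pt_family.
rewrite <- (Zseries_succ (fun nu => Q (IZR p - IZR p * IZR P) * pt_family n0 u nu (K + P))%C)
  by apply asum_scal, asum_pt_family.
apply Zseries_ext. intros nu. unfold pt_family.
assert (En : pole n0 (nu + 1) = (pole n0 nu + 2 * p)%Z) by (unfold pole; ring).
rewrite En. set (n := pole n0 nu). clearbody n. clear En.
replace (K + P - j * (nu + 1) - (n + 2 * p) - u)%Z with (K - j * nu - n - u)%Z by ring.
rewrite sg_plus, sg_even.
set (k := (K - j * nu - n - u)%Z).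
assert (EK : K = (k + j * nu + n + u)%Z) by (unfold k; ring). clearbody k. subst K.
set (c := rtheta_coeff tau k). clearbody c.
transitivity ((Q (2 * IZR p * IZR (k + j * nu + n + u)) * Q (IZR j * IZR p * IZR nu ^ 2 + IZR n *
    (IZR n - 1) / 2 + IZR n * (IZR k + IZR u))) * (sg n * c))%C; [ring|].
transitivity ((Q (IZR p - IZR p * IZR P) * Q (IZR j * IZR p * IZR (nu + 1) ^ 2 + IZR (n + 2 * p) *
    (IZR (n + 2 * p) - 1) / 2 + IZR (n + 2 * p) * (IZR k + IZR u))) * (sg n * c))%C; [|ring].
f_equal. emono.
Qed.

Lemma laurent_pt_q0 (n0 u t : Z) : (forall nu, pole n0 nu <> (- t)%Z) ->
  laurent (pt_coeff n0 u) ((IZR t) * tau) = 0.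
Proof.
intros H. rewrite laurent_pt. rewrite <- Zseries_zero. apply Zseries_ext. intros nu.
unfold pt_value.
replace ((IZR t) * tau + (IZR (pole n0 nu)) * tau)%C with
  ((IZR (t + pole n0 nu)) * tau)%C by (rewrite plus_IZR, RtoC_plus; ring).
rewrite rtheta_q; [ring|exact Htau|]. specialize (H nu). lia.
Qed.

(** [rtheta] vanishes at all powers of q except 1, so only nu = 0 contributes. There y = 1, and the
    factor y^u disappears: the choice of u does not affect the residues. *)
Lemma laurent_pt_q (n u : Z) :
  laurent (pt_coeff n u) ((IZR (- n)) * tau) =
  (sg n * Q (- (IZR n * (IZR n + 1) / 2)) * h)%C.
Proof.
rewrite laurent_pt. rewrite (Zseries_single _ 0).
- unfold pt_value. replace (pole n 0) with n by (unfold pole; ring).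
  replace ((IZR (- n)) * tau + (IZR n) * tau)%C with (RtoC 0)
    by (rewrite opp_IZR, RtoC_opp; ring).
  fold (eta3 tau). fold h. rewrite epow_scale.
  rewrite <- (Cmult_assoc (sg n)). f_equal. f_equal. emono.
- intros nu Hnu. unfold pt_value.
  replace ((IZR (- n)) * tau + (IZR (pole n nu)) * tau)%C with
    ((IZR (2 * p * nu)) * tau)%C by
    (unfold pole; rewrite opp_IZR, plus_IZR, RtoC_plus, RtoC_opp; ring).
  rewrite rtheta_q; [ring|exact Htau|]. nia.
Qed.

(** * The Weyl-Kac numerator and its residues *)

Definition num_weight (i : Z) : C :=
  Q (IZR p * IZR P * IZR i ^ 2 + IZR p * (2 * IZR r + 1) * IZR i).

Definition num_exp1 (i : Z) : Z := (- P * i - r)%Z.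
Definition num_exp2 (i : Z) : Z := (P * i + r + 1)%Z.

(* q^(1/8) z^(1/2) times the Weyl-Kac numerator, up to a power of q. *)
Definition numer (w : C) : C :=
  Zseries (fun i => num_weight i * (epow w (IZR (num_exp1 i)) - epow w (IZR (num_exp2 i))))%C.

Lemma pP_pos : 0 < IZR p * IZR P.
Proof. apply Rmult_lt_0_compat; apply IZR_lt; lia. Qed.

Lemma asum_num_aux (w : C) (a b : Z) :
  asum (fun i => num_weight i * epow w (IZR (a * i + b)))%C.
Proof.
apply (asum_ext (fun i => epow w (IZR b) * lterm num_weight (RtoC (IZR a) * w) i)%C).
- intros i. unfold lterm. rewrite epow_scale, plus_IZR, mult_IZR, epow_add. ring.
- apply asum_scal.
  apply (entire_qgauss tau Htau _ 1 (IZR p * IZR P) (IZR p * (2 * IZR r + 1)) 0); [apply pP_pos|].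
  intros i. rewrite Rmult_1_l. right. unfold num_weight. f_equal. f_equal. ring.
Qed.

Lemma asum_num1 (w : C) : asum (fun i => num_weight i * epow w (IZR (num_exp1 i)))%C.
Proof. exact (asum_num_aux w (- P) (- r)). Qed.

Lemma asum_num2 (w : C) : asum (fun i => num_weight i * epow w (IZR (num_exp2 i)))%C.
Proof.
apply (asum_ext (fun i => num_weight i * epow w (IZR (P * i + (r + 1))))%C);
  [|apply asum_num_aux].
intros i. unfold num_exp2. now rewrite Z.add_assoc.
Qed.

Lemma asum_delta0 : asum (delta 0).
Proof.
apply (asum_single _ 0). intros k Hk. unfold delta. now destruct (Z.eq_dec k 0).
Qed.

Section Monomials.
Variable ex : Z -> Z.
Hypothesis Hex : forall w, asum (fun i => num_weight i * epow w (IZR (ex i)))%C.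

Let fam (i K : Z) : C := (num_weight i * delta (ex i) K)%C.

Lemma mono_dom (w : C) (i k : Z) :
  Cmod (fam i (k + ex i) * epow w (IZR (k + ex i))) <=
  Cmod (num_weight i * epow w (IZR (ex i))) * Cmod (delta 0 k).
Proof.
unfold fam, delta. destruct (Z.eq_dec (k + ex i) (ex i)); destruct (Z.eq_dec k 0); try lia.
- subst k. rewrite Cmod_1, Z.add_0_l, Cmult_1_r. lra.
- rewrite Cmod_0, Cmult_0_r, Cmult_0_l, Cmod_0. lra.
Qed.

(** A sum over all i of weights placed at [ex i], which avoids solving [ex i = K] for i and lets
    quasi-periodicity be checked term by term. *)
Definition mono_coeff (K : Z) : C := Zseries (fun i => fam i K).

Lemma entire_mono : entire mono_coeff.
Proof.
intros w. exact (family_asum fam w ex _ _ (Hex w) asum_delta0 (mono_dom w)).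
Qed.

Lemma laurent_mono (w : C) :
  laurent mono_coeff w = Zseries (fun i => num_weight i * epow w (IZR (ex i)))%C.
Proof.
etransitivity; [exact (family_laurent fam w ex _ _ (Hex w) asum_delta0 (mono_dom w))|].
apply Zseries_ext. intros i. apply laurent_delta.
Qed.

Lemma asum_mono_family (K : Z) : asum (fun i => fam i K).
Proof. exact (family_outer fam (RtoC 0) ex _ _ (Hex _) asum_delta0 (mono_dom _) K). Qed.

Lemma quasi_mono (eps : Z) :
  (forall i, ex (i + eps) = (ex i + P)%Z) ->
  (forall i, (num_weight i * Q (2 * IZR p * IZR (ex i)))%C =
             (Q (IZR p - IZR p * IZR P) * num_weight (i + eps))%C) ->
  quasi mono_coeff.
Proof.
intros H1 H2 K. unfold mono_coeff.
rewrite Cmult_comm, <- Zseries_scal by apply asum_mono_family.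
rewrite <- Zseries_scal by apply asum_mono_family.
rewrite <- (Zseries_shift (fun i => Q (IZR p - IZR p * IZR P) * fam i (K + P))%C eps)
  by apply asum_scal, asum_mono_family.
apply Zseries_ext. intros i. unfold fam. rewrite H1. unfold delta.
destruct (Z.eq_dec K (ex i)); destruct (Z.eq_dec (K + P) (ex i + P)); try lia.
- subst K. rewrite !Cmult_1_r, <- H2. ring.
- ring.
Qed.

End Monomials.

Definition num_coeff (K : Z) : C := (mono_coeff num_exp1 K + - RtoC 1 * mono_coeff num_exp2 K)%C.

Lemma entire_num : entire num_coeff.
Proof.
apply entire_plus; [|apply entire_scal]; apply entire_mono;
  [apply asum_num1|apply asum_num2].
Qed.

Lemma quasi_num : quasi num_coeff.
Proof.
apply quasi_plus; [|apply quasi_scal].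
- apply (quasi_mono num_exp1 asum_num1 (-1)).
  + intros i. unfold num_exp1. ring.
  + intros i. unfold num_weight, num_exp1. emono.
- apply (quasi_mono num_exp2 asum_num2 1).
  + intros i. unfold num_exp2. ring.
  + intros i. unfold num_weight, num_exp2. emono.
Qed.

Lemma laurent_num (w : C) : laurent num_coeff w = numer w.
Proof.
unfold num_coeff. rewrite laurent_plus, laurent_scal.
- rewrite (laurent_mono _ asum_num1), (laurent_mono _ asum_num2).
  rewrite <- Zseries_scal by apply asum_num2.
  rewrite <- Zseries_plus; [|apply asum_num1|apply asum_scal, asum_num2].
  apply Zseries_ext. intros i. ring.
- apply entire_mono, asum_num2.
- apply entire_mono, asum_num1.
- apply entire_scal, entire_mono, asum_num2.
Qed.

Lemma asum_numer (w : C) :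
  asum (fun i => num_weight i * (epow w (IZR (num_exp1 i)) - epow w (IZR (num_exp2 i))))%C.
Proof.
apply (asum_ext (fun i => num_weight i * epow w (IZR (num_exp1 i)) +
   - RtoC 1 * (num_weight i * epow w (IZR (num_exp2 i))))%C); [intros; ring|].
apply asum_plus; [apply asum_num1|apply asum_scal, asum_num2].
Qed.

(** The Weyl reflection: [num_exp1 i] and [num_exp2 i] add up to 1, so z -> 1/z exchanges the two
    monomials up to the factor 1/z. *)
Lemma numer_opp (w : C) : numer (- w) = (- epow w (-1) * numer w)%C.
Proof.
unfold numer. rewrite <- Zseries_scal by apply asum_numer.
apply Zseries_ext. intros i.
replace (epow (- w) (IZR (num_exp1 i))) with (epow w (-1) * epow w (IZR (num_exp2 i)))%C
  by (unfold num_exp1, num_exp2; emono).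
replace (epow (- w) (IZR (num_exp2 i))) with (epow w (-1) * epow w (IZR (num_exp1 i)))%C
  by (unfold num_exp1, num_exp2; emono).
ring.
Qed.

Lemma C_eq_opp (x : C) : x = (- x)%C -> x = 0.
Proof.
intros H. apply (f_equal (fun y => y + x)%C) in H.
replace (- x + x)%C with (RtoC 0) in H by ring.
destruct x as [a b]. unfold Cplus in H. simpl in H. inversion H.
apply injective_projections; simpl; lra.
Qed.

Lemma numer_0 : numer (RtoC 0) = 0.
Proof.
apply C_eq_opp. rewrite <- (Cmult_1_l (numer _)) at 2.
rewrite <- (epow_zero_l (-1)).
transitivity (- epow (RtoC 0) (-1) * numer (RtoC 0))%C; [|ring].
rewrite <- numer_opp. f_equal. ring.
Qed.

(** The point q^(-p) goes to q^p both under z -> 1/z and under z -> q^(2p) z. The two transformation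
    rules give values of the numerator that differ by a sign. *)
Lemma numer_qp : numer ((IZR p) * tau) = 0.
Proof.
assert (E := quasi_laurent num_coeff (- ((IZR p) * tau)) entire_num quasi_num).
rewrite !laurent_num, numer_opp in E.
replace (- ((IZR p) * tau) + RtoC (2 * IZR p) * tau)%C with ((IZR p) * tau)%C in E
  by (rewrite RtoC_mult; ring).
apply C_eq_opp. rewrite E at 1.
transitivity (- (Q (IZR p - IZR p * IZR P) * epow (- ((IZR p) * tau)) (- IZR P) *
   epow ((IZR p) * tau) (-1)) * numer ((IZR p) * tau))%C; [ring|].
replace (Q (IZR p - IZR p * IZR P) * epow (- ((IZR p) * tau)) (- IZR P) *
   epow ((IZR p) * tau) (-1))%C with (RtoC 1).
- ring.
- rewrite <- (epow_0 tau). rewrite epow_scale.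
  replace (- ((IZR p) * tau))%C with (RtoC (- IZR p) * tau)%C by (rewrite RtoC_opp; ring).
  rewrite epow_scale, <- !epow_add. f_equal. ring.
Qed.

(* h times the residue data of numer / theta at z = q^(-n). *)
Definition resid (n : Z) : C :=
  (sg n * Q (IZR n * (IZR n + 1) / 2) * numer ((IZR (- n)) * tau))%C.

(** This oddness lets a single coefficient serve the poles n and -n, and so the pair of Appell
    functions attached to one m. *)
Lemma resid_opp (n : Z) : resid (- n) = (- resid n)%C.
Proof.
unfold resid. rewrite Z.opp_involutive, sg_opp.
replace ((IZR n) * tau)%C with (- ((IZR (- n)) * tau))%C
  by (rewrite opp_IZR, RtoC_opp; ring).
rewrite numer_opp, epow_scale.
transitivity (- (Q (IZR (- n) * (IZR (- n) + 1) / 2) * Q (IZR (- n) * -1)) * (sg n * numer ((IZR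
    (- n)) * tau)))%C; [ring|].
replace (Q (IZR (- n) * (IZR (- n) + 1) / 2) * Q (IZR (- n) * -1))%C with
  (Q (IZR n * (IZR n + 1) / 2)) by emono.
ring.
Qed.

Definition npol : nat := Z.to_nat (p - 1).
(** Equal to m - p with m = i + 1, where m is the summation index of the theorem. *)
Definition pidx (i : nat) : Z := (Z.of_nat i + 1 - p)%Z.

Lemma pidx_bounds (i : nat) : (i < npol)%nat -> (- p < pidx i < 0)%Z.
Proof. unfold npol, pidx. lia. Qed.

(** Poles at n divisible by p are absent because the numerator vanishes there. The exponents 1 - j
    and 1 are the ones for which [annsum_window] holds and for which [sum_B1] and [sum_B2] produce
    the denominators of the Appell functions. *)
Definition polar_part (w : C) : C :=
  csum npol (fun i => resid (pidx i) * polar (pidx i) (1 - j) w +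
                      resid (- pidx i) * polar (- pidx i) 1 w)%C.

Definition ptsum_coeff (K : Z) : C :=
  csum npol (fun i => resid (pidx i) * pt_coeff (pidx i) (1 - j) K +
                      resid (- pidx i) * pt_coeff (- pidx i) 1 K)%C.

Lemma entire_ptsum : entire ptsum_coeff.
Proof.
apply (entire_csum npol (fun i K => resid (pidx i) * pt_coeff (pidx i) (1 - j) K +
                      resid (- pidx i) * pt_coeff (- pidx i) 1 K)%C).
intros i _. apply entire_plus; apply entire_scal, entire_pt.
Qed.

Lemma quasi_ptsum : quasi ptsum_coeff.
Proof.
apply (quasi_csum npol (fun i K => resid (pidx i) * pt_coeff (pidx i) (1 - j) K +
                      resid (- pidx i) * pt_coeff (- pidx i) 1 K)%C).
intros i _. apply quasi_plus; apply quasi_scal, quasi_pt.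
Qed.

Lemma laurent_ptsum (w : C) : laurent ptsum_coeff w =
  csum npol (fun i => resid (pidx i) * laurent (pt_coeff (pidx i) (1 - j)) w +
                      resid (- pidx i) * laurent (pt_coeff (- pidx i) 1) w)%C.
Proof.
unfold ptsum_coeff.
rewrite (laurent_csum npol (fun i K => resid (pidx i) * pt_coeff (pidx i) (1 - j) K +
                      resid (- pidx i) * pt_coeff (- pidx i) 1 K)%C).
- apply csum_ext. intros i _.
  rewrite laurent_plus, !laurent_scal; try reflexivity; try apply entire_scal; apply entire_pt.
- intros i _. apply entire_plus; apply entire_scal, entire_pt.
Qed.

Lemma theta_polar_part (w : C) : theta tau w <> RtoC 0 ->
  (theta tau w * polar_part w)%C = laurent ptsum_coeff w.
Proof.
intros H. rewrite laurent_ptsum. unfold polar_part. rewrite <- csum_scal.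
apply csum_ext. intros i _. rewrite <- !theta_polar by exact H. ring.
Qed.

(* The holomorphic part of numer / theta, multiplied by theta. *)
Definition hol_coeff (K : Z) : C := (num_coeff K + - / h * ptsum_coeff K)%C.

Lemma entire_hol : entire hol_coeff.
Proof. apply entire_plus; [apply entire_num|apply entire_scal, entire_ptsum]. Qed.

Lemma quasi_hol : quasi hol_coeff.
Proof. apply quasi_plus; [apply quasi_num|apply quasi_scal, quasi_ptsum]. Qed.

Lemma laurent_hol (w : C) :
  laurent hol_coeff w = (numer w - / h * laurent ptsum_coeff w)%C.
Proof.
unfold hol_coeff. rewrite laurent_plus, laurent_scal, laurent_num.
- ring.
- apply entire_ptsum.
- apply entire_num.
- apply entire_scal, entire_ptsum.
Qed.

Lemma resid_cancel (n : Z) :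
  (resid n * (sg n * Q (- (IZR n * (IZR n + 1) / 2)) * h))%C = (h * numer ((IZR (- n)) * tau))%C.
Proof.
unfold resid. rewrite epow_opp.
transitivity ((sg n * sg n) * (h * numer ((IZR (- n)) * tau)))%C.
- field. apply epow_neq0.
- rewrite sg_sqr. ring.
Qed.

(** One full period of exponents modulo 2p. At t = 0 and t = p the numerator vanishes and no polar
    family meets the point; at every other t exactly one family does, and its weight was chosen to
    cancel the numerator. *)
Lemma laurent_hol_q0 (t : Z) : (- p < t <= p)%Z ->
  laurent hol_coeff ((IZR t) * tau) = 0.
Proof.
intros Ht. rewrite laurent_hol, laurent_ptsum.
assert (Z1 : forall i, (i < npol)%nat -> (- t <> pidx i)%Z ->
   laurent (pt_coeff (pidx i) (1 - j)) ((IZR t) * tau) = 0).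
{ intros i Hi Hn. apply pidx_bounds in Hi. apply laurent_pt_q0. intros nu E. unfold pole in E.
  assert (C3 : (nu = 0 \/ 1 <= nu \/ nu <= -1)%Z) by lia.
  destruct C3 as [->|[C3|C3]]; [lia|nia|nia]. }
assert (Z2 : forall i, (i < npol)%nat -> (- t <> - pidx i)%Z ->
   laurent (pt_coeff (- pidx i) 1) ((IZR t) * tau) = 0).
{ intros i Hi Hn. apply pidx_bounds in Hi. apply laurent_pt_q0. intros nu E. unfold pole in E.
  assert (C3 : (nu = 0 \/ 1 <= nu \/ nu <= -1)%Z) by lia.
  destruct C3 as [->|[C3|C3]]; [lia|nia|nia]. }
destruct (Z_le_gt_dec 1 t) as [L1|L1]; [destruct (Z.eq_dec t p) as [->|L2]|destruct (Z.eq_dec t 0)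
    as [->|L2]].
- rewrite numer_qp, (csum_ext _ _ (fun _ => RtoC 0)), csum_zero; [ring|].
  intros i Hi. assert (B := pidx_bounds i Hi). rewrite Z1, Z2 by lia. ring.
- rewrite (csum_single _ (Z.to_nat (p - 1 - t))); [|unfold npol; lia|].
  + assert (E : pidx (Z.to_nat (p - 1 - t)) = (- t)%Z) by (unfold pidx; lia).
    rewrite Z2 by (unfold npol; lia). rewrite E.
    rewrite Cmult_0_r, Cplus_0_r.
    assert (V := laurent_pt_q (- t) (1 - j)). rewrite Z.opp_involutive in V. rewrite V.
    rewrite resid_cancel, Z.opp_involutive. field. apply h_neq0.
  + intros i Hi Hne. assert (B := pidx_bounds i Hi).
    rewrite Z1, Z2; try lia; [ring|]. unfold pidx. lia.
- rewrite Cmult_0_l, numer_0, (csum_ext _ _ (fun _ => RtoC 0)), csum_zero; [ring|].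
  intros i Hi. assert (B := pidx_bounds i Hi).
  rewrite Cmult_0_l in Z1, Z2. rewrite Z1, Z2 by lia. ring.
- rewrite (csum_single _ (Z.to_nat (p - 1 + t))); [|unfold npol; lia|].
  + assert (E : pidx (Z.to_nat (p - 1 + t)) = t) by (unfold pidx; lia).
    rewrite Z1 by (unfold npol; lia). rewrite E.
    rewrite Cmult_0_r, Cplus_0_l.
    assert (V := laurent_pt_q (- t) 1). rewrite Z.opp_involutive in V. rewrite V.
    rewrite resid_cancel, Z.opp_involutive. field. apply h_neq0.
  + intros i Hi Hne. assert (B := pidx_bounds i Hi).
    rewrite Z1, Z2; try lia; [ring|]. unfold pidx. lia.
Qed.

Lemma laurent_hol_q (t : Z) : laurent hol_coeff ((IZR t) * tau) = 0.
Proof.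
set (c := ((t + p - 1) / (2 * p))%Z).
assert (E := Z_div_mod_eq_full (t + p - 1) (2 * p)). fold c in E.
assert (B := Z.mod_pos_bound (t + p - 1) (2 * p) ltac:(lia)).
set (m := ((t + p - 1) mod (2 * p))%Z) in *.
replace t with (m - p + 1 + 2 * p * c)%Z by lia.
apply quasi_zero; [apply entire_hol|apply quasi_hol|].
apply laurent_hol_q0. lia.
Qed.

(* The Laurent coefficients of the holomorphic part of numer / theta. *)
Definition quot_coeff (k : Z) : C := (/ h * conv hol_coeff (sig tau) k)%C.

(** Each use of [conv_sig_step] replaces e(z) by e(qz), so the step after t needs the zero of the
    holomorphic part at q^(t+1). *)
Lemma conv_sig_iter (t : nat) (k : Z) :
  conv (fun i => Q (INR t * IZR i) * hol_coeff i)%C (sig tau) (k - Z.of_nat t) =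
  (sg (Z.of_nat t) * Q (INR t * IZR k - INR t * (INR t - 1) / 2) * conv hol_coeff (sig tau) k)%C.
Proof.
induction t as [|t IH].
- simpl Z.of_nat. simpl INR. unfold sg. replace (0 * IZR k - 0 * (0 - 1) / 2) with 0 by field.
  rewrite !epow_0, !Cmult_1_l. replace (k - 0)%Z with k by lia.
  unfold conv. apply Zseries_ext. intros i. rewrite Rmult_0_l, epow_0. ring.
- set (e := fun i => (Q (INR t * IZR i) * hol_coeff i)%C) in *.
  assert (En : entire e) by (apply entire_translate, entire_hol).
  assert (St := conv_sig_step tau Htau e (k - Z.of_nat t) (entire_asum _ En)).
  assert (A : asum (fun i => Q (IZR i) * e i)%C).
  { apply (asum_ext (lterm e tau)); [|apply En]. intros i. unfold lterm. ring. }
  assert (V : laurent e tau = 0).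
  { unfold e. rewrite laurent_translate.
    replace (tau + RtoC t * tau)%C with (RtoC (IZR (Z.of_nat (S t))) * tau)%C.
    - apply laurent_hol_q.
    - rewrite <- INR_IZR_INZ, S_INR, RtoC_plus. ring. }
  specialize (St A V).
  replace (k - Z.of_nat (S t))%Z with (k - Z.of_nat t - 1)%Z by lia.
  transitivity (conv (fun i => Q (IZR i) * e i)%C (sig tau) (k - Z.of_nat t - 1)).
  + unfold conv. apply Zseries_ext. intros i. unfold e. rewrite Cmult_assoc.
    f_equal. f_equal. rewrite S_INR. emono.
  + rewrite St, IH. rewrite Nat2Z.inj_succ. unfold Z.succ. rewrite sg_succ.
    replace (Q (S t * IZR k - S t * (S t - 1) / 2)) with
      (Q (IZR (k - Z.of_nat t)) * Q (INR t * IZR k - INR t * (INR t - 1) / 2))%C.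
    * ring.
    * rewrite S_INR, <- epow_add. f_equal. rewrite minus_IZR, <- INR_IZR_INZ. field.
Qed.

(** The iteration with t = 2p: quasi-periodicity rewrites q^(2pi) e_i as a multiple of e_(i+P),
    which turns the convolution at k - 2p into one at k - 2p + P = k + j. The sign is trivial
    because 2p is even. *)
Lemma quot_rec (k : Z) :
  quot_coeff (k + j) = (Q (2 * IZR p * IZR k + IZR p * IZR j) * quot_coeff k)%C.
Proof.
assert (E := conv_sig_iter (Z.to_nat (2 * p)) k).
rewrite INR_IZR_INZ, Z2Nat.id, sg_even in E by lia.
assert (E2 : conv (fun i => Q (IZR (2 * p) * IZR i) * hol_coeff i)%C (sig tau) (k - 2 * p) =
   (Q (IZR p - IZR p * IZR P) * conv hol_coeff (sig tau) (k + j))%C).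
{ unfold conv.
  assert (A := asum_mul_sig tau Htau hol_coeff (k + j) (entire_asum _ entire_hol)).
  rewrite <- (Zseries_shift _ P A). rewrite <- Zseries_scal by exact (asum_shift _ P A).
  apply Zseries_ext. intros i.
  assert (X := quasi_hol i). rewrite Cmult_comm in X.
  rewrite mult_IZR, X. replace (k + j - (i + P))%Z with (k - 2 * p - i)%Z by lia. ring. }
rewrite E2 in E. unfold quot_coeff.
set (x := conv hol_coeff (sig tau) (k + j)) in *. set (y := conv hol_coeff (sig tau) k) in *.
replace x with (/ Q (IZR p - IZR p * IZR P) * (Q (IZR p - IZR p * IZR P) * x))%C
  by (field; apply epow_neq0).
rewrite E. clearbody x y.
transitivity ((/ Q (IZR p - IZR p * IZR P) * Q (IZR (2 * p) * IZR k - IZR (2 * p) * (IZR (2 * p) -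
    1) / 2)) * (/ h * y))%C; [ring|].
transitivity (Q (2 * IZR p * IZR k + IZR p * IZR j) * (/ h * y))%C; [|ring].
f_equal. emono.
Qed.

Lemma quot_class (s n : Z) :
  quot_coeff (s + j * n) = (Q (IZR p * IZR j * IZR n ^ 2 + 2 * IZR p * IZR s * IZR n) * quot_coeff
      s)%C.
Proof.
induction n as [|n IH|n IH] using Z.peano_ind.
- replace (s + j * 0)%Z with s by ring.
  replace (IZR p * IZR j * 0 ^ 2 + 2 * IZR p * IZR s * 0) with 0 by ring. rewrite epow_0. ring.
- replace (s + j * Z.succ n)%Z with (s + j * n + j)%Z by ring.
  rewrite quot_rec, IH, Cmult_assoc. f_equal. emono.
- replace (s + j * n)%Z with (s + j * Z.pred n + j)%Z in IH by lia.
  rewrite quot_rec in IH.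
  set (x := quot_coeff (s + j * Z.pred n)) in *.
  replace x with (/ Q (2 * IZR p * IZR (s + j * Z.pred n) + IZR p * IZR j) *
     (Q (2 * IZR p * IZR (s + j * Z.pred n) + IZR p * IZR j) * x))%C by (field; apply epow_neq0).
  rewrite IH, Cmult_assoc. f_equal. clear IH x.
  assert (En : IZR n = IZR (Z.pred n) + 1) by (rewrite <- plus_IZR; f_equal; lia).
  rewrite En. generalize (Z.pred n). intros m. emono.
Qed.

(** Completing the square in [quot_class], the coefficients on each class modulo j are a constant
    times q^((p/j) k^2). The constant [K] adds up the moduli over the j classes. *)
Lemma entire_quot : entire quot_coeff.
Proof.
set (K := rsum (Z.to_nat j) (fun s => Cmod (quot_coeff (Z.of_nat s) * Q (- (IZR p / IZR j * INR s
    ^ 2))))).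
assert (Hj' : 0 < IZR j) by (apply IZR_lt; lia).
apply (entire_qgauss tau Htau _ K (IZR p / IZR j) 0 0).
{ apply Rdiv_lt_0_compat; [apply IZR_lt; lia|exact Hj']. }
intros k.
assert (E := Z_div_mod_eq_full k j). assert (B := Z.mod_pos_bound k j ltac:(lia)).
set (n := (k / j)%Z) in *. set (s := (k mod j)%Z) in *.
replace k with (s + j * n)%Z by lia. rewrite quot_class.
assert (L : Cmod (quot_coeff s * Q (- (IZR p / IZR j * IZR s ^ 2))) <= K).
{ unfold K. assert (Hs : (Z.to_nat s < Z.to_nat j)%nat) by lia.
  replace s with (Z.of_nat (Z.to_nat s)) by lia. rewrite <- INR_IZR_INZ.
  set (F := fun s : nat => Cmod (quot_coeff (Z.of_nat s) * Q (- (IZR p / IZR j * INR s ^ 2)))).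
  change (F (Z.to_nat s) <= rsum (Z.to_nat j) F).
  induction (Z.to_nat j) as [|m IH]; [lia|]. cbn [rsum].
  assert (0 <= rsum m F).
  { clear. induction m; simpl; [lra|]. apply Rplus_le_le_0_compat; [exact IHm|apply Cmod_ge_0]. }
  assert (0 <= F m) by apply Cmod_ge_0.
  destruct (Nat.eq_dec (Z.to_nat s) m) as [->|Ne]; [lra|].
  specialize (IH ltac:(lia)). lra. }
rewrite (Rmult_comm K).
apply (Rle_trans _ (Cmod (Q (IZR p / IZR j * IZR (s + j * n) ^ 2)) * Cmod (quot_coeff s * Q (-
    (IZR p / IZR j * IZR s ^ 2))))).
- right. rewrite <- Cmod_mult. f_equal.
  replace (Q (IZR p * IZR j * IZR n ^ 2 + 2 * IZR p * IZR s * IZR n)) with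
    (Q (IZR p / IZR j * IZR (s + j * n) ^ 2) * Q (- (IZR p / IZR j * IZR s ^ 2)))%C.
  + ring.
  + rewrite <- epow_add. f_equal. rewrite plus_IZR, mult_IZR. field. lra.
- replace (IZR p / IZR j * IZR (s + j * n) ^ 2 + 0 * IZR (s + j * n) + 0) with
    (IZR p / IZR j * IZR (s + j * n) ^ 2) by ring.
  apply Rmult_le_compat_l; [apply Cmod_ge_0|exact L].
Qed.

(** Associativity of convolution: theta is regrouped with [sig], whose convolution is h at 0 and
    vanishes elsewhere. The interchange needs only the uniform bound on [sig]. *)
Lemma conv_theta_quot (k : Z) : conv (theta_coeff tau) quot_coeff k = hol_coeff k.
Proof.
set (f := fun l i : Z => (theta_coeff tau l * (/ h * (hol_coeff i * sig tau (k - l - i))))%C).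
assert (Hb : asum (fun l => RtoC (sig_bd tau) * theta_coeff tau l)%C)
  by apply asum_scal, entire_asum, entire_theta, Htau.
assert (Hg : asum (fun i => / h * hol_coeff i)%C)
  by apply asum_scal, entire_asum, entire_hol.
assert (Hf : forall l i, Cmod (f l (i + 0)%Z) <=
   Cmod (RtoC (sig_bd tau) * theta_coeff tau l) * Cmod (/ h * hol_coeff i)).
{ intros l i. rewrite Z.add_0_r. unfold f. rewrite !Cmod_mult, Cmod_sig_bd by exact Htau.
  assert (L := sig_le tau Htau (k - l - i)).
  transitivity (Cmod (theta_coeff tau l) * (Cmod (/ h) * (Cmod (hol_coeff i) * sig_bd tau)));
      [|right; ring].
  repeat (apply Rmult_le_compat_l; [apply Cmod_ge_0|]). exact L. }
assert (F := fubini f (fun _ => 0%Z) _ _ Hb Hg Hf).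
transitivity (Zseries (fun l => Zseries (f l))).
- unfold conv at 1. apply Zseries_ext. intros l. unfold f, quot_coeff.
  assert (A := asum_mul_sig tau Htau hol_coeff (k - l) (entire_asum _ entire_hol)).
  rewrite Zseries_scal by (now apply asum_scal). rewrite Zseries_scal by exact A. reflexivity.
- rewrite F. rewrite (Zseries_single _ k).
  + transitivity (/ h * hol_coeff k * conv (theta_coeff tau) (sig tau) 0)%C.
    * unfold conv. rewrite <- Zseries_scal by (apply asum_mul_sig, entire_asum, entire_theta;
        exact Htau).
      apply Zseries_ext. intros l. unfold f. replace (k - l - k)%Z with (0 - l)%Z by lia. ring.
    * rewrite conv_theta_sig by exact Htau. simpl. fold h. field. apply h_neq0.
  + intros i Hi. transitivity (/ h * hol_coeff i * conv (theta_coeff tau) (sig tau) (k - i))%C.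
    * unfold conv. rewrite <- Zseries_scal by (apply asum_mul_sig, entire_asum, entire_theta;
        exact Htau).
      apply Zseries_ext. intros l. unfold f. replace (k - l - i)%Z with (k - i - l)%Z by lia. ring.
    * rewrite conv_theta_sig by exact Htau. destruct (Z.eq_dec (k - i) 0); [lia|]. ring.
Qed.

Lemma theta_quot (w : C) : (theta tau w * laurent quot_coeff w)%C = laurent hol_coeff w.
Proof.
unfold theta. rewrite <- laurent_conv; [|apply entire_theta, Htau|apply entire_quot].
apply laurent_ext, conv_theta_quot.
Qed.

Theorem numer_decomposition (w : C) : theta tau w <> RtoC 0 ->
  (numer w / theta tau w)%C = (laurent quot_coeff w + / h * polar_part w)%C.
Proof.
intros H.
assert (E1 := theta_quot w). rewrite laurent_hol, <- theta_polar_part in E1 by exact H.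
replace (numer w) with (theta tau w * laurent quot_coeff w + / h * (theta tau w * polar_part w))%C.
- field. split; [exact h_neq0|exact H].
- rewrite E1. ring.
Qed.

End Core.

(** * Expansion in the annulus and uniqueness of Laurent coefficients *)

(* Coefficients of the geometric expansion of 1/(1 - y) for |y| < 1 when
   [n > 0] and for |y| > 1 otherwise. *)
Definition geo (n k : Z) : C :=
  if (0 <? n)%Z then (if (k <? 0)%Z then RtoC 0 else RtoC 1)
  else (if (k <? 0)%Z then (- RtoC 1)%C else RtoC 0).

(** Both choices of [geo n] jump by 1 at k = 0 and are constant elsewhere, so multiplication by 1 -
    y leaves 1 in either case. *)
Lemma geo_sum (n : Z) (v : C) :
  asum (lterm (geo n) v) -> (1 - epow v 1)%C <> RtoC 0 ->
  laurent (geo n) v = (/ (1 - epow v 1))%C.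
Proof.
intros A N.
assert (A1 : asum (fun k => lterm (geo n) v (k + -1))) by now apply asum_shift.
assert (E : ((1 - epow v 1) * laurent (geo n) v)%C = RtoC 1).
{ transitivity (laurent (geo n) v + (- epow v 1) * Zseries (fun k => lterm (geo n) v (k + -1)))%C.
  - rewrite (Zseries_shift _ _ A). unfold laurent. ring.
  - unfold laurent. rewrite <- Zseries_scal by exact A1.
    rewrite <- Zseries_plus; [|exact A|now apply asum_scal].
    rewrite (Zseries_single _ 0).
    + unfold lterm. replace (- epow v 1 * (geo n (0 + -1) * epow v (IZR (0 + -1))))%C with
        (- geo n (-1) * (epow v 1 * epow v (IZR (-1))))%C by (simpl; ring).
      rewrite <- epow_add. replace (1 + IZR (-1)) with 0 by lra. rewrite epow_0.
      unfold geo. destruct (0 <? n)%Z; simpl; ring.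
    + intros k Hk. unfold lterm.
      replace (epow v (IZR k)) with (epow v 1 * epow v (IZR (k + -1)))%C by emono.
      assert (G : geo n (k + -1) = geo n k).
      { unfold geo. destruct (Z.ltb_spec (k + -1) 0); destruct (Z.ltb_spec k 0); try lia; easy. }
      rewrite G. ring. }
set (D := (1 - epow v 1)%C) in *.
transitivity (/ D * (D * laurent (geo n) v))%C; [field; exact N|]. rewrite E. ring.
Qed.

Lemma Im_plus_scal (w tau : C) (n : R) : Im (w + RtoC n * tau) = Im w + n * Im tau.
Proof. destruct w, tau. simpl. ring. Qed.

Lemma Im_scal (a : R) (x : C) : Im (RtoC a * x) = a * Im x.
Proof. destruct x. simpl. ring. Qed.

Section Annulus.
Variable tau : C.
Hypothesis Htau : 0 < Im tau.
Variables p j r : Z.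
Hypothesis Hp : (1 <= p)%Z.
Hypothesis Hj : (1 <= j)%Z.
Variable w : C.
Hypothesis Hw : Rabs (Im w) < Im tau.
Hypothesis Hth : theta tau w <> 0.

Notation Q := (epow tau).

Let c : R := 2 * PI * (Im tau - Rabs (Im w)).

Lemma c_pos : 0 < c.
Proof. unfold c. pose proof PI_RGT_0. apply Rmult_lt_0_compat; lra. Qed.

(** Where [geo n k] is nonzero, n and k have compatible signs and n k >= |k|. Hence one decay rate,
    set by the distance from |z| to the edges of the annulus, serves for all n. *)
Lemma geo_le (n k : Z) : n <> 0%Z ->
  Cmod (geo n k * epow (w + (IZR n) * tau) (IZR k)) <= exp (- c * Rabs (IZR k)).
Proof.
intros Hn. rewrite Cmod_mult.
assert (B : (0 < n /\ k < 0)%Z \/ (n <= 0 /\ 0 <= k)%Z \/ ((Z.abs k <= n * k)%Z)) by nia.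
destruct B as [B|[B|B]].
- unfold geo. destruct (Z.ltb_spec 0 n); destruct (Z.ltb_spec k 0); try lia.
  rewrite Cmod_0, Rmult_0_l. apply Rlt_le, exp_pos.
- unfold geo. destruct (Z.ltb_spec 0 n); destruct (Z.ltb_spec k 0); try lia.
  rewrite Cmod_0, Rmult_0_l. apply Rlt_le, exp_pos.
- assert (G : Cmod (geo n k) <= 1).
  { unfold geo. destruct (0 <? n)%Z; destruct (k <? 0)%Z;
      rewrite ?Cmod_opp, ?Cmod_0, ?Cmod_1; lra. }
  rewrite <- (Rmult_1_l (exp _)). apply Rmult_le_compat; try apply Cmod_ge_0; [exact G|].
  rewrite Cmod_epow, Im_plus_scal. apply exp_le.
  apply IZR_le in B. rewrite abs_IZR, mult_IZR in B.
  unfold c. pose proof PI_RGT_0 as HP.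
  assert (D : - Rabs (Im w) * Rabs (IZR k) <= Im w * IZR k).
  { rewrite <- Ropp_mult_distr_l, <- Rabs_mult. pose proof (Rle_abs (- (Im w * IZR k))) as X.
    rewrite Rabs_Ropp in X. lra. }
  assert (D2 : Im tau * Rabs (IZR k) <= Im tau * (IZR n * IZR k))
    by (apply Rmult_le_compat_l; lra).
  assert (D3 : (Im tau - Rabs (Im w)) * Rabs (IZR k) <= (Im w + IZR n * Im tau) * IZR k) by lra.
  apply (Rmult_le_compat_l (2 * PI)) in D3; lra.
Qed.

Lemma asum_geo (n : Z) : n <> 0%Z -> asum (lterm (geo n) (w + (IZR n) * tau)).
Proof.
intros Hn. apply (asum_le _ (fun k => RtoC (exp (- c * Rabs (IZR k)))));
  [|apply asum_exp_abs, c_pos].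
intros k. rewrite Cmod_exp.
now apply geo_le.
Qed.

Definition ann_family (n0 u nu K : Z) : C :=
  let n := pole p n0 nu in
  let k := (K - j * nu - u)%Z in
  (Q (IZR j * IZR p * IZR nu ^ 2 + IZR n * (IZR u + IZR k)) * geo n k)%C.

Definition ann_coeff (n0 u K : Z) : C := Zseries (fun nu => ann_family n0 u nu K).

Let ann_shift (u nu : Z) : Z := (j * nu + u)%Z.
Let ann_beta (n0 u nu : Z) : C :=
  (epow w (IZR u) * lterm (fun nu => Q (IZR j * IZR p * IZR nu ^ 2 + IZR (pole p n0 nu) * IZR u))
     (RtoC (IZR j) * w) nu)%C.
Let ann_g (k : Z) : C := RtoC (exp (- c * Rabs (IZR k))).

Lemma asum_ann_beta (n0 u : Z) : asum (ann_beta n0 u).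
Proof.
apply asum_scal.
apply (entire_qgauss tau Htau _ 1 (IZR j * IZR p) (2 * IZR p * IZR u) (IZR n0 * IZR u));
  [apply jp_pos; assumption|].
intros nu. rewrite Rmult_1_l. right. f_equal. f_equal. unfold pole.
rewrite plus_IZR, !mult_IZR. ring.
Qed.

Lemma asum_ann_g : asum ann_g.
Proof. apply asum_exp_abs, c_pos. Qed.

Section Pole.
Variables n0 u : Z.
Hypothesis Hn0 : (- p < n0 < p)%Z.
Hypothesis Hn0' : n0 <> 0%Z.

Lemma pole_neq0 (nu : Z) : pole p n0 nu <> 0%Z.
Proof.
unfold pole. intros E.
assert (C3 : (nu = 0 \/ 1 <= nu \/ nu <= -1)%Z) by lia.
destruct C3 as [->|[C3|C3]]; [lia|nia|nia].
Qed.

Lemma ann_dom (nu k : Z) :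
  Cmod (ann_family n0 u nu (k + ann_shift u nu) * epow w (IZR (k + ann_shift u nu))) <=
  Cmod (ann_beta n0 u nu) * Cmod (ann_g k).
Proof.
unfold ann_family. assert (Hn := pole_neq0 nu). set (n := pole p n0 nu) in *.
unfold ann_shift. replace (k + (j * nu + u) - j * nu - u)%Z with k by lia.
unfold ann_g. rewrite Cmod_exp.
apply (Rle_trans _ (Cmod (ann_beta n0 u nu) * Cmod (geo n k * epow (w + (IZR n) * tau) (IZR k)))).
- right. rewrite <- Cmod_mult. f_equal. unfold ann_beta, lterm. fold n. clearbody n.
  transitivity ((Q (IZR j * IZR p * IZR nu ^ 2 + IZR n * (IZR u + IZR k)) * epow w (IZR (k + (j *
      nu + u)))) * geo n k)%C; [ring|].
  transitivity ((epow w (IZR u) * Q (IZR j * IZR p * IZR nu ^ 2 + IZR n * IZR u) * epow (RtoC (IZR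
      j) * w) (IZR nu) * epow (w + (IZR n) * tau) (IZR k)) * geo n k)%C; [|ring].
  f_equal. rewrite epow_scale, epow_plus, epow_scale. emono.
- apply Rmult_le_compat_l; [apply Cmod_ge_0|]. now apply geo_le.
Qed.

Lemma asum_ann : asum (lterm (ann_coeff n0 u) w).
Proof.
exact (family_asum (ann_family n0 u) w (ann_shift u) _ _ (asum_ann_beta n0 u) asum_ann_g ann_dom).
Qed.

Lemma laurent_ann_family (nu : Z) : laurent (ann_family n0 u nu) w = polar_term tau p j n0 u w nu.
Proof.
assert (A : asum (lterm (ann_family n0 u nu) w)).
{ exact (family_inner (ann_family n0 u) w (ann_shift u) _ _ asum_ann_g ann_dom nu). }
rewrite <- (laurent_shift _ (j * nu + u) w A).
assert (Hn := pole_neq0 nu). unfold polar_term. set (n := pole p n0 nu) in *.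
assert (N := pole_neq1 tau Htau w n Hth).
rewrite (laurent_ext _ (fun k => Q (IZR j * IZR p * IZR nu ^ 2 + IZR n * IZR u) *
   (Q (IZR n * IZR k) * geo n k))%C).
- assert (A' : asum (lterm (fun k => Q (IZR n * IZR k) * geo n k)%C w)).
  { apply (asum_ext (lterm (geo n) (w + (IZR n) * tau))); [|now apply asum_geo].
    intros k. unfold lterm. rewrite epow_plus, epow_scale. ring. }
  assert (LS : laurent (fun k => Q (IZR j * IZR p * IZR nu ^ 2 + IZR n * IZR u) *
     (Q (IZR n * IZR k) * geo n k))%C w =
     (Q (IZR j * IZR p * IZR nu ^ 2 + IZR n * IZR u) * laurent (fun k => Q (IZR n * IZR k) * geo n
         k) w)%C).
  { unfold laurent. rewrite <- Zseries_scal by exact A'. apply Zseries_ext. intros k. unfold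
      lterm. ring. }
  rewrite LS, laurent_translate, (geo_sum n _ (asum_geo n Hn) N).
  unfold Cdiv. rewrite Cmult_assoc. f_equal. clearbody n. rewrite epow_plus, epow_scale. emono.
- intros k. unfold ann_family. fold n.
  replace (k + (j * nu + u) - j * nu - u)%Z with k by lia.
  rewrite Cmult_assoc. f_equal. emono.
Qed.

Lemma laurent_ann : laurent (ann_coeff n0 u) w = polar tau p j n0 u w.
Proof.
etransitivity; [exact (family_laurent (ann_family n0 u) w (ann_shift u) _ _
   (asum_ann_beta n0 u) asum_ann_g ann_dom)|].
apply Zseries_ext. intros nu. apply laurent_ann_family.
Qed.

End Pole.

Definition annsum_coeff (K : Z) : C :=
  csum (npol p) (fun i => resid tau p j r (pidx p i) * ann_coeff (pidx p i) (1 - j) K +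
                      resid tau p j r (- pidx p i) * ann_coeff (- pidx p i) 1 K)%C.

Lemma asum_annsum : asum (lterm annsum_coeff w) /\
  laurent annsum_coeff w = polar_part tau p j r w.
Proof.
set (F := fun i k => (resid tau p j r (pidx p i) * lterm (ann_coeff (pidx p i) (1 - j)) w k +
                      resid tau p j r (- pidx p i) * lterm (ann_coeff (- pidx p i) 1) w k)%C).
assert (E : forall k, csum (npol p) (fun i => F i k) = lterm annsum_coeff w k).
{ intros k. unfold lterm, annsum_coeff. rewrite Cmult_comm, <- csum_scal.
  apply csum_ext. intros i _. unfold F, lterm. ring. }
assert (A : forall i, (i < npol p)%nat ->
   asum (lterm (ann_coeff (pidx p i) (1 - j)) w) /\ asum (lterm (ann_coeff (- pidx p i) 1) w)).
{ intros i Hi. assert (B := pidx_bounds p Hp i Hi).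
  split; apply asum_ann; lia. }
assert (AF : forall i, (i < npol p)%nat -> asum (F i)).
{ intros i Hi. destruct (A i Hi). apply asum_plus; now apply asum_scal. }
split.
- apply (asum_ext _ _ E). now apply asum_csum.
- unfold laurent. rewrite <- (Zseries_ext _ _ E), Zseries_csum by exact AF.
  apply csum_ext. intros i Hi. destruct (A i Hi) as [A1 A2]. assert (B := pidx_bounds p Hp i Hi).
  unfold F. rewrite Zseries_plus, !Zseries_scal; try assumption; try (now apply asum_scal).
  f_equal; f_equal; apply laurent_ann; lia.
Qed.

End Annulus.

(** The exponents of z are j nu + u + k. For n0 < 0, u = 1 - j, the pole index is positive exactly
    when nu >= 1; for n0 > 0, u = 1, exactly when nu >= 0. In both cases the exponents are at least
    1 on the positive side and at most -j on the other. *)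
Lemma annsum_window (tau : C) (p j r s : Z) : (1 <= p)%Z -> (0 <= s < j)%Z ->
  annsum_coeff tau p j r (- s) = 0.
Proof.
intros Hp Hs. unfold annsum_coeff.
rewrite (csum_ext _ _ (fun _ => RtoC 0)); [apply csum_zero|].
intros i Hi. assert (B := pidx_bounds p Hp i Hi).
assert (Z0 : forall n0 u, (forall nu, geo (pole p n0 nu) (- s - j * nu - u) = 0) ->
   ann_coeff tau p j n0 u (- s) = 0).
{ intros n0 u H. unfold ann_coeff. etransitivity; [|apply Zseries_zero].
  apply Zseries_ext. intros nu. unfold ann_family. rewrite H. ring. }
rewrite !Z0; [ring| |]; intros nu; unfold geo, pole;
  destruct (Z.ltb_spec 0 (2 * p * nu + - pidx p i)) as [L|L];
  destruct (Z.ltb_spec 0 (2 * p * nu + pidx p i)) as [L2|L2];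
  match goal with |- context [(?k <? 0)%Z] => destruct (Z.ltb_spec k 0) as [L3|L3] end;
  try easy; exfalso;
  (assert (C3 : (nu <= -1 \/ nu = 0 \/ 1 <= nu)%Z) by lia;
   destruct C3 as [C3|[->|C3]]; nia).
Qed.

(** * Uniqueness of Laurent coefficients *)

Lemma Cconv_bound_all (u : nat -> C) (l : C) : Cconv u l -> exists M, forall n, Cmod (u n) <= M.
Proof.
intros H. destruct (Cconv_bounded u l H) as [N HN].
exists (Cmod l + 1 + rsum N (fun k => Cmod (u k))). intros n.
assert (P : forall m, 0 <= rsum m (fun k => Cmod (u k))).
{ induction m as [|m IH]; simpl; [lra|]. pose proof (Cmod_ge_0 (u m)). lra. }
destruct (le_lt_dec N n) as [L|L].
- specialize (HN n L). specialize (P N). lra.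
- pose proof (Cmod_ge_0 l).
  assert (Cmod (u n) <= rsum N (fun k => Cmod (u k))); [|lra].
  clear HN. induction N as [|N IH]; [lia|]. simpl.
  destruct (Nat.eq_dec n N) as [->|Ne].
  + specialize (P N). lra.
  + specialize (IH ltac:(lia)). pose proof (Cmod_ge_0 (u N)). lra.
Qed.

Lemma is_series_bound (a : nat -> C) (l : C) : is_series a l -> exists M, forall n, Cmod (a n) <= M.
Proof.
intros H. apply is_series_Cconv in H. destruct (Cconv_bound_all _ _ H) as [M HM].
exists (2 * M). intros n.
replace (a n) with (csum (S n) a + - csum n a)%C by (simpl; ring).
eapply Rle_trans; [apply Cmod_triangle|]. rewrite Cmod_opp.
pose proof (HM n). pose proof (HM (S n)). lra.
Qed.

Lemma epow_real_neq1 (x : R) : 0 < x < 1 -> epow (RtoC x) 1 <> RtoC 1.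
Proof.
intros Hx E. apply (f_equal Re) in E. unfold epow, Cexp in E. simpl in E.
replace ((2 * PI * 1 * 0 - 0 * 1) * x - (2 * PI * 1 * 1 + 0 * 0) * 0) with 0 in E by ring.
replace ((2 * PI * 1 * 0 - 0 * 1) * 0 + (2 * PI * 1 * 1 + 0 * 0) * x) with (2 * (PI * x)) in E by
    ring.
rewrite exp_0, Rmult_1_l, cos_2a_sin in E.
assert (S : 0 < sin (PI * x)).
{ pose proof PI_RGT_0. apply sin_gt_0; nra. }
nra.
Qed.

(* Averages over the (M+1)-st roots of unity. *)
Definition rou_avg (M : nat) (d : Z) : C :=
  (csum (S M) (fun t => epow (RtoC (INR t / INR (S M))) (IZR d)) / RtoC (INR (S M)))%C.

Lemma SM_neq0 (M : nat) : RtoC (INR (S M)) <> 0.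
Proof.
intros E. apply RtoC_inj in E. rewrite S_INR in E. pose proof (pos_INR M). lra.
Qed.

Lemma rou_avg_0 (M : nat) : rou_avg M 0 = RtoC 1.
Proof.
unfold rou_avg.
assert (E : forall m, csum m (fun t => epow (RtoC (INR t / INR (S M))) 0) = RtoC (INR m)).
{ induction m as [|m IH]; [easy|]. rewrite (S_INR m), RtoC_plus. cbn [csum]. rewrite IH, epow_0.
    reflexivity. }
rewrite E. field. apply SM_neq0.
Qed.

Lemma rou_avg_le (M : nat) (d : Z) : Cmod (rou_avg M d) <= 1.
Proof.
unfold rou_avg. rewrite Cmod_div by apply SM_neq0.
assert (P : 0 < INR (S M)) by (rewrite S_INR; pose proof (pos_INR M); lra).
rewrite Cmod_R, Rabs_right by lra. apply Rle_div_l; [exact P|]. rewrite Rmult_1_l.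
eapply Rle_trans; [apply csum_mod_le|].
assert (B : forall m, rsum m (fun t => Cmod (epow (RtoC (INR t / INR (S M))) (IZR d))) <= INR m);
  [|apply B].
induction m as [|m IH]; [simpl; lra|].
rewrite (S_INR m). cbn [rsum]. rewrite Cmod_epow. simpl Im.
replace (- (2 * PI * 0) * IZR d) with 0 by ring. rewrite exp_0. lra.
Qed.

Lemma rou_avg_eq0 (M : nat) (d : Z) : d <> 0%Z -> (Z.abs d < Z.of_nat (S M))%Z ->
  rou_avg M d = 0.
Proof.
intros Hd HM.
assert (P : 0 < INR (S M)) by (rewrite S_INR; pose proof (pos_INR M); lra).
set (zeta := epow (RtoC (IZR d / INR (S M))) 1).
assert (E : forall m, ((1 - zeta) * csum m (fun t => epow (RtoC (INR t / INR (S M))) (IZR d)))%C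
  = (1 - epow (RtoC (INR m / INR (S M))) (IZR d))%C).
{ induction m as [|m IH].
  - simpl. replace (0 / _) with 0 by (unfold Rdiv; ring). rewrite epow_zero_l. ring.
  - cbn [csum]. rewrite Cmult_plus_distr_l, IH.
    replace (epow (RtoC (INR (S m) / INR (S M))) (IZR d)) with
      (zeta * epow (RtoC (INR m / INR (S M))) (IZR d))%C; [ring|].
    unfold zeta. rewrite (S_INR m).
    rewrite <- (Cmult_1_r (RtoC (IZR d / _))), <- (Cmult_1_r (RtoC (INR m / _))),
      <- (Cmult_1_r (RtoC ((INR m + 1) / _))), !epow_scale, <- epow_add.
    f_equal. field. lra. }
assert (N : (1 - zeta)%C <> 0).
{ intros X. apply Ceq_minus in X. symmetry in X. unfold zeta in X.
  apply IZR_lt in HM. rewrite abs_IZR, <- INR_IZR_INZ in HM.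
  destruct (Z_lt_le_dec d 0) as [L|L].
  - apply IZR_lt in L. rewrite Rabs_left in HM by exact L.
    apply (epow_real_neq1 (- (IZR d / INR (S M)))).
    + split.
      * unfold Rdiv. rewrite Ropp_mult_distr_l. apply Rdiv_lt_0_compat; lra.
      * unfold Rdiv. rewrite Ropp_mult_distr_l. apply Rlt_div_l; lra.
    + transitivity (/ epow (RtoC (IZR d / INR (S M))) 1)%C.
      * rewrite <- epow_opp.
        rewrite <- (Cmult_1_r (RtoC (- _))), <- (Cmult_1_r (RtoC (IZR d / _))), !epow_scale.
        f_equal. ring.
      * rewrite X. field.
  - assert (L' : 0 < IZR d) by (apply IZR_lt; lia). rewrite Rabs_right in HM by lra.
    apply (epow_real_neq1 (IZR d / INR (S M))); [|exact X].
    split; [now apply Rdiv_lt_0_compat|]. apply Rlt_div_l; lra. }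
assert (E1 := E (S M)).
replace (INR (S M) / INR (S M)) with 1 in E1 by (field; lra).
assert (O : epow (RtoC 1) (IZR d) = RtoC 1).
{ replace (RtoC 1) with (RtoC 2 * half)%C at 1.
  - rewrite epow_scale, <- mult_IZR. apply epow_half_even.
  - unfold half. rewrite <- RtoC_mult. f_equal. field. }
rewrite O in E1. unfold rou_avg.
set (X := csum (S M) _) in *.
assert (X0 : X = 0).
{ rewrite <- (Cmult_1_l X), <- (Cinv_l _ N), <- Cmult_assoc, E1. ring. }
rewrite X0. field. apply SM_neq0.
Qed.

(** A discrete Cauchy formula on the circle |z| = |q|^(1/2). Since [is_Zseries] asserts convergence
    only, absolute convergence on that circle is established first, from two neighbouring
    circles. *)
Lemma laurent_unique (tau : C) (a : Z -> C) : 0 < Im tau ->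
  (forall w, 0 < Im w < Im tau -> is_Zseries (lterm a w) (RtoC 0)) ->
  forall n, a n = 0.
Proof.
intros Htau H n.
assert (Im_s : forall x, Im (RtoC x * tau) = x * Im tau) by (intros; destruct tau; simpl; ring).
set (w0 := (RtoC (1 / 2) * tau)%C).
(* Bounded terms at q^(1/4) control the indices k >= 0 at q^(1/2), and bounded terms at q^(3/4)
   control k < 0; the gain is exp(-c |k|) with c = 2 pi Im tau / 4. *)
assert (A : asum (lterm a w0)).
{ destruct (H (RtoC (1 / 4) * tau)%C) as (l1 & l2 & H1 & _ & _); [rewrite Im_s; lra|].
  destruct (H (RtoC (3 / 4) * tau)%C) as (l3 & l4 & _ & H2 & _); [rewrite Im_s; lra|].
  destruct (is_series_bound _ _ H1) as [M1 B1]. destruct (is_series_bound _ _ H2) as [M2 B2].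
  set (c := 2 * PI * (Im tau / 4)).
  assert (Hc : 0 < c) by (unfold c; pose proof PI_RGT_0; apply Rmult_lt_0_compat; lra).
  apply (asum_le _ (fun k => RtoC (Rabs M1 + Rabs M2) * RtoC (exp (- c * Rabs (IZR k))))%C);
    [|now apply asum_scal, asum_exp_abs].
  intros k. rewrite Cmod_mult, Cmod_exp, Cmod_R.
  rewrite (Rabs_right (Rabs M1 + Rabs M2)) by
    (apply Rle_ge, Rplus_le_le_0_compat; apply Rabs_pos).
  assert (K : forall x M, Cmod (lterm a (RtoC x * tau) k) <= M ->
     2 * PI * (x * Im tau - Im tau / 2) * IZR k <= - c * Rabs (IZR k) ->
     Cmod (lterm a w0 k) <= Rabs M * exp (- c * Rabs (IZR k))).
  { intros x M HM Hx.
    replace (Cmod (lterm a w0 k)) with (Cmod (lterm a (RtoC x * tau) k) *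
       exp (2 * PI * (x * Im tau - Im tau / 2) * IZR k)).
    - apply Rmult_le_compat; [apply Cmod_ge_0|apply Rlt_le, exp_pos| |now apply exp_le].
      eapply Rle_trans; [exact HM|apply Rle_abs].
    - unfold lterm, w0. rewrite !Cmod_mult, !Cmod_epow, !Im_s, Rmult_assoc, <- exp_plus.
      f_equal. f_equal. field. }
  pose proof (exp_pos (- c * Rabs (IZR k))). pose proof (Rabs_pos M1). pose proof (Rabs_pos M2).
  destruct (Z_lt_le_dec k 0) as [L|L].
  - specialize (B2 (Z.to_nat (- k - 1))).
    replace (- Z.of_nat (S (Z.to_nat (- k - 1))))%Z with k in B2 by lia.
    apply IZR_lt in L. assert (X := K (3 / 4) M2 B2).
    rewrite (Rabs_left (IZR k)) in * by exact L.
    assert (Y := X ltac:(unfold c; right; field)).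
    assert (Z0 := Rmult_le_pos _ _ (Rabs_pos M1) (Rlt_le _ _ (exp_pos (- c * - IZR k)))). lra.
  - specialize (B1 (Z.to_nat k)). rewrite Z2Nat.id in B1 by exact L.
    apply IZR_le in L. assert (X := K (1 / 4) M1 B1).
    rewrite (Rabs_right (IZR k)) in * by lra.
    assert (Y := X ltac:(unfold c; right; field)).
    assert (Z0 := Rmult_le_pos _ _ (Rabs_pos M2) (Rlt_le _ _ (exp_pos (- c * IZR k)))). lra. }
(* The terms of the average of zeta^(-n) times the series over the rotations of q^(1/2) by the
   (M+1)-st roots of unity zeta. Every such average is 0, while the limit M -> oo isolates the index
   n. *)
set (F := fun M k => (lterm a w0 k * rou_avg M (k - n))%C).
assert (Z0 : forall M, Zseries (F M) = 0).
{ intros M.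
  set (wt := fun t : nat => (w0 + RtoC (INR t / INR (S M)))%C).
  assert (At : forall t, asum (lterm a (wt t))).
  { intros t. apply (asum_le _ (lterm a w0)); [|exact A]. intros k. unfold lterm.
    rewrite !Cmod_mult, !Cmod_epow. right. f_equal. f_equal. unfold wt. destruct w0. simpl. ring. }
  assert (Zt : forall t, Zseries (lterm a (wt t)) = 0).
  { intros t. apply is_Zseries_unique; [apply At|]. apply H.
    assert (I0 : Im (wt t) = 1 / 2 * Im tau).
    { unfold wt, w0. rewrite <- Im_s. destruct (RtoC (1 / 2) * tau)%C. simpl. ring. }
    rewrite I0. lra. }
  rewrite (Zseries_ext _ (fun k => csum (S M) (fun t =>
     (epow (RtoC (INR t / INR (S M))) (- IZR n) / RtoC (INR (S M))) * lterm a (wt t) k))%C).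
  - rewrite (Zseries_csum (S M) (fun t k => (epow (RtoC (INR t / INR (S M))) (- IZR n) / RtoC (INR
      (S M))) * lterm a (wt t) k)%C).
    + rewrite (csum_ext _ _ (fun _ => RtoC 0)); [apply csum_zero|].
      intros t _. rewrite Zseries_scal by apply At. rewrite Zt. ring.
    + intros t _. apply asum_scal, At.
  - intros k. unfold F, rou_avg, Cdiv.
    rewrite (Cmult_comm (csum _ _)), Cmult_assoc, <- csum_scal.
    apply csum_ext. intros t _. unfold lterm, wt. rewrite epow_plus.
    rewrite minus_IZR. unfold Rminus. rewrite epow_add. ring. }
assert (L : Cconv (fun M => Zseries (F M)) (Zseries (fun k => lterm a w0 k * delta n k)%C)).
{ apply (Tannery _ _ (lterm a w0) A).
  - intros M k. unfold F. rewrite Cmod_mult. rewrite <- (Rmult_1_r (Cmod (lterm a w0 k))) at 2.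
    apply Rmult_le_compat_l; [apply Cmod_ge_0|apply rou_avg_le].
  - intros k. unfold F. apply Cconv_scal.
    apply (Cconv_eventually (fun _ => delta n k) _ _ (Z.to_nat (Z.abs (k - n)))); [|apply
        Cconv_const].
    intros M HM. unfold delta. destruct (Z.eq_dec k n) as [->|Ne].
    + rewrite Z.sub_diag. symmetry. apply rou_avg_0.
    + symmetry. apply rou_avg_eq0; lia. }
assert (E := Cconv_unique _ _ _ L (Cconv_ext _ _ _ (fun M => eq_sym (Z0 M)) (Cconv_const _))).
rewrite (Zseries_single _ n) in E.
- unfold delta in E. destruct (Z.eq_dec n n); [|easy]. unfold lterm in E.
  assert (N := epow_neq0 w0 (IZR n)).
  replace (a n) with (/ epow w0 (IZR n) * (a n * epow w0 (IZR n) * RtoC 1))%C by (field; exact N).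
  rewrite E. ring.
- intros k Hk. unfold delta. destruct (Z.eq_dec k n); [easy|ring].
Qed.

(** * The character and its string functions *)

Lemma csum_add (n m : nat) (f : nat -> C) :
  csum (n + m) f = (csum n f + csum m (fun i => f (n + i)%nat))%C.
Proof.
induction m as [|m IH].
- rewrite Nat.add_0_r. simpl. ring.
- rewrite Nat.add_succ_r. cbn [csum]. rewrite IH. ring.
Qed.

Lemma zfold_classes (m N : nat) (a : Z -> C) :
  csum (m * N) (zfold a) =
  csum m (fun s => csum N (zfold (fun n => a (Z.of_nat m * n + Z.of_nat s)%Z))).
Proof.
induction N as [|N IH].
- rewrite Nat.mul_0_r. cbn [csum]. now rewrite csum_zero.
- rewrite Nat.mul_succ_r, csum_add, IH. cbn [csum]. rewrite csum_plus. f_equal.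
  unfold zfold. rewrite !csum_plus. f_equal.
  + apply csum_ext. intros i _. f_equal. lia.
  (* The negative half of the fold runs through the residues modulo m in reverse order. *)
  + rewrite csum_rev. apply csum_ext. intros i Hi. f_equal. nia.
Qed.

Lemma asum_class (m s : nat) (a : Z -> C) : (s < m)%nat -> asum a ->
  asum (fun n => a (Z.of_nat m * n + Z.of_nat s)%Z).
Proof.
intros Hs H. apply (asum_bound _ (Zabs a)). intros N.
eapply Rle_trans; [|apply (zpart_le_Zabs a (m * N) H)].
assert (E : RtoC (rsum (m * N) (zmod a)) =
  RtoC (rsum m (fun s => rsum N (zmod (fun n => a (Z.of_nat m * n + Z.of_nat s)%Z))))).
{ assert (Z1 : forall b k, zfold (fun n => RtoC (Cmod (b n))) k = RtoC (zmod b k))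
    by (intros b k; unfold zfold, zmod; now rewrite RtoC_plus).
  rewrite <- (rsum_re_bound (m * N) _ _ (Z1 a)), zfold_classes.
  rewrite <- (rsum_re_bound m _ _ (fun s => eq_refl)).
  apply csum_ext. intros i _. apply rsum_re_bound. intros k. apply Z1. }
apply RtoC_inj in E. rewrite E.
set (F := fun s => rsum N (zmod (fun n => a (Z.of_nat m * n + Z.of_nat s)%Z))).
change (F s <= rsum m F).
assert (P : forall k, 0 <= F k).
{ intros k. unfold F. clear. induction N as [|N IH]; simpl; [lra|].
  apply Rplus_le_le_0_compat; [exact IH|apply zmod_ge0]. }
clear E. clearbody F. assert (P2 : forall k, 0 <= rsum k F).
{ induction k as [|k IH]; simpl; [lra|]. specialize (P k). lra. }
clear -P P2 Hs. induction m as [|m IH]; [lia|]. simpl.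
destruct (Nat.eq_dec s m) as [->|Ne].
- specialize (P2 m). lra.
- specialize (IH ltac:(lia)). specialize (P m). lra.
Qed.

Lemma Zseries_classes (m : nat) (a : Z -> C) : (1 <= m)%nat -> asum a ->
  Zseries a = csum m (fun s => Zseries (fun n => a (Z.of_nat m * n + Z.of_nat s)%Z)).
Proof.
intros Hm H.
apply (Cconv_unique (fun N => csum (m * N) (zfold a))).
- apply (Cconv_subseq (fun n => csum n (zfold a)) _ (fun N => (m * N)%nat)); [intros; nia|].
  now apply Zseries_conv.
- eapply Cconv_ext; [intros N; symmetry; apply zfold_classes|].
  apply Cconv_csum. intros s Hs. apply Zseries_conv. now apply asum_class.
Qed.

(** Up to the factor q^(1/8) z^(-1/2), the two theta functions of degree 2 collect the even and the
    odd powers of z in j(z; q), and the sign between them is the (-1)^n of j. *)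
Lemma char_den_eq (tau w : C) : 0 < Im tau ->
  char_den w tau = (epow tau (1 / 8) * epow w (- (1 / 2)) * theta tau w)%C.
Proof.
intros Htau. assert (A := entire_theta tau Htau w).
assert (A0 := asum_class 2 0 _ (Nat.lt_0_succ 1) A).
assert (A1 := asum_class 2 1 _ (le_n _) A).
assert (H : theta tau w = csum 2 (fun s => Zseries (fun n =>
   lterm (theta_coeff tau) w (Z.of_nat 2 * n + Z.of_nat s)))).
{ apply (Zseries_classes 2); [lia|exact A]. }
rewrite H. cbn [csum]. rewrite Cplus_0_l, Cmult_plus_distr_l.
rewrite <- (Zseries_opp _ A0), <- (Zseries_opp _ A1).
rewrite <- (Zseries_scal _ _ (asum_opp _ A0)), <- (Zseries_scal _ _ (asum_opp _ A1)).
assert (A2 := asum_scal (epow tau (1 / 8) * epow w (- (1 / 2)))%C _ (asum_opp _ A1)).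
assert (T1 : Theta 1 2 w tau = Zseries (fun i => epow tau (1 / 8) * epow w (- (1 / 2)) *
   lterm (theta_coeff tau) w (Z.of_nat 2 * - i + Z.of_nat 0))%C).
{ apply Zseries_ext. intros i. unfold lterm, theta_coeff.
  replace (Z.of_nat 2 * - i + Z.of_nat 0)%Z with (2 * - i)%Z by lia.
  rewrite sg_even. rewrite Cmult_1_l. emono. }
assert (T2 : Theta (-1) 2 w tau = (- Zseries (fun i => epow tau (1 / 8) * epow w (- (1 / 2)) *
   lterm (theta_coeff tau) w (Z.of_nat 2 * - i + Z.of_nat 1)))%C).
{ rewrite <- Zseries_opp_val by exact A2.
  apply Zseries_ext. intros i. unfold lterm, theta_coeff.
  replace (Z.of_nat 2 * - i + Z.of_nat 1)%Z with (2 * - i + 1)%Z by lia.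
  rewrite sg_succ, sg_even.
  transitivity (epow tau (1 / 8) * epow w (- (1 / 2)) * (epow tau (IZR (2 * - i + 1) * (IZR (2 * -
      i + 1) - 1) / 2) * epow w (IZR (2 * - i + 1))))%C; [|ring].
  emono. }
unfold char_den. rewrite T1, T2. ring.
Qed.

Lemma INR_gt0 (n : nat) : (1 <= n)%nat -> 0 < INR n.
Proof. intros H. apply lt_0_INR. lia. Qed.

Lemma Zof_nat_ge1 (n : nat) : (1 <= n)%nat -> (1 <= Z.of_nat n)%Z.
Proof. lia. Qed.

Section Statement.
Variables p j r : nat.
Hypothesis hp : (1 <= p)%nat.
Hypothesis hj : (1 <= j)%nat.
Variable tau : C.
Hypothesis Htau : 0 < Im tau.

Let zp := Z.of_nat p.
Let zj := Z.of_nat j.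
Let zr := Z.of_nat r.
Notation Q := (epow tau).

(** The fractional power of q split off from the character: the i = 0 exponent of the numerator,
    less the 1/8 of the denominator. The factors z^(-1/2) cancel. *)
Definition kappa : C := Q (- (1 / 8) + p * (2 * r + 1) ^ 2 / (4 * (2 * p + j))).

Lemma character_numer (w : C) : theta tau w <> RtoC 0 ->
  character p (2 * p + j) (2 * r) w tau = (kappa * (numer tau zp zj zr w / theta tau w))%C.
Proof.
intros H. unfold character. rewrite char_den_eq by exact Htau.
pose proof (INR_gt0 p hp) as Pp. pose proof (INR_gt0 j hj) as Pj.
assert (ER : INR (2 * r) = 2 * INR r) by (rewrite mult_INR; reflexivity).
assert (EP : INR (2 * p + j) = 2 * INR p + INR j) by (rewrite plus_INR, mult_INR; reflexivity).
set (k' := Q (INR p * (2 * INR r + 1) ^ 2 / (4 * (2 * INR p + INR j)))).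
assert (E1 : Theta (INR (2 * r) + 1) (INR (2 * p + j)) w (RtoC (INR p) * tau) =
  (k' * epow w (- (1 / 2)) * Zseries (fun i => num_weight tau zp zj zr i * epow w (IZR (num_exp1
      zp zj zr i))))%C).
{ unfold Theta. rewrite <- Zseries_scal by (apply asum_num1; [exact Htau|apply (Zof_nat_ge1 p
    hp)|apply (Zof_nat_ge1 j hj)]).
  apply Zseries_ext. intros i. unfold num_weight, num_exp1, k', zp, zj, zr.
  rewrite epow_scale, ER, EP.
  transitivity ((k' * Q (IZR zp * IZR (2 * zp + zj) * IZR i ^ 2 + IZR zp * (2 * IZR zr + 1) * IZR
      i)) * (epow w (- (1 / 2)) * epow w (IZR (num_exp1 zp zj zr i))))%C;
    [|unfold k', num_exp1, zp, zj, zr; ring].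
  f_equal.
  - unfold k', zp, zj, zr. rewrite <- epow_add. f_equal.
    rewrite plus_IZR, mult_IZR, <- !INR_IZR_INZ. field. lra.
  - rewrite <- epow_add. f_equal. unfold num_exp1, zp, zj, zr.
    rewrite minus_IZR, mult_IZR, opp_IZR, plus_IZR, mult_IZR, <- !INR_IZR_INZ. field. lra. }
(* Reversing i gives the second theta function the same weights as the first, so that the difference
   can be taken term by term. *)
assert (E2 : Theta (- (INR (2 * r) + 1)) (INR (2 * p + j)) w (RtoC (INR p) * tau) =
  (k' * epow w (- (1 / 2)) * Zseries (fun i => num_weight tau zp zj zr i * epow w (IZR (num_exp2
      zp zj zr i))))%C).
{ unfold Theta.
  assert (A := asum_num2 tau Htau zp zj zr (Zof_nat_ge1 p hp) (Zof_nat_ge1 j hj) w).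
  rewrite <- (Zseries_opp _ A), <- Zseries_scal by (apply (asum_opp _ A)).
  apply Zseries_ext. intros i.
  rewrite epow_scale, ER, EP. unfold num_weight.
  transitivity ((k' * Q (IZR zp * IZR (2 * zp + zj) * IZR (- i) ^ 2 + IZR zp * (2 * IZR zr + 1) *
      IZR (- i))) * (epow w (- (1 / 2)) * epow w (IZR (num_exp2 zp zj zr (- i)))))%C;
    [|ring].
  f_equal.
  - unfold k', zp, zj, zr. rewrite <- epow_add. f_equal.
    rewrite opp_IZR, plus_IZR, mult_IZR, <- !INR_IZR_INZ. field. lra.
  - rewrite <- epow_add. f_equal. unfold num_exp2, zp, zj, zr.
    rewrite !plus_IZR, !mult_IZR, opp_IZR, plus_IZR, mult_IZR, <- !INR_IZR_INZ. field. lra. }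
rewrite E1, E2.
assert (E3 : numer tau zp zj zr w =
  (Zseries (fun i => num_weight tau zp zj zr i * epow w (IZR (num_exp1 zp zj zr i))) -
   Zseries (fun i => num_weight tau zp zj zr i * epow w (IZR (num_exp2 zp zj zr i))))%C).
{ assert (A1 := asum_num1 tau Htau zp zj zr (Zof_nat_ge1 p hp) (Zof_nat_ge1 j hj) w).
  assert (A2 := asum_num2 tau Htau zp zj zr (Zof_nat_ge1 p hp) (Zof_nat_ge1 j hj) w).
  unfold Cminus. rewrite <- Zseries_opp_val by exact A2.
  rewrite <- Zseries_plus.
  - apply Zseries_ext. intros i. ring.
  - exact A1.
  - eapply asum_ext; [|exact (asum_scal (- RtoC 1)%C _ A2)]. intros i. cbn beta. ring. }
rewrite E3.
set (S1 := Zseries _). set (S2 := Zseries _).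
assert (EK : kappa = (k' / Q (1 / 8))%C).
{ unfold kappa, k'. rewrite epow_add, epow_opp. unfold Cdiv. ring. }
rewrite EK. field. repeat split; try apply epow_neq0. exact H.
Qed.

Lemma char_defined_theta (w : C) : character_defined w tau <-> theta tau w <> 0.
Proof.
unfold character_defined. rewrite char_den_eq by exact Htau. split; intros H E; apply H.
- rewrite E. ring.
- revert E. intros E.
  rewrite <- (Cmult_1_l (theta tau w)).
  assert (N : (Q (1 / 8) * epow w (- (1 / 2)))%C <> 0) by (apply Cmult_neq_0; apply epow_neq0).
  rewrite <- (Cinv_l _ N), <- Cmult_assoc, E. ring.
Qed.

(* The Laurent coefficients of the character in the annulus |q| < |z| < 1/|q|. *)
Definition char_coeff (K : Z) : C :=
  (kappa * (quot_coeff tau zp zj zr K + / eta3 tau * annsum_coeff tau zp zj zr K))%C.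

Lemma laurent_char (w : C) : Rabs (Im w) < Im tau -> theta tau w <> RtoC 0 ->
  asum (lterm char_coeff w) /\ laurent char_coeff w = character p (2 * p + j) (2 * r) w tau.
Proof.
intros Hw H.
assert (A1 := entire_quot tau Htau zp zj zr (Zof_nat_ge1 p hp) (Zof_nat_ge1 j hj) w).
destruct (asum_annsum tau Htau zp zj zr (Zof_nat_ge1 p hp) (Zof_nat_ge1 j hj) w Hw H) as [A2 E2].
assert (E : forall K, (kappa * (lterm (quot_coeff tau zp zj zr) w K + / eta3 tau * lterm
    (annsum_coeff tau zp zj zr) w K))%C = lterm char_coeff w K).
{ intros K. unfold lterm, char_coeff. ring. }
assert (A3 := asum_plus _ _ A1 (asum_scal (/ eta3 tau) _ A2)).
split.
- apply (asum_ext _ _ E). now apply asum_scal.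
- unfold laurent at 1. rewrite <- (Zseries_ext _ _ E).
  rewrite Zseries_scal by exact A3. rewrite Zseries_plus by (try apply asum_scal; assumption).
  rewrite Zseries_scal by exact A2.
  rewrite character_numer, (numer_decomposition tau Htau zp zj zr (Zof_nat_ge1 p hp) (Zof_nat_ge1
      j hj) w H) by exact H.
  rewrite <- E2. reflexivity.
Qed.

Lemma is_Zseries_lin (a b : Z -> C) (c l m : C) : is_Zseries a l -> is_Zseries b m ->
  is_Zseries (fun k => c * (a k - b k))%C (c * (l - m))%C.
Proof.
intros (l1 & l2 & H1 & H2 & ->) (m1 & m2 & H3 & H4 & ->).
exists (c * (l1 - m1))%C, (c * (l2 - m2))%C.
apply is_series_Cconv in H1, H2, H3, H4.
assert (L : forall u v x y, Cconv (fun n => csum n u) x -> Cconv (fun n => csum n v) y ->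
   Cconv (fun n => csum n (fun k => c * (u k - v k))%C) (c * (x - y))%C).
{ intros u v x y Hu Hv.
  replace (c * (x - y))%C with (c * x + (- c) * y)%C by ring.
  eapply Cconv_ext; [|exact (Cconv_plus _ _ _ _ (Cconv_scal c _ _ Hu) (Cconv_scal (- c) _ _ Hv))].
  intros n. cbn beta. rewrite <- !csum_scal, <- csum_plus. apply csum_ext. intros k _. ring. }
repeat split.
- apply is_series_Cconv. now apply (L (fun n => a (Z.of_nat n)) (fun n => b (Z.of_nat n))).
- apply is_series_Cconv.
  now apply (L (fun n => a (- Z.of_nat (S n))%Z) (fun n => b (- Z.of_nat (S n))%Z)).
- ring.
Qed.

Lemma level_eq : level p (2 * p + j) = INR j / INR p.
Proof.
unfold level. rewrite plus_INR, mult_INR. pose proof (INR_gt0 p hp). simpl (INR 2). field. lra.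
Qed.

Lemma annulus_Im (w : C) :
  Cmod (epow tau 1) < Cmod (epow w 1) < / Cmod (epow tau 1) <-> Rabs (Im w) < Im tau.
Proof.
rewrite !Cmod_epow, <- exp_Ropp, !Rmult_1_r, Ropp_involutive. pose proof PI_RGT_0.
split.
- intros [H1 H2]. apply exp_lt_inv in H1, H2. apply Rabs_def1; nra.
- intros Hw. apply Rabs_def2 in Hw. split; apply exp_increasing; nra.
Qed.

(** The integer division is exact where it matters, since the expansion for the even spin 2r
    involves only even m. *)
Definition char_string (m : Z) : C :=
  (char_coeff (- (m / 2)) / Q (IZR m ^ 2 / (4 * level p (2 * p + j))))%C.

Let Eterm (c : Z -> C) (w : C) (n : Z) : C :=
  let m := (2 * n + Z.of_nat (2 * r))%Z in
  (c m * epow tau (IZR m ^ 2 / (4 * level p (2 * p + j))) * epow w (- (IZR m / 2)))%C.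

Lemma char_string_term (w : C) (n : Z) :
  Eterm char_string w n = lterm char_coeff w (- (n + zr)).
Proof.
unfold Eterm, char_string, lterm.
replace (2 * n + Z.of_nat (2 * r))%Z with ((n + zr) * 2)%Z by (unfold zr; lia).
rewrite Z.div_mul by lia.
replace (- (IZR ((n + zr) * 2) / 2)) with (IZR (- (n + zr))) by (rewrite opp_IZR, mult_IZR; field).
field. apply epow_neq0.
Qed.

Lemma char_string_expansion : string_expansion p (2 * p + j) (2 * r) tau char_string.
Proof.
intros w Hw Hd. apply annulus_Im in Hw. apply char_defined_theta in Hd.
destruct (laurent_char w Hw Hd) as [A E].
assert (A1 := asum_shift _ zr (asum_opp _ A)).
assert (A2 : asum (Eterm char_string w)).
{ apply (asum_ext (fun n => lterm char_coeff w (- (n + zr)))); [|exact A1].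
  intros n. symmetry. apply char_string_term. }
assert (I := is_Zseries_asum _ A2).
replace (character p (2 * p + j) (2 * r) w tau) with (Zseries (Eterm char_string w)); [exact I|].
rewrite <- E, (Zseries_ext _ _ (char_string_term w)).
rewrite (Zseries_shift _ zr (asum_opp _ A)). now apply Zseries_opp.
Qed.

Lemma theta_neq0_strip (w : C) : - Im tau < Im w < 0 -> theta tau w <> 0.
Proof.
intros Hw. apply theta_neq0; [exact Htau|now apply eta3_neq0|].
intros n E. apply (f_equal Cmod) in E. rewrite !Cmod_epow in E. apply exp_inv in E.
pose proof PI_RGT_0.
assert (E' : Im w = Im tau * IZR n) by nra.
destruct (Z_le_gt_dec 0 n) as [L|L].
- apply IZR_le in L. nra.
- assert (L' : IZR n <= -1) by (apply IZR_le; lia). nra.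
Qed.

(** The chosen family is known only to satisfy the expansion. [char_string_expansion] makes the
    choice legitimate, and Laurent uniqueness pins down its values at even indices. *)
Lemma string_function_eq (s : Z) :
  (string_function p (2 * p + j) (2 * s) (2 * r) tau *
   Q (IZR (2 * s) ^ 2 / (4 * level p (2 * p + j))))%C = char_coeff (- s).
Proof.
unfold string_function.
set (c := epsilon _ _).
assert (Hc : string_expansion p (2 * p + j) (2 * r) tau c).
{ unfold c. apply epsilon_spec. exists char_string. exact char_string_expansion. }
set (a := fun n => (c (2 * n + Z.of_nat (2 * r))%Z * Q (IZR (2 * n + Z.of_nat (2 * r)) ^ 2 / (4 *
    level p (2 * p + j)))
   - char_coeff (- (n + zr)))%C).
assert (Z0 : forall n, a n = 0).
{ apply (laurent_unique tau); [exact Htau|]. intros w Hw.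
  (* The expansion is in powers z^(-m/2), so z -> 1/z makes it an ordinary Laurent series. It also
     moves |q| < |z| < 1 to 1 < |z| < 1/|q|, where theta has no zero and the character is
     defined. *)
  set (w' := (- w)%C).
  assert (Iw : Im w' = - Im w) by (unfold w'; destruct w; reflexivity).
  assert (Hw' : Rabs (Im w') < Im tau) by (rewrite Iw, Rabs_Ropp, Rabs_right; lra).
  assert (Hd : character_defined w' tau).
  { apply char_defined_theta, theta_neq0_strip. rewrite Iw. lra. }
  assert (H1 := Hc w' (proj2 (annulus_Im w') Hw') Hd).
  assert (H2 := char_string_expansion w' (proj2 (annulus_Im w') Hw') Hd).
  assert (L := is_Zseries_lin _ _ (epow w (- IZR zr)) _ _ H1 H2).
  replace (epow w (- IZR zr) * (character p (2 * p + j) (2 * r) w' tau - character p (2 * p + j)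
      (2 * r) w' tau))%C
    with (RtoC 0) in L by ring.
  assert (X : forall n, (epow w (- IZR zr) * (Eterm c w' n - Eterm char_string w' n))%C = lterm a
      w n).
  { intros n. rewrite char_string_term. unfold Eterm, lterm, a.
    replace (IZR (2 * n + Z.of_nat (2 * r)) / 2) with (IZR (n + zr)).
    - rewrite opp_IZR.
      replace (epow w (IZR n)) with (epow w (- IZR zr) * epow w' (- IZR (n + zr)))%C; [ring|].
      replace w' with (RtoC (-1) * w)%C.
      + rewrite epow_scale, <- epow_add. f_equal. rewrite plus_IZR. ring.
      + unfold w'. replace (RtoC (-1)) with (- RtoC 1)%C by now rewrite <- RtoC_opp. ring.
    - replace (2 * n + Z.of_nat (2 * r))%Z with ((n + zr) * 2)%Z by (unfold zr; lia).
      rewrite mult_IZR. field. }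
  destruct L as (l1 & l2 & L1 & L2 & L3). exists l1, l2. repeat split; [| |exact L3].
  - eapply is_series_ext; [|exact L1]. intros k. apply (X (Z.of_nat k)).
  - eapply is_series_ext; [|exact L2]. intros k. apply (X (- Z.of_nat (S k))%Z). }
specialize (Z0 (s - zr)%Z). unfold a in Z0.
replace (2 * (s - zr) + Z.of_nat (2 * r))%Z with (2 * s)%Z in Z0 by (unfold zr; lia).
replace (- (s - zr + zr))%Z with (- s)%Z in Z0 by lia.
now apply Ceq_minus in Z0.
Qed.

(** For 0 <= s < j the polar part contributes nothing to z^(-s). The level is j/p, so q^(m^2/(4N))
    at m = 2s is q^(p s^2/j). *)
Lemma string_function_quot (s : nat) : (s < j)%nat ->
  (Q (p / j * s ^ 2) * string_function p (2 * p + j) (2 * Z.of_nat s) (2 * r) tau)%C =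
  (kappa * quot_coeff tau zp zj zr (- Z.of_nat s))%C.
Proof.
intros Hs. assert (E := string_function_eq (Z.of_nat s)).
unfold char_coeff in E.
rewrite annsum_window in E by (unfold zp, zj; lia).
rewrite Cmult_0_r, Cplus_0_r in E. rewrite <- E, Cmult_comm. f_equal. f_equal.
rewrite level_eq, mult_IZR, <- INR_IZR_INZ. pose proof (INR_gt0 p hp). pose proof (INR_gt0 j hj).
    field. lra.
Qed.

End Statement.

(** * Appell functions *)

Lemma asum_mul_bounded (a x : Z -> C) (B : R) :
  (forall n, Cmod (x n) <= B) -> asum a -> asum (fun n => a n * x n)%C.
Proof.
intros H Ha. apply (asum_le _ (fun n => RtoC B * a n)%C); [|now apply asum_scal].
intros n. rewrite !Cmod_mult, Cmod_R, Rmult_comm.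
apply Rmult_le_compat_r; [apply Cmod_ge_0|].
eapply Rle_trans; [apply H|apply Rle_abs].
Qed.

Lemma bounded_of_far (x : Z -> C) (N : nat) (B : R) :
  (forall n, (Z.of_nat N <= Z.abs n)%Z -> Cmod (x n) <= B) ->
  exists B', forall n, Cmod (x n) <= B'.
Proof.
intros H. exists (Rabs B + rsum (S N) (zmod x)). intros n.
assert (P : forall k, 0 <= rsum k (zmod x)).
{ induction k as [|k IH]; cbn [rsum]; [lra|]. pose proof (zmod_ge0 x k). lra. }
assert (P2 : forall k i, (i < k)%nat -> zmod x i <= rsum k (zmod x)).
{ intros k. induction k as [|k IH]; intros i Hi; [lia|]. cbn [rsum].
  destruct (Nat.eq_dec i k) as [->|Ne].
  - specialize (P k). lra.
  - specialize (IH i ltac:(lia)). pose proof (zmod_ge0 x k). lra. }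
destruct (Z_le_gt_dec (Z.of_nat N) (Z.abs n)) as [L|L].
- specialize (H n L). pose proof (Rle_abs B). specialize (P (S N)). lra.
- pose proof (Rabs_pos B).
  assert (Cmod (x n) <= rsum (S N) (zmod x)); [|lra].
  destruct (Z_lt_le_dec n 0) as [L2|L2].
  + eapply Rle_trans; [|apply (P2 (S N) (Z.to_nat (- n - 1))); lia].
    unfold zmod. replace (- Z.of_nat (S (Z.to_nat (- n - 1))))%Z with n by lia.
    pose proof (Cmod_ge_0 (x (Z.of_nat (Z.to_nat (- n - 1))))). lra.
  + eapply Rle_trans; [|apply (P2 (S N) (Z.to_nat n)); lia].
    unfold zmod. rewrite Z2Nat.id by lia.
    pose proof (Cmod_ge_0 (x (- Z.of_nat (S (Z.to_nat n)))%Z)). simpl in *. lra.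
Qed.

(** The power in the denominator tends to 0 or to infinity as |n| grows. Beyond [N] its modulus is
    at most 1/e or at least e, which keeps the denominator above 1/2; finitely many n remain. *)
Lemma inv_one_sub_bounded (t v : C) : 0 < Im t ->
  (forall n : Z, (1 - epow (v + RtoC (IZR n) * t) 1)%C <> 0) ->
  exists B, forall n : Z, Cmod (/ (1 - epow (v + RtoC (IZR n) * t) 1)) <= B.
Proof.
intros Ht H.
set (c := 2 * PI * Im t). assert (Hc : 0 < c) by (unfold c; pose proof PI_RGT_0; apply
    Rmult_lt_0_compat; lra).
set (al := 2 * PI * Im v).
destruct (INR_unbounded ((Rabs al + 1) / c)) as [N HN].
assert (HN' : Rabs al + 1 < c * INR N) by (apply Rlt_div_l in HN; lra).
apply (bounded_of_far _ N 2). intros n Hn.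
rewrite Cmod_inv by apply H.
assert (M : Cmod (epow (v + RtoC (IZR n) * t) 1) = exp (- al - c * IZR n)).
{ rewrite Cmod_epow, Im_plus_scal. f_equal. unfold al, c. ring. }
assert (Habs : - Rabs al <= al <= Rabs al).
{ split; [|apply Rle_abs]. pose proof (Rle_abs (- al)) as X. rewrite Rabs_Ropp in X. lra. }
assert (E1 : 2 <= exp 1) by (pose proof (exp_ineq1_le 1); lra).
assert (L : / 2 <= Cmod (1 - epow (v + RtoC (IZR n) * t) 1)).
{ set (y := epow (v + RtoC (IZR n) * t) 1) in *.
  destruct (Z_lt_le_dec n 0) as [L2|L2].
  - assert (IZR n <= - INR N) by (rewrite INR_IZR_INZ, <- opp_IZR; apply IZR_le; lia).
    assert (exp 1 <= Cmod y) by (rewrite M; apply exp_le; nra).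
    assert (T := Cmod_triangle (1 - y) (- RtoC 1)).
    replace (1 - y + - RtoC 1)%C with (- y)%C in T by ring.
    rewrite !Cmod_opp, Cmod_1 in T. lra.
  - assert (INR N <= IZR n) by (rewrite INR_IZR_INZ; apply IZR_le; lia).
    assert (Y : Cmod y <= exp (- (1))) by (rewrite M; apply exp_le; nra).
    rewrite exp_Ropp in Y.
    assert (/ exp 1 <= / 2) by (apply Rinv_le_contravar; lra).
    assert (T := Cmod_triangle (1 - y) y).
    replace (1 - y + y)%C with (RtoC 1) in T by ring. rewrite Cmod_1 in T. lra. }
rewrite <- (Rinv_inv 2). apply Rinv_le_contravar; lra.
Qed.

(** The right side factors both as y^(1-j) (1 - y^j) and as -y (1 - y^(-j)). These two
    factorisations are the origin of the exponents u = 1 - j and u = 1. *)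
Lemma geom_fin (v : C) (j : nat) :
  ((1 - epow v 1) * csum j (fun s => epow v (- INR s)))%C =
  (epow v (1 - INR j) - epow v 1)%C.
Proof.
induction j as [|j IH].
- simpl. rewrite Rminus_0_r. ring.
- cbn [csum]. rewrite Cmult_plus_distr_l, IH, S_INR.
  replace (1 - (INR j + 1)) with (- INR j) by ring.
  replace (epow v (1 - INR j)) with (epow v 1 * epow v (- INR j))%C
    by (rewrite <- epow_add; f_equal; ring).
  ring.
Qed.

Lemma jtheta_theta (t v : C) : jtheta (epow v 1) (epow t 1) = theta t v.
Proof.
apply Zseries_ext. intros n. unfold lterm, theta_coeff.
rewrite Cpowz_m1, !Cpowz_epow, IZR_binom2, !Rmult_1_l. reflexivity.
Qed.

Lemma theta_reflect (t v v' : C) : 0 < Im t ->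
  (forall n : Z, (epow v (IZR n) * epow v' (IZR n))%C = epow t (IZR n)) ->
  theta t v' = theta t v.
Proof.
intros Ht H. unfold theta, laurent.
rewrite <- (Zseries_opp (lterm (theta_coeff t) v)) by now apply entire_theta.
apply Zseries_ext. intros n. unfold lterm, theta_coeff. rewrite sg_opp.
assert (E : epow v' (IZR n) = (epow t (IZR n) * epow v (IZR (- n)))%C).
{ rewrite <- H, opp_IZR, epow_opp. field. apply epow_neq0. }
rewrite E.
transitivity (sg n * (epow t (IZR n * (IZR n - 1) / 2) * epow t (IZR n)) * epow v (IZR (- n)))%C;
    [ring|].
f_equal. f_equal. emono.
Qed.

Section Main.
Variables p j r : nat.
Hypothesis hp : (1 <= p)%nat.
Hypothesis hj : (1 <= j)%nat.
Variables tau w : C.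
Hypothesis Htau : 0 < Im tau.

Let zp := Z.of_nat p.
Let zj := Z.of_nat j.
Let zr := Z.of_nat r.
Notation Q := (epow tau).

(** A logarithm of -q^a z^b, with the minus sign carried by [half]. *)
Definition arg (a b : R) : C := (half + RtoC a * tau + RtoC b * w)%C.

Lemma epow_arg (a b : R) (n : R) : epow (arg a b) n = (epow half n * Q (a * n) * epow w (b * n))%C.
Proof. unfold arg. now rewrite !epow_plus, !epow_scale. Qed.

Lemma opp_q_z (a : R) (n : Z) : (- Q a * Cpowz (epow w 1) n)%C = epow (arg a (IZR n)) 1.
Proof. rewrite epow_arg, Cpowz_epow, opp_epow, Rmult_1_l, !Rmult_1_r. ring. Qed.

Lemma opp_z_q (a : R) (n : Z) : (- Cpowz (epow w 1) n * Q a)%C = epow (arg a (IZR n)) 1.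
Proof. rewrite <- opp_q_z. ring. Qed.

Let t2 : C := (RtoC (2 * j * p) * tau)%C.

Lemma t2_pos : 0 < Im t2.
Proof.
unfold t2. rewrite Im_scal.
pose proof (INR_gt0 p hp). pose proof (INR_gt0 j hj).
repeat apply Rmult_lt_0_compat; lra.
Qed.

Lemma q_t2 (a : R) : epow t2 a = Q (2 * j * p * a).
Proof. apply epow_scale. Qed.

(** By [quot_class] the coefficients along the class of -s modulo j are those of a theta series in
    q^(2pj); the minus sign in its argument cancels the (-1)^n of the theta series. *)
Lemma quot_theta (s : nat) :
  (epow w (- INR s) * quot_coeff tau zp zj zr (- Z.of_nat s) * theta t2 (arg (p * (j - 2 * s))
      j))%C =
  Zseries (fun n => lterm (quot_coeff tau zp zj zr) w (zj * n - Z.of_nat s)).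
Proof.
unfold theta, laurent. rewrite <- Zseries_scal by (apply entire_theta, t2_pos).
apply Zseries_ext. intros n. unfold lterm, theta_coeff.
replace (zj * n - Z.of_nat s)%Z with (- Z.of_nat s + zj * n)%Z by ring.
rewrite (quot_class tau Htau zp zj zr (Zof_nat_ge1 p hp) (Zof_nat_ge1 j hj)).
rewrite epow_arg, q_t2. fold (sg n).
set (X := quot_coeff tau zp zj zr (- Z.of_nat s)).
transitivity ((sg n * sg n) * ((epow w (- INR s) * Q (2 * j * p * (IZR n * (IZR n - 1) / 2)) * Q
    (p * (j - 2 * s) * IZR n) * epow w (j * IZR n)) * X))%C; [ring|].
rewrite sg_sqr, Cmult_1_l.
transitivity ((Q (IZR zp * IZR zj * IZR n ^ 2 + 2 * IZR zp * IZR (- Z.of_nat s) * IZR n) * epow w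
    (IZR (- Z.of_nat s + zj * n))) * X)%C; [|ring].
f_equal. unfold zp, zj. emono.
Qed.

Lemma quot_sum :
  csum j (fun s => epow w (- INR s) * quot_coeff tau zp zj zr (- Z.of_nat s) *
     theta t2 (arg (p * (j - 2 * s)) j))%C = laurent (quot_coeff tau zp zj zr) w.
Proof.
assert (A := asum_opp _ (entire_quot tau Htau zp zj zr (Zof_nat_ge1 p hp) (Zof_nat_ge1 j hj) w)).
unfold laurent.
rewrite <- (Zseries_opp _ (entire_quot tau Htau zp zj zr (Zof_nat_ge1 p hp) (Zof_nat_ge1 j hj) w)).
rewrite (Zseries_classes j _ hj A). apply csum_ext. intros s Hs.
rewrite quot_theta. rewrite <- (Zseries_opp _ (asum_class j s _ Hs A)).
apply Zseries_ext. intros n. f_equal. unfold zj. lia.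
Qed.

(** * Splitting the polar sums into denominators 1 - y^j *)

Section Pole.
Variable n0 : Z.

Let v (n : Z) : C := (w + (IZR (pole zp n0 n)) * tau)%C.
Let B (s : nat) (n : Z) : C :=
  (Q (j * p * IZR n ^ 2) * epow w (j * IZR n) * epow (v n) (- INR s))%C.
Hypothesis HN : forall n, epow (v n) (INR j) <> RtoC 1.

Lemma vj_neq (n : Z) : (1 - epow (v n) (INR j))%C <> 0.
Proof. intros E. apply Ceq_minus in E. now apply (HN n). Qed.

Lemma v1_neq (n : Z) : (1 - epow (v n) 1)%C <> 0.
Proof.
intros E. apply Ceq_minus in E. apply (HN n).
replace (INR j) with (1 * INR j) by ring. rewrite <- Cpow_epow, <- E. apply Cpow_1_l.
Qed.

Lemma vj_neq' (n : Z) : (1 - epow (v n) (- INR j))%C <> 0.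
Proof.
intros E. apply Ceq_minus in E. apply (HN n).
replace (INR j) with (- - INR j) by ring. rewrite epow_opp, <- E. field.
Qed.

Lemma inv_vj_bounded : exists K, forall n, Cmod (/ (1 - epow (v n) (INR j))) <= K.
Proof.
assert (E : forall n, epow (v n) (INR j) =
   epow (RtoC (INR j) * (w + (IZR n0) * tau) + RtoC (IZR n) * t2) 1).
{ intros n. unfold v, t2. rewrite !epow_plus, !epow_scale, !epow_plus, !epow_scale.
  unfold pole, zp. emono. }
destruct (inv_one_sub_bounded t2 (RtoC (INR j) * (w + (IZR n0) * tau)) t2_pos) as [K HK].
- intros n. rewrite <- E. apply vj_neq.
- exists K. intros n. rewrite E. apply HK.
Qed.

Lemma asum_B (s : nat) : asum (B s).
Proof.
apply (asum_ext (fun n => epow w (- INR s) *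
  lterm (fun n => Q (j * p * IZR n ^ 2 - 2 * p * s * IZR n - s * IZR n0)) (RtoC (INR j) * w) n)%C).
- intros n. unfold lterm, B, v. rewrite epow_scale, !epow_plus, epow_scale.
  unfold pole, zp. emono.
- apply asum_scal. apply (entire_qgauss tau Htau _ 1 (j * p) (- 2 * p * s) (- s * IZR n0)).
  + apply Rmult_lt_0_compat; [exact (INR_gt0 j hj)|exact (INR_gt0 p hp)].
  + intros n. rewrite Rmult_1_l. right. f_equal. f_equal. ring.
Qed.

Lemma asum_B1 (s : nat) : asum (fun n => B s n / (1 - epow (v n) (INR j)))%C.
Proof.
destruct inv_vj_bounded as [K HK]. now apply (asum_mul_bounded _ _ K); [|apply asum_B].
Qed.

(** The identity 1/(1 - y^(-j)) = 1 - 1/(1 - y^j) reduces this to [asum_B] and [asum_B1]. *)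
Lemma asum_B2 (s : nat) : asum (fun n => B s n / (1 - epow (v n) (- INR j)))%C.
Proof.
apply (asum_ext (fun n => B s n + - RtoC 1 * (B s n / (1 - epow (v n) (INR j))))%C).
- intros n. assert (N1 := vj_neq n). assert (N2 := vj_neq' n).
  rewrite epow_opp in *. field. repeat split; try assumption; try apply epow_neq0.
  intros E. apply N1. rewrite <- (Copp_0), <- E. ring.
- apply asum_plus; [apply asum_B|apply asum_scal, asum_B1].
Qed.

Lemma sum_B1 : csum j (fun s => Zseries (fun n => B s n / (1 - epow (v n) (INR j)))%C) =
  polar tau zp zj n0 (1 - zj) w.
Proof.
rewrite <- (Zseries_csum j (fun s n => B s n / (1 - epow (v n) (INR j)))%C) by (intros; apply
    asum_B1).
apply Zseries_ext. intros n. unfold polar_term. fold (v n).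
assert (N1 := vj_neq n). assert (N2 := v1_neq n).
assert (G := geom_fin (v n) j).
assert (E : (epow (v n) (1 - INR j) - epow (v n) 1)%C =
  (epow (v n) (IZR (1 - zj)) * (1 - epow (v n) (INR j)))%C).
{ unfold zj. rewrite minus_IZR, <- INR_IZR_INZ.
  replace (epow (v n) 1) with (epow (v n) (1 - INR j) * epow (v n) (INR j))%C
    by (rewrite <- epow_add; f_equal; ring). ring. }
rewrite E in G.
set (D := (1 - epow (v n) (INR j))%C) in *. set (D1 := (1 - epow (v n) 1)%C) in *.
transitivity (Q (j * p * IZR n ^ 2) * epow w (j * IZR n) / D * csum j (fun s => epow (v n) (- INR
    s)))%C.
- rewrite <- csum_scal. apply csum_ext. intros s _. unfold B, Cdiv. ring.
- transitivity (Q (j * p * IZR n ^ 2) * epow w (j * IZR n) / D / D1 * (D1 * csum j (fun s => epow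
    (v n) (- INR s))))%C.
  + field. now split.
  + rewrite G. unfold zp, zj. rewrite <- !INR_IZR_INZ. field. now split.
Qed.

Lemma sum_B2 : csum j (fun s => Zseries (fun n => B s n / (1 - epow (v n) (- INR j)))%C) =
  (- polar tau zp zj n0 1 w)%C.
Proof.
rewrite <- (Zseries_csum j (fun s n => B s n / (1 - epow (v n) (- INR j)))%C) by (intros; apply
    asum_B2).
assert (T : forall n, csum j (fun s => B s n / (1 - epow (v n) (- INR j)))%C =
   (- polar_term tau zp zj n0 1 w n)%C).
{ intros n. unfold polar_term. fold (v n).
  assert (N1 := vj_neq' n). assert (N2 := v1_neq n).
  assert (G := geom_fin (v n) j).
  assert (E : (epow (v n) (1 - INR j) - epow (v n) 1)%C =
    (- epow (v n) 1 * (1 - epow (v n) (- INR j)))%C).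
  { unfold Rminus. rewrite epow_add. ring. }
  rewrite E in G.
  set (D := (1 - epow (v n) (- INR j))%C) in *. set (D1 := (1 - epow (v n) 1)%C) in *.
  transitivity (Q (j * p * IZR n ^ 2) * epow w (j * IZR n) / D * csum j (fun s => epow (v n) (-
      INR s)))%C.
  - rewrite <- csum_scal. apply csum_ext. intros s _. unfold B, Cdiv. ring.
  - transitivity (Q (j * p * IZR n ^ 2) * epow w (j * IZR n) / D / D1 * (D1 * csum j (fun s =>
      epow (v n) (- INR s))))%C.
    + field. now split.
    + rewrite G. unfold zp, zj. rewrite <- !INR_IZR_INZ. field. now split. }
rewrite (Zseries_ext _ _ T). apply Zseries_opp_val.
apply (asum_ext (fun n => - RtoC 1 * csum j (fun s => B s n / (1 - epow (v n) (- INR j))))%C).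
- intros n. rewrite T. ring.
- apply asum_scal, asum_csum. intros s _. apply asum_B2.
Qed.

End Pole.

(** The residue evaluates the numerator at z = q^(p-m), where the monomials in z become powers of q
    and each half of the numerator is a theta series in q^(2pP), P = 2p + j. The signs combine to
    (-1)^(m-p). *)
Lemma resid_E (m : nat) :
  (sg (Z.of_nat p) * sg (Z.of_nat m) * Q (IZR (binom2 (Z.of_nat p)) - p * r)
    * Q (IZR (binom2 (Z.of_nat m + 1)) + m * (r - p))
    * (jtheta (- Q (m * (2 * p + j) + p * (2 * r + 1))) (Q (2 * p * (2 * p + j)))
       - Q (m * (2 * p + j) - m * (2 * r + 1))
         * jtheta (- Q (- m * (2 * p + j) + p * (2 * r + 1))) (Q (2 * p * (2 * p + j)))))%C =
  resid tau zp zj zr (Z.of_nat m - zp).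
Proof.
set (n0 := (Z.of_nat m - zp)%Z).
set (tP := (RtoC (2 * p * (2 * p + j)) * tau)%C).
assert (HtP : 0 < Im tP).
{ unfold tP. pose proof (INR_gt0 p hp). pose proof (pos_INR j).
  rewrite Im_scal. repeat apply Rmult_lt_0_compat; lra. }
assert (EQ : Q (2 * p * (2 * p + j)) = epow tP 1) by (unfold tP; rewrite epow_scale; f_equal; ring).
assert (J : forall a, jtheta (- Q a) (Q (2 * p * (2 * p + j))) =
   Zseries (fun n => Q (p * (2 * p + j) * (IZR n * (IZR n - 1)) + a * IZR n))
   /\ asum (fun n => Q (p * (2 * p + j) * (IZR n * (IZR n - 1)) + a * IZR n))).
{ intros a.
  assert (EX : (- Q a)%C = epow (half + RtoC a * tau) 1).
  { rewrite opp_epow, epow_plus, epow_scale, Rmult_1_r. reflexivity. }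
  assert (T : forall n, lterm (theta_coeff tP) (half + RtoC a * tau) n =
     Q (p * (2 * p + j) * (IZR n * (IZR n - 1)) + a * IZR n)).
  { intros n. unfold lterm, theta_coeff, tP. rewrite epow_plus, !epow_scale. fold (sg n).
    transitivity ((sg n * sg n) * (Q (2 * p * (2 * p + j) * (IZR n * (IZR n - 1) / 2)) * Q (a *
        IZR n)))%C; [ring|].
    rewrite sg_sqr, Cmult_1_l. emono. }
  split.
  - rewrite EX, EQ, jtheta_theta. now apply Zseries_ext.
  - apply (asum_ext _ _ T). now apply entire_theta. }
destruct (J (m * (2 * p + j) + p * (2 * r + 1))) as [E1 A1].
destruct (J (- m * (2 * p + j) + p * (2 * r + 1))) as [E2 A2].
rewrite E1, E2. clear E1 E2 J.
(* Index i of the numerator corresponds to index i + 1 of the second theta series, as [H2]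
   records. *)
rewrite <- (Zseries_shift _ 1 A2).
assert (A2' := asum_shift _ 1 A2).
rewrite <- Zseries_scal by exact A2'.
unfold Cminus. rewrite <- Zseries_opp_val by (now apply asum_scal).
rewrite <- Zseries_plus; [|exact A1|].
2:{ eapply asum_ext; [|exact (asum_scal (- Q (m * (2 * p + j) - m * (2 * r + 1)))%C _ A2')].
    intros n. cbn beta. ring. }
assert (ES : (sg (Z.of_nat p) * sg (Z.of_nat m))%C = sg n0).
{ unfold n0, zp. replace (Z.of_nat m - Z.of_nat p)%Z with (Z.of_nat m + - Z.of_nat p)%Z by ring.
  rewrite sg_plus, sg_opp. ring. }
rewrite ES. unfold resid, numer.
rewrite <- !Cmult_assoc. f_equal. rewrite Cmult_assoc.
assert (AN := asum_numer tau Htau zp zj zr (Zof_nat_ge1 p hp) (Zof_nat_ge1 j hj) ((IZR (- n0)) *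
    tau)%C).
rewrite <- Zseries_scal, <- Zseries_scal.
- apply Zseries_ext. intros i. unfold num_weight, num_exp1, num_exp2. rewrite !epow_scale.
  assert (H1 : (Q (IZR (binom2 (Z.of_nat p)) - p * r) * Q (IZR (binom2 (Z.of_nat m + 1)) + m * (r
      - p))
     * Q (p * (2 * p + j) * (IZR i * (IZR i - 1)) + (m * (2 * p + j) + p * (2 * r + 1)) * IZR
         i))%C =
   (Q (IZR n0 * (IZR n0 + 1) / 2) * (Q (IZR zp * IZR (2 * zp + zj) * IZR i ^ 2 + IZR zp * (2 * IZR
       zr + 1) * IZR i) *
     Q (IZR (- n0) * IZR (- (2 * zp + zj) * i - zr))))%C).
  { rewrite !IZR_binom2. unfold n0, zp, zj, zr. emono. }
  assert (H2 : (Q (IZR (binom2 (Z.of_nat p)) - p * r) * Q (IZR (binom2 (Z.of_nat m + 1)) + m * (r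
      - p))
     * (Q (m * (2 * p + j) - m * (2 * r + 1)) * Q (p * (2 * p + j) * (IZR (i + 1) * (IZR (i + 1) -
         1)) + (- m * (2 * p + j) + p * (2 * r + 1)) * IZR (i + 1))))%C =
   (Q (IZR n0 * (IZR n0 + 1) / 2) * (Q (IZR zp * IZR (2 * zp + zj) * IZR i ^ 2 + IZR zp * (2 * IZR
       zr + 1) * IZR i) *
     Q (IZR (- n0) * IZR ((2 * zp + zj) * i + zr + 1))))%C).
  { rewrite !IZR_binom2. unfold n0, zp, zj, zr. emono. }
  match type of H1 with _ = ?x => match type of H2 with _ = ?y =>
    transitivity (x - y)%C end end; [rewrite <- H1, <- H2; ring|ring].
- exact AN.
- apply asum_plus; [exact A1|].
  eapply asum_ext; [|exact (asum_scal (- Q (m * (2 * p + j) - m * (2 * r + 1)))%C _ A2')].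
  intros n. cbn beta. ring.
Qed.

(** * Appell functions as partial fractions of the polar sums *)

Section Appell.
Variable m : nat.
Hypothesis Hdef : forall s : nat, (s < j)%nat ->
  appell_defined (- Q (j * m - 2 * p * s))%C
    (- Q (p * (j + 2 * s)) * Cpowz (epow w 1) (- Z.of_nat j))%C (Q (2 * j * p)) /\
  appell_defined (- Q (j * m + 2 * p * s))%C
    (- Q (p * (j - 2 * s)) * Cpowz (epow w 1) (Z.of_nat j))%C (Q (2 * j * p)).

Let n0 : Z := (Z.of_nat m - zp)%Z.

Lemma q_2jp : Q (2 * j * p) = epow t2 1.
Proof. rewrite q_t2. f_equal. ring. Qed.

Lemma theta_arg_neq0 (s : nat) : (s < j)%nat -> theta t2 (arg (p * (j - 2 * s)) j) <> 0.
Proof.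
intros Hs. apply theta_neq0; [apply t2_pos|apply eta3_neq0, t2_pos|].
intros n E. destruct (Hdef s Hs) as [_ [H _]]. apply (H n).
rewrite q_2jp, opp_q_z, Cpowz_epow, Rmult_1_l, <- INR_IZR_INZ. exact E.
Qed.

(** The two arguments multiply to the modulus q^(2jp), and j(x; q) is invariant under x -> q/x. Both
    Appell functions therefore have the same theta denominator, and it cancels the theta factor in
    front. *)
Lemma theta_arg_reflect (s : nat) :
  theta t2 (arg (p * (j + 2 * s)) (- j)) = theta t2 (arg (p * (j - 2 * s)) j).
Proof.
apply theta_reflect; [apply t2_pos|]. intros n. rewrite !epow_arg, q_t2.
transitivity ((sg n * sg n) * (Q (p * (j - 2 * s) * IZR n) * epow w (j * IZR n) * (Q (p * (j + 2 *
    s) * IZR n) * epow w (- j * IZR n))))%C;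
  [unfold sg; ring|].
rewrite sg_sqr. rewrite Cmult_1_l. emono.
Qed.

(** The product of the two Appell arguments is q^(j(m+p)) z^j for every s, so genericity at s = 0
    suffices. A pole at n would make this product q^(2jp(1-n)), whence the witness 1 - n. *)
Lemma pole2_neq (n : Z) : epow (w + (IZR (pole zp n0 n)) * tau) (INR j) <> RtoC 1.
Proof.
intros E. destruct (Hdef 0%nat ltac:(lia)) as [_ [_ H]]. apply (H (1 - n)%Z).
rewrite opp_q_z, Cpowz_epow, epow_arg, opp_epow.
transitivity ((epow half 1 * epow half 1) * (Q (j * m + 2 * p * INR 0) * Q (p * (j - 2 * INR 0) *
    1) * epow w (IZR (Z.of_nat j) * 1)))%C; [ring|].
rewrite <- epow_add. replace (1 + 1) with 2 by ring. rewrite epow_half2, Cmult_1_l.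
rewrite <- (Cmult_1_r (Q (2 * j * p * _))), <- E. rewrite epow_plus, epow_scale.
unfold pole, n0, zp. simpl (INR 0). emono.
Qed.

Lemma pole1_neq (n : Z) : epow (w + RtoC (IZR (pole zp (- n0) n)) * tau) (INR j) <> RtoC 1.
Proof.
intros E. destruct (Hdef 0%nat ltac:(lia)) as [[_ H] _]. apply (H (n + 1)%Z).
rewrite opp_q_z, Cpowz_epow, epow_arg, opp_epow.
transitivity ((epow half 1 * epow half 1) * (Q (j * m - 2 * p * INR 0) * Q (p * (j + 2 * INR 0) *
    1) * epow w (IZR (- Z.of_nat j) * 1)))%C; [ring|].
rewrite <- epow_add. replace (1 + 1) with 2 by ring. rewrite epow_half2, Cmult_1_l.
transitivity (Q (2 * j * p * IZR (n + 1)) * / epow (w + RtoC (IZR (pole zp (- n0) n)) * tau) (INR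
    j))%C.
- rewrite epow_plus, epow_scale. unfold pole, n0, zp. simpl (INR 0). emono.
- rewrite E. field.
Qed.

Lemma theta_appell (a c b' : R) (b : Z) : b' = IZR b -> theta t2 (arg a b') <> RtoC 0 ->
  (theta t2 (arg a b') * appell (- Q c) (- Q a * Cpowz (epow w 1) b) (Q (2 * j * p)))%C =
  Zseries (fun n => Q (2 * j * p * (IZR n * (IZR n - 1) / 2) + a * IZR n) * epow w (b' * IZR n)
     / (1 - Q (c + a + 2 * j * p * (IZR n - 1)) * epow w b'))%C.
Proof.
intros -> NT. unfold appell. rewrite q_2jp, opp_q_z, jtheta_theta.
match goal with |- (_ * (?x / _))%C = _ => transitivity x; [field; exact NT|] end.
apply Zseries_ext. intros n.
rewrite Cpowz_m1, !Cpowz_epow, !q_t2, !epow_arg, IZR_binom2, minus_IZR, opp_epow, !Rmult_1_l.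
fold (sg n). unfold Cdiv. f_equal.
- transitivity ((sg n * sg n) * (Q (2 * j * p * (IZR n * (IZR n - 1) / 2)) * Q (a * IZR n)
    * epow w (IZR b * IZR n)))%C; [ring|].
  rewrite sg_sqr, Cmult_1_l. emono.
- f_equal. f_equal.
  transitivity ((epow half 1 * epow half 1) *
    (Q (2 * j * p * (IZR n - 1)) * Q c * Q (a * 1) * epow w (IZR b * 1)))%C; [ring|].
  rewrite <- epow_add. replace (1 + 1) with 2 by ring. rewrite epow_half2, Cmult_1_l. emono.
Qed.

(** In the n-th denominator the power of q is jm + jp + 2jp(n-1) = j(2pn + m - p), that is j times
    the pole index, so the denominator is 1 - y^j. *)
Lemma appell2_eq (s : nat) : (s < j)%nat ->
  (epow w (- INR s) * Q (p * s) * theta t2 (arg (p * (j - 2 * s)) j) *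
   (Q (- m * s) * appell (- Q (j * m + 2 * p * s))
     (- Q (p * (j - 2 * s)) * Cpowz (epow w 1) (Z.of_nat j)) (Q (2 * j * p))))%C =
  Zseries (fun n => Q (j * p * IZR n ^ 2) * epow w (j * IZR n)
     * epow (w + (IZR (pole zp n0 n)) * tau) (- INR s)
     / (1 - epow (w + (IZR (pole zp n0 n)) * tau) (INR j)))%C.
Proof.
intros Hs. assert (E := theta_appell (p * (j - 2 * s)) (j * m + 2 * p * s) j (Z.of_nat j)
  (INR_IZR_INZ j) (theta_arg_neq0 s Hs)).
set (TH := theta t2 _) in *. set (AP := appell _ _ _) in *.
set (K := (epow w (- INR s) * Q (p * s) * Q (- m * s))%C).
assert (NK : K <> 0) by (unfold K; repeat apply Cmult_neq_0; apply epow_neq0).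
assert (A := asum_B1 n0 pole2_neq s).
set (F := fun n => (_ * _ * epow (w + _) (- INR s) / _)%C) in *.
transitivity (K * (TH * AP))%C; [unfold K; ring|]. rewrite E.
rewrite (Zseries_ext _ (fun n => / K * F n)%C).
- rewrite Zseries_scal by exact A. field. exact NK.
- intros n. unfold F, Cdiv. rewrite (Cmult_assoc (/ K)).
  rewrite !epow_plus, !epow_scale. unfold K, pole, n0, zp. f_equal; [|do 2 f_equal]; emono.
Qed.

(** Here z^(-j) occurs, and q^(j(2pn + m - p)) z^(-j) is y^(-j) for the family of poles with residue
    -n0, at index -n. Hence the reversal of the summation. *)
Lemma appell1_eq (s : nat) : (s < j)%nat ->
  (epow w (- INR s) * Q (p * s) * theta t2 (arg (p * (j - 2 * s)) j) *
   (Q (m * s - 2 * p * s) * appell (- Q (j * m - 2 * p * s))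
     (- Q (p * (j + 2 * s)) * Cpowz (epow w 1) (- Z.of_nat j)) (Q (2 * j * p))))%C =
  Zseries (fun n => Q (j * p * IZR n ^ 2) * epow w (j * IZR n)
     * epow (w + RtoC (IZR (pole zp (- n0) n)) * tau) (- INR s)
     / (1 - epow (w + RtoC (IZR (pole zp (- n0) n)) * tau) (- INR j)))%C.
Proof.
intros Hs. assert (NT := theta_arg_neq0 s Hs). rewrite <- theta_arg_reflect in *.
assert (EJ : - INR j = IZR (- Z.of_nat j)) by now rewrite opp_IZR, <- INR_IZR_INZ.
assert (E := theta_appell (p * (j + 2 * s)) (j * m - 2 * p * s) (- j) _ EJ NT).
set (TH := theta t2 _) in *. set (AP := appell _ _ _) in *.
set (K := (epow w (- INR s) * Q (p * s) * Q (m * s - 2 * p * s))%C).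
assert (NK : K <> 0) by (unfold K; repeat apply Cmult_neq_0; apply epow_neq0).
assert (A := asum_B2 (- n0) pole1_neq s).
set (F := fun n => (_ * _ * epow (w + _) (- INR s) / _)%C) in *.
transitivity (K * (TH * AP))%C; [unfold K; ring|]. rewrite E.
rewrite (Zseries_ext _ (fun n => / K * F (- n)%Z)%C).
- rewrite Zseries_scal by exact (asum_opp F A). rewrite (Zseries_opp F A). field. exact NK.
- intros n. unfold F, Cdiv. rewrite (Cmult_assoc (/ K)).
  rewrite !epow_plus, !epow_scale. unfold K, pole, n0, zp. f_equal; [|do 2 f_equal]; emono.
Qed.

(** The minus sign, which comes from [sum_B2], meets the oddness of [resid] in the final assembly
    and reproduces the two summands of [polar_part]. *)
Lemma appell_sum :
  csum j (fun s => epow w (- INR s) * Q (p * s) * theta t2 (arg (p * (j - 2 * s)) j) *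
   (Q (m * s - 2 * p * s) * appell (- Q (j * m - 2 * p * s))
      (- Q (p * (j + 2 * s)) * Cpowz (epow w 1) (- Z.of_nat j)) (Q (2 * j * p)) +
    Q (- m * s) * appell (- Q (j * m + 2 * p * s))
      (- Q (p * (j - 2 * s)) * Cpowz (epow w 1) (Z.of_nat j)) (Q (2 * j * p))))%C =
  (polar tau zp zj n0 (1 - zj) w - polar tau zp zj (- n0) 1 w)%C.
Proof.
rewrite <- (sum_B1 n0 pole2_neq).
transitivity (csum j (fun s => Zseries (fun n => Q (j * p * IZR n ^ 2) * epow w (j * IZR n)
     * epow (w + (IZR (pole zp n0 n)) * tau) (- INR s)
     / (1 - epow (w + (IZR (pole zp n0 n)) * tau) (INR j)))%C) +
  - polar tau zp zj (- n0) 1 w)%C; [|reflexivity].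
rewrite <- (sum_B2 (- n0) pole1_neq), <- csum_plus.
apply csum_ext. intros s Hs. cbv zeta beta.
rewrite <- (appell2_eq s Hs), <- (appell1_eq s Hs). ring.
Qed.

End Appell.

End Main.

(** * The decomposition of the character *)

Lemma sum_n_m_csum (a n : nat) (f : nat -> C) :
  sum_n_m f a (a + n) = csum (S n) (fun i => f (a + i)%nat).
Proof.
induction n as [|n IH].
- rewrite Nat.add_0_r, sum_n_n. cbn [csum]. rewrite Nat.add_0_r. symmetry. apply Cplus_0_l.
- rewrite Nat.add_succ_r, sum_n_Sm by lia. rewrite IH. cbn [csum].
  rewrite Nat.add_succ_r. reflexivity.
Qed.

Lemma sum_n_m_from0 (j : nat) (f : nat -> C) : (1 <= j)%nat ->
  sum_n_m f 0 (j - 1) = csum j f.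
Proof.
intros H. destruct j as [|j]; [lia|].
replace (S j - 1)%nat with (0 + j)%nat by lia. apply (sum_n_m_csum 0 j f).
Qed.

Lemma sum_n_m_from1 (p : nat) (f : nat -> C) : (1 <= p)%nat ->
  sum_n_m f 1 (p - 1) = csum (p - 1) (fun i => f (S i)).
Proof.
intros H. destruct p as [|[|p]]; [lia| |].
- rewrite sum_n_m_zero by (simpl; lia). reflexivity.
- replace (S (S p) - 1)%nat with (1 + p)%nat by lia. apply (sum_n_m_csum 1 p f).
Qed.

Theorem theorem2p3 (p j r : nat) (tau w : C)
  (hp : (1 <= p)%nat) (hj : (1 <= j)%nat) (hpj : Nat.gcd p j = 1%nat)
  (hr : (2 * r <= 2 * p + j - 2)%nat)
  (htau : 0 < Im tau) :
  let q (a : R) : C := epow tau a in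
  let z : C := epow w 1 in
  let P : nat := (2 * p + j)%nat in
  character_defined w tau ->
  (forall s m : nat, (0 <= s <= j - 1)%nat -> (1 <= m <= p - 1)%nat ->
     appell_defined (- q (j * m - 2 * p * s)%R)%C
       (- q (p * (j + 2 * s))%R * Cpowz z (- Z.of_nat j))%C (q (2 * j * p)%R) /\
     appell_defined (- q (j * m + 2 * p * s)%R)%C
       (- q (p * (j - 2 * s))%R * Cpowz z (Z.of_nat j))%C (q (2 * j * p)%R)) ->
  character p P (2 * r) w tau =
  (sum_n_m (fun s : nat =>
       Cpowz z (- Z.of_nat s) * q (p / j * s ^ 2)%R
       * string_function p P (2 * Z.of_nat s) (2 * r) tau
       * jtheta (- Cpowz z (Z.of_nat j) * q (p * (j - 2 * s))%R) (q (2 * p * j)%R))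
     0 (j - 1)
   + RtoC 1 / Cpow (qpoch (q 1)) 3
     * sum_n_m (fun s : nat =>
         Cpow (RtoC (-1)) p
         * q (- (1 / 8) + p * (2 * r + 1) ^ 2 / (4 * (2 * p + j)))%R
         * q (IZR (binom2 (Z.of_nat p)) - p * (r - s))%R
         * Cpowz z (- Z.of_nat s)
         * jtheta (- q (p * (j - 2 * s))%R * Cpowz z (Z.of_nat j)) (q (2 * j * p)%R)
         * sum_n_m (fun m : nat =>
             Cpow (RtoC (-1)) m
             * q (IZR (binom2 (Z.of_nat m + 1)) + m * (r - p))%R
             * (jtheta (- q (m * (2 * p + j) + p * (2 * r + 1))%R)
                  (q (2 * p * (2 * p + j))%R)
                - q (m * (2 * p + j) - m * (2 * r + 1))%R
                  * jtheta (- q (- m * (2 * p + j) + p * (2 * r + 1))%R)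
                      (q (2 * p * (2 * p + j))%R))
             * (q (m * s - 2 * p * s)%R
                * appell (- q (j * m - 2 * p * s)%R)
                    (- q (p * (j + 2 * s))%R * Cpowz z (- Z.of_nat j))
                    (q (2 * j * p)%R)
                + q (- m * s)%R
                  * appell (- q (j * m + 2 * p * s)%R)
                      (- q (p * (j - 2 * s))%R * Cpowz z (Z.of_nat j))
                      (q (2 * j * p)%R)))
             1 (p - 1))
       0 (j - 1))%C.
Proof.
intros q z P Hd Hdef.
apply char_defined_theta in Hd; [|exact htau].
unfold P. rewrite (character_numer p j r hp hj tau htau w Hd).
rewrite (numer_decomposition tau htau _ _ _ (Zof_nat_ge1 p hp) (Zof_nat_ge1 j hj) w Hd).
rewrite Cmult_plus_distr_l. f_equal.
(* The Laurent part: its residue classes modulo j give the terms with string functions. *)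
- rewrite (sum_n_m_from0 j _ hj).
  rewrite <- (quot_sum p j r hp hj tau w htau), <- csum_scal.
  apply csum_ext. intros s Hs.
  assert (EJ : jtheta (- Cpowz z (Z.of_nat j) * q (p * (j - 2 * s))%R) (q (2 * p * j)%R) =
    theta (RtoC (2 * j * p) * tau)%C (arg tau w (p * (j - 2 * s)) j)).
  { unfold z, q. rewrite opp_z_q, <- INR_IZR_INZ.
    replace (2 * p * j) with (2 * j * p) by ring. rewrite q_2jp. apply jtheta_theta. }
  rewrite EJ. unfold z, q.
  rewrite Cpowz_epow, opp_IZR, <- INR_IZR_INZ, Rmult_1_l.
  set (TH := theta _ _).
  assert (E := string_function_quot p j r hp hj tau htau s Hs).
  transitivity (kappa p j r tau * quot_coeff tau (Z.of_nat p) (Z.of_nat j) (Z.of_nat r) (-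
      Z.of_nat s)
     * (epow w (- s) * TH))%C; [ring|]. rewrite <- E. ring.
- rewrite (sum_n_m_from0 j _ hj).
  unfold q at 1. rewrite <- (jacobi_eta3 tau htau).
  (* Here m = i + 1. The factor q^(ps) is taken out of q^(binom2 p - p(r-s)), so that the remaining
     coefficient is the residue [rho i], independent of s. *)
  set (G := fun i s : nat => (epow w (- s) * q (p * s)%R *
        theta (RtoC (2 * j * p) * tau)%C (arg tau w (p * (j - 2 * s)) j) *
        (q (S i * s - 2 * p * s)%R * appell (- q (j * S i - 2 * p * s)%R)
           (- q (p * (j + 2 * s))%R * Cpowz z (- Z.of_nat j)) (q (2 * j * p)%R) +
         q (- S i * s)%R * appell (- q (j * S i + 2 * p * s)%R)
           (- q (p * (j - 2 * s))%R * Cpowz z (Z.of_nat j)) (q (2 * j * p)%R)))%C).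
  set (rho := fun i : nat => resid tau (Z.of_nat p) (Z.of_nat j) (Z.of_nat r)
                               (Z.of_nat (S i) - Z.of_nat p)).
  assert (EP : polar_part tau (Z.of_nat p) (Z.of_nat j) (Z.of_nat r) w =
    csum (p - 1) (fun i => rho i * csum j (G i))%C).
  { unfold polar_part, npol. replace (Z.to_nat (Z.of_nat p - 1)) with (p - 1)%nat by lia.
    apply csum_ext. intros i Hi. unfold G, q, z.
    rewrite (appell_sum p j r hp hj tau w htau (S i)).
    - replace (pidx (Z.of_nat p) i) with (Z.of_nat (S i) - Z.of_nat p)%Z by (unfold pidx; lia).
      rewrite (resid_opp tau htau _ _ _ (Zof_nat_ge1 p hp) (Zof_nat_ge1 j hj)).
      unfold rho. ring.
    - intros s Hs. apply (Hdef s (S i)); lia. }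
  rewrite EP. unfold Cdiv. rewrite Cmult_1_l.
  transitivity (/ eta3 tau * (kappa p j r tau * csum (p - 1) (fun i => rho i * csum j (G i))))%C;
    [ring|].
  f_equal. rewrite <- csum_scal.
  transitivity (csum (p - 1) (fun i => csum j (fun s => kappa p j r tau * (rho i * G i s))))%C.
  { apply csum_ext. intros i _. now rewrite !csum_scal. }
  (* The polar part sums over m outside and s inside; the theorem has the opposite order. *)
  rewrite csum_exchange. apply csum_ext. intros s Hs.
  rewrite (sum_n_m_from1 p _ hp), <- csum_scal. apply csum_ext. intros i Hi.
  unfold rho. rewrite <- (resid_E p j r hp hj tau htau (S i)). unfold G.
  assert (EJ : jtheta (- q (p * (j - 2 * s))%R * Cpowz z (Z.of_nat j)) (q (2 * j * p)%R) =
    theta (RtoC (2 * j * p) * tau)%C (arg tau w (p * (j - 2 * s)) j)).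
  { unfold z, q. rewrite opp_q_z, <- INR_IZR_INZ, q_2jp. apply jtheta_theta. }
  rewrite EJ, !Cpow_m1.
  replace (Cpowz z (- Z.of_nat s)) with (epow w (- s))
    by (unfold z; rewrite Cpowz_epow, opp_IZR, <- INR_IZR_INZ, Rmult_1_l; reflexivity).
  replace (q (IZR (binom2 (Z.of_nat p)) - p * (r - s))) with
    (q (IZR (binom2 (Z.of_nat p)) - p * r)%R * q (p * s)%R)%C
    by (unfold q; rewrite <- epow_add; f_equal; ring).
  fold (kappa p j r tau).
  change (epow tau) with q.
  change (q (- (1 / 8) + p * (2 * r + 1) ^ 2 / (4 * (2 * p + j)))) with (kappa p j r tau).
  ring.
Qed.
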